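(* Let $(\mathrm{M},\mathcal{G})$ be a complete built matroid. Then its Chow polynomial $\mathrm{H}(\mathrm{M},\mathcal{G})(t)$ is $\gamma$-positive.
   Context: $\mathrm{M}$ is a loopless matroid on a finite set $E$ with lattice of flats $\mathcal{L}$ (ordered by inclusion, $\hat0=\varnothing$, $\hat1=E$, $F\vee G=\operatorname{cl}_{\mathrm{M}}(F\cup G)$). A building set is $\mathcal{G}\subseteq\mathcal{L}\setminus\{\hat0\}$ such that for every $F\neq\hat0$ the join map $\prod_{G\in\max\mathcal{G}_{\leqslant F}}[\hat0,G]\to[\hat0,F]$ is a poset isomorphism, where $\max\mathcal{G}_{\leqslant F}$ is the set of maximal elements of $\{G\in\mathcal{G}:G\leqslant F\}$. A subset $\mathcal{S}\subseteq\mathcal{G}$ is nested if for every antichain $A\subseteq\mathcal{S}$ and every $\{S_1,\dots,S_k\}\subseteq A$ with $k\geqslant2$, $S_1\vee\dots\vee S_k\notin\mathcal{G}$. The Chow ring is $\mathrm{CH}(\mathrm{M},\mathcal{G})=\mathbb{Q}[x_G:G\in\mathcal{G}]/(I+J)$, $I$ generated by the monomials $x_{G_1}\cdots x_{G_k}$ with $\{G_1,\dots,G_k\}$ not nested, $J$ by $\sum_{G\in\mathcal{G},G\geqslant a}x_G$ for each atom $a$. The Chow polynomial $\mathrm{H}(\mathrm{M},\mathcal{G})(t)=\sum_i\dim\mathrm{CH}^i(\mathrm{M},\mathcal{G})t^i$ is palindromic of degree $d$; it is $\gamma$-positive if in the unique expansion $\sum_{i=0}^{\lfloor d/2\rfloor}\gamma_it^i(1+t)^{d-2i}$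 all $\gamma_i\geqslant0$. Completeness: for a total order $\vartriangleleft$ on $E$ and flats $F\leqslant G$, with $G\setminus F=\{e_1\vartriangleleft\dots\vartriangleleft e_k\}$ and $F_i=\operatorname{cl}_{\mathrm{M}}(F\cup\{e_1,\dots,e_i\})$, let $C_\vartriangleleft(F,G)=\{F,F_1,\dots,F_k\}$. Let $\mathcal{G}_F=\{F\vee H:H\in\mathcal{G}\}\setminus\{F\}$ and $\mathcal{G}_F^G=\mathcal{G}_F\cap[F,G]$. $(\mathrm{M},\mathcal{G})$ is complete if for some total order $\vartriangleleft$ on $E$, $C_\vartriangleleft(F,G)\subseteq\mathcal{G}_F^G\cup\{F\}$ for every flat $F$ and every $G\in\mathcal{G}$ with $F\leqslant G$. *)

(* Defs.v *)
From HB Require Import structures.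
From mathcomp Require Import all_boot all_order all_algebra.
From mathcomp Require Import mpoly.

Unset Strict Implicit.
Unset Printing Implicit Defensive.

Import GRing.Theory Num.Theory.

Section BuiltMatroids.
Variable E : finType.
Implicit Types (A B X F G a : {set E}) (I Gs S T : {set {set E}}).

Definition is_matroid I : Prop :=
  [/\ set0 \in I,
      (forall A B, B \in I -> A \subset B -> A \in I) &
      (forall A B, A \in I -> B \in I -> (#|A| < #|B|)%N ->
         exists2 e, e \in B :\: A & e |: A \in I)].

Definition mrank I X : nat := \max_(A in I | A \subset X) #|A|.
Definition mcl I X : {set E} := [set e | mrank I (e |: X) == mrank I X].

Definition loopless I : Prop := forall e : E, [set e] \in I.

(** flats; the lattice of flats is ordered by inclusion, 0 = set0, 1 = E *)
Definition is_flat I F : Prop := mcl I F = F.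
Definition fjoin I F G : {set E} := mcl I (F :|: G).
Definition bigfjoin I S : {set E} := mcl I (\bigcup_(X in S) X).

Definition is_atom I a : Prop :=
  [/\ is_flat I a, a != set0 &
      forall X, is_flat I X -> X \subset a -> X = set0 \/ X = a].

Definition maxbelow Gs F : {set {set E}} :=
  [set G in Gs | (G \subset F) &&
     [forall H in Gs, ((H \subset F) && (G \subset H)) ==> (H == G)]].

(** elements of the product  prod_{G in Ms} [0, G]  of intervals of flats,
    encoded as finite functions (value set0 outside Ms) *)
Definition in_prod I (Ms : {set {set E}}) (h : {ffun {set E} -> {set E}}) : Prop :=
  forall G, (G \in Ms -> is_flat I (h G) /\ h G \subset G) /\
            (G \notin Ms -> h G = set0).
Definition prod_le (Ms : {set {set E}}) (h1 h2 : {ffun {set E} -> {set E}}) : Prop :=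
  forall G, G \in Ms -> h1 G \subset h2 G.
Definition join_map I (Ms : {set {set E}}) (h : {ffun {set E} -> {set E}}) : {set E} :=
  mcl I (\bigcup_(G in Ms) h G).

(** building set: G \subset L \ {0}, and for every flat F <> 0 the join map
    prod_{G in max G_{<=F}} [0,G] -> [0,F] is a poset isomorphism
    (maps into [0,F], is an order embedding, and is surjective). *)
Definition is_building_set I Gs : Prop :=
  (forall G, G \in Gs -> is_flat I G /\ G != set0) /\
  (forall F, is_flat I F -> F != set0 ->
     [/\ (forall h, in_prod I (maxbelow Gs F) h ->
            join_map I (maxbelow Gs F) h \subset F),
         (forall h1 h2, in_prod I (maxbelow Gs F) h1 -> in_prod I (maxbelow Gs F) h2 ->
            (prod_le (maxbelow Gs F) h1 h2 <->
             join_map I (maxbelow Gs F) h1 \subset join_map I (maxbelow Gs F) h2)) &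
         (forall X, is_flat I X -> X \subset F ->
            exists2 h, in_prod I (maxbelow Gs F) h & join_map I (maxbelow Gs F) h = X)]).

Definition antichain S : Prop :=
  forall X Y, X \in S -> Y \in S -> X \subset Y -> X = Y.

Definition nested I Gs S : Prop :=
  S \subset Gs /\
  forall Ac : {set {set E}}, Ac \subset S -> antichain Ac ->
    forall T, T \subset Ac -> (1 < #|T|)%N -> bigfjoin I T \notin Gs.

(** The Chow ring CH(M,G) = Q[x_G : G in Gs] / (I + J).
    Variables are indexed by 'I_#|Gs|, the variable j standing for x_{enum_val j}. *)
Definition chow_gen I Gs (p : {mpoly rat[#|Gs|]}) : Prop :=
  (exists U : {set 'I_#|Gs|},
     ~ nested I Gs [set enum_val j | j in U] /\ p = (\prod_(j in U) 'X_j)%R)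
  \/
  (exists a, is_atom I a /\ p = (\sum_(j : 'I_#|Gs| | a \subset enum_val j) 'X_j)%R).

Definition in_chow_ideal I Gs (p : {mpoly rat[#|Gs|]}) : Prop :=
  exists s : seq ({mpoly rat[#|Gs|]} * {mpoly rat[#|Gs|]}),
    (forall x, x \in s -> chow_gen I Gs x.2) /\
    p = (\sum_(x <- s) x.1 * x.2)%R.

(** homogeneous of degree d (the zero polynomial included) *)
Definition homog_of_deg {n : nat} (d : nat) (p : {mpoly rat[n]}) : Prop :=
  forall m, m \in msupp p -> mdeg m = d.

(** dim_Q CH^i(M,G) = k : the degree-i part of Q[x] has, modulo I + J,
    a basis of k elements *)
Definition chow_dim I Gs (i k : nat) : Prop :=
  exists b : 'I_k -> {mpoly rat[#|Gs|]},
    [/\ forall j, homog_of_deg i (b j),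
        (forall c : 'I_k -> rat,
           in_chow_ideal I Gs (\sum_j c j *: b j)%R -> forall j, c j = 0%R) &
        (forall p, homog_of_deg i p ->
           exists c : 'I_k -> rat, in_chow_ideal I Gs (p - \sum_j c j *: b j)%R)].

Definition is_chow_poly I Gs (H : {poly rat}) : Prop :=
  forall i, exists k, chow_dim I Gs i k /\ (H`_i = k%:R)%R.

(** completeness, the total order on E being given by an enumeration s of E *)
Definition chainC I (s : seq E) F G : {set {set E}} :=
  let l := [seq e <- s | e \in G :\: F] in
  [set mcl I (F :|: [set x in take i l]) | i : 'I_(size l).+1].
Definition GF I Gs F : {set {set E}} := [set fjoin I F H | H in Gs] :\ F.
Definition GFG I Gs F G : {set {set E}} :=
  [set X in GF I Gs F | (F \subset X) && (X \subset G)].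

Definition complete I Gs : Prop :=
  exists s : seq E, [/\ uniq s, (forall e, e \in s) &
    forall F G, is_flat I F -> G \in Gs -> F \subset G ->
      chainC I s F G \subset GFG I Gs F G :|: [set F]].

End BuiltMatroids.

Arguments is_matroid {E}.
Arguments mrank {E}.
Arguments mcl {E}.
Arguments loopless {E}.
Arguments is_flat {E}.
Arguments fjoin {E}.
Arguments bigfjoin {E}.
Arguments is_atom {E}.
Arguments maxbelow {E}.
Arguments in_prod {E}.
Arguments prod_le {E}.
Arguments join_map {E}.
Arguments is_building_set {E}.
Arguments antichain {E}.
Arguments nested {E}.
Arguments chow_gen {E}.
Arguments in_chow_ideal {E}.
Arguments chow_dim {E}.
Arguments is_chow_poly {E}.
Arguments chainC {E}.
Arguments GF {E}.
Arguments GFG {E}.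
Arguments complete {E}.

Definition gamma_positive (H : {poly rat}) : Prop :=
  exists g : nat -> rat,
    (forall i, 0 <= g i)%R /\
    H = (\sum_(i < ((size H).-1 %/ 2).+1)
           g i *: ('X^i * (1 + 'X) ^+ ((size H).-1 - 2 * i)))%R.

(* Main.v *)
Require Import Defs.
From HB Require Import structures.
From mathcomp Require Import all_boot all_order all_algebra.
From mathcomp Require Import ssrcomplements mpoly.
From mathcomp Require Import zify ring.

(**
  Dimension count. Put h_G = \sum_(K >= G) x_K. The relations
  x_A h_G^(rk G - rk(join A)) = 0 of Feichtner and Yuzvinsky reduce every
  monomial to combinations of the x^m with nested support S and
  m_G < rk G - rk(join of S below G). For independence, work in the variables
  h: the functional L that sends a monomial h_(F1)...h_(Fk) to 1 if every
  nonempty subfamily satisfies rk(union) > cardinality (the dragon Hall-Rado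
  condition), and to 0 otherwise, kills the Chow ideal, because it kills
  (h_F - h_J)(h_G - h_J) for J = F v G. By Moebius inversion, L(x_F h^m) is 0 or
  -1, and it restricts to L on the contraction by F; this makes the pairing of
  the reduced monomials x^m with suitable h-monomials triangular for a
  lexicographic order, with diagonal entries 1 or -1.

  Gamma-positivity. With A(X) the sum over nested S with join X of
  \prod_(G in S) (t + ... + t^(d_G - 1)), the Chow polynomial is \sum_X A(X), A is
  multiplicative over the components of X, and
  A(G) = \sum_(F < G) A(F) (t + ... + t^(rk G - rk F - 1)) for G in the building
  set. Grouping the flats F along lexicographic chains up to G turns these weights
  into t(1 + t)^(d - 2), with A(F) replaced by the part of it that does not continue
  a lexicographic chain. Completeness says that such a chain can enter F in only
  one component K of F, so that this part is A(F \ K) times a partial sum of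
  the same kind for K, and induction on the rank applies.
*)

(** The obstacle is subtraction: regrouping along chains replaces [av F] by a difference without
    evident sign. What is subtracted turns out to be indexed by those flats Y below the component K
    whose own chain to K is complete before the first element of G \ F. The difference is therefore
    the recursion for K truncated at a threshold, which is why the induction concerns the
    truncations [pm G m] for all m and not only [av G]. Truncation is compatible with regrouping,
    since all flats on one chain to G reach G at the same threshold. With U = sum_d (t + ... +
    t^(d-1)) z^d = t z^2 / ((1 - z)(1 - t z)), the regrouped weights are the coefficients of U / (1
    - U) = t z^2 / (1 - (1 + t) z). E is not assumed to belong to the building set. Its components,
    the maximal elements [top], split the matroid as a direct sum and need separate treatment
    throughout the proof of independence. *)

Set Implicit Arguments.
Unset Strict Implicit.
Unset Printing Implicit Defensive.
Import GRing.Theory Num.Theory.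

(** * Matroid rank and closure *)

Section MatroidRank.
Variables (E : finType) (I : {set {set E}}).
Hypothesis matI : is_matroid I.
Implicit Types (A B X Y Z F G : {set E}).
Notation rk := (mrank I).
Notation cl := (mcl I).

Lemma leq_rank A X : A \in I -> A \subset X -> #|A| <= rk X.
Proof. by move=> hA hs; rewrite /mrank (bigD1 A) ?hA //= leq_maxl. Qed.

Lemma rank_basis X : exists B, [/\ B \in I, B \subset X & #|B| = rk X].
Proof.
have [h0 _ _] := matI.
have hc : 0 < #|[pred A : {set E} | (A \in I) && (A \subset X)]|.
  by apply/card_gt0P; exists set0; rewrite inE h0 sub0set.
have [B /andP[hB hs] e] := eq_bigmax_cond (fun A : {set E} => #|A|) hc.
by exists B; split.
Qed.

Lemma rankS X Y : X \subset Y -> rk X <= rk Y.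
Proof.
move=> h; have [B [hB hs <-]] := rank_basis X.
by apply: leq_rank => //; apply: subset_trans h.
Qed.

Lemma basis_extend B X : B \in I -> B \subset X ->
  exists B', [/\ B' \in I, B \subset B', B' \subset X & #|B'| = rk X].
Proof.
have [_ _ aug] := matI.
move: {2}(rk X - #|B|) (leqnn (rk X - #|B|)) => n.
elim: n B => [|n IH] B hn hB hs.
  exists B; split=> //; apply/eqP; rewrite eqn_leq leq_rank //=; lia.
case: (ltnP #|B| (rk X)) => [lt|ge]; last first.
  by exists B; split=> //; apply/eqP; rewrite eqn_leq leq_rank.
have [C [hC sC cC]] := rank_basis X.
have [|e eC eI] := aug B C hB hC; first by rewrite cC.
move: eC; rewrite inE => /andP[eB eC].
have [||| B' [h1 h2 h3 h4]] := IH (e |: B).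
- by rewrite cardsU1 eB; lia.
- by [].
- by rewrite subUset sub1set (subsetP sC).
exists B'; split=> //; apply: subset_trans h2; exact: subsetUr.
Qed.

Lemma rank_submod X Y : rk (X :|: Y) + rk (X :&: Y) <= rk X + rk Y.
Proof.
have [_ her _] := matI.
have [B [hB sB <-]] := rank_basis (X :&: Y).
have [|B' [hB' BB' sB' <-]] := basis_extend (B:=B) (X:=X :|: Y) hB.
  by apply: subset_trans sB _; apply: subset_trans (subsetIl _ _) (subsetUl _ _).
have hX : #|B' :&: X| <= rk X.
  by apply: leq_rank (subsetIr _ _); apply: her hB' (subsetIl _ _).
have hY : #|B' :&: Y| <= rk Y.
  by apply: leq_rank (subsetIr _ _); apply: her hB' (subsetIl _ _).
have e1 : (B' :&: X) :|: (B' :&: Y) = B' by rewrite -setIUr; apply/setIidPl.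
have e2 : #|B| <= #|(B' :&: X) :&: (B' :&: Y)|.
  by rewrite subset_leq_card // -setIIr subsetI BB'.
by have := cardsUI (B' :&: X) (B' :&: Y); rewrite e1; lia.
Qed.

Lemma rank_leq_card X : rk X <= #|X|.
Proof. by have [B [_ s <-]] := rank_basis X; apply: subset_leq_card. Qed.

Lemma rank0 : rk set0 = 0.
Proof. by apply/eqP; rewrite -leqn0 -(cards0 E) rank_leq_card. Qed.

Lemma rankU X Y : rk (X :|: Y) <= rk X + rk Y.
Proof. by have := rank_submod X Y; lia. Qed.

Lemma rankU1 e X : rk (e |: X) <= (rk X).+1.
Proof.
by have := rankU [set e] X; have := rank_leq_card [set e]; rewrite cards1; lia.
Qed.

Lemma mem_cl e X : (e \in cl X) = (rk (e |: X) == rk X).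
Proof. by rewrite inE. Qed.

Lemma rank_clU X Y : Y \subset cl X -> rk (X :|: Y) = rk X.
Proof.
move: {2}#|Y| (erefl #|Y|) => n; elim: n Y => [|n IH] Y.
  by move/eqP; rewrite cards_eq0 => /eqP-> _; rewrite setU0.
move=> hc hs; have /card_gt0P[e eY] : 0 < #|Y| by rewrite hc.
have hY : #|Y :\ e| = n by have := cardsD1 e Y; rewrite eY hc; lia.
have hs' : Y :\ e \subset cl X by apply: subset_trans hs; apply: subsetDl.
have r1 := IH _ hY hs'.
have /eqP r2 : rk (e |: X) == rk X by rewrite -mem_cl (subsetP hs).
have := rank_submod (X :|: Y :\ e) (e |: X).
have -> : X :|: Y :\ e :|: (e |: X) = X :|: Y.
  apply/setP => z; rewrite !inE; case: eqP => [->|_]; rewrite ?eY ?orbT //=.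
  by case: (z \in X); case: (z \in Y).
have := @rankS X ((X :|: Y :\ e) :&: (e |: X)).
rewrite subsetI subsetUl subsetUr => /(_ isT).
have := @rankS X (X :|: Y); rewrite subsetUl => /(_ isT).
lia.
Qed.

Lemma sub_cl X : X \subset cl X.
Proof. by apply/subsetP => e eX; rewrite mem_cl; rewrite (setUidPr _) ?sub1set. Qed.

Lemma rank_cl X : rk (cl X) = rk X.
Proof.
by rewrite -[RHS](rank_clU (subxx (cl X))); congr (rk _); apply/esym/setUidPr/sub_cl.
Qed.

Lemma sub_clP X Y : reflect (rk (X :|: Y) = rk X) (Y \subset cl X).
Proof.
apply: (iffP idP); first exact: rank_clU.
move=> h; apply/subsetP => e eY; rewrite mem_cl eqn_leq.
rewrite -[X in _ <= X]h !rankS ?subsetUr //.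
by rewrite setUC setUS // sub1set.
Qed.

Lemma sub_cl_rank X Y : X \subset Y -> rk Y <= rk X -> Y \subset cl X.
Proof.
move=> h1 h2; apply/sub_clP; rewrite (setUidPr h1).
by apply/eqP; rewrite eqn_leq h2 rankS.
Qed.

Lemma clS X Y : X \subset Y -> cl X \subset cl Y.
Proof.
move=> h; apply/sub_clP.
have := rank_submod Y (cl X); have := @rankS X (Y :&: cl X).
rewrite subsetI h sub_cl => /(_ isT); rewrite rank_cl.
by have := @rankS Y (Y :|: cl X) (subsetUl _ _); lia.
Qed.

Lemma cl_id X : cl (cl X) = cl X.
Proof.
apply/eqP; rewrite eqEsubset [cl X \subset _]sub_cl andbT.
apply: sub_cl_rank; last by rewrite !rank_cl.
exact: subset_trans (sub_cl _) (sub_cl _).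
Qed.

Definition mflat F := cl F == F.
Notation flat := mflat.

Lemma flatP F : reflect (is_flat I F) (flat F).
Proof. exact: eqP. Qed.

Lemma flat_cl X : flat (cl X).
Proof. by rewrite /flat cl_id. Qed.

Lemma cl_sub F X : flat F -> X \subset F -> cl X \subset F.
Proof. by move=> /eqP hF /clS; rewrite hF. Qed.

Lemma sub_clE X Y : (X \subset cl Y) = (cl X \subset cl Y).
Proof.
apply/idP/idP => h; last exact: subset_trans (sub_cl _) h.
exact: cl_sub (flat_cl _) h.
Qed.

Lemma clUS X X' Y : X \subset cl X' -> cl (X :|: Y) \subset cl (X' :|: Y).
Proof.
move=> h; rewrite -sub_clE subUset; apply/andP; split.
  by apply: subset_trans h _; apply: clS; apply: subsetUl.
by apply: subset_trans (sub_cl _); apply: subsetUr.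
Qed.

Lemma clUcl X Y : cl (cl X :|: Y) = cl (X :|: Y).
Proof.
apply/eqP; rewrite eqEsubset clUS //= clUS //.
by rewrite cl_id sub_cl.
Qed.

Lemma flatI F G : flat F -> flat G -> flat (F :&: G).
Proof.
move=> hF hG; rewrite /flat eqEsubset sub_cl andbT subsetI.
by rewrite !cl_sub ?subsetIl ?subsetIr.
Qed.

Lemma flatT : flat [set: E].
Proof. by rewrite /flat eqEsubset sub_cl subsetT. Qed.

Lemma flat_rank_lt F X : flat F -> F \proper X -> rk F < rk X.
Proof.
move=> /eqP hF /properP[s [e eX eF]]; rewrite ltnNge; apply: contra eF => h.
by rewrite -hF; apply: (subsetP (sub_cl_rank s h)).
Qed.

Lemma flat_rank_eq F X : flat F -> F \subset X -> rk X <= rk F -> F = X.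
Proof.
move=> hF s h; apply/eqP; rewrite eqEsubset s /= -(eqP hF).
exact: sub_cl_rank.
Qed.

Lemma rank_eq_cl X Y : cl X = cl Y -> rk X = rk Y.
Proof. by move=> h; rewrite -rank_cl h rank_cl. Qed.

Hypothesis loopI : loopless I.

Lemma rank_set1 e : rk [set e] = 1.
Proof.
apply/eqP; rewrite eqn_leq -{1}(cards1 e) rank_leq_card /=.
by rewrite -{1}(cards1 e) leq_rank.
Qed.

Lemma flat0 : flat set0.
Proof.
rewrite /flat eqEsubset sub_cl andbT; apply/subsetP => e.
by rewrite mem_cl setU0 rank_set1 rank0.
Qed.

Lemma cl0 : cl set0 = set0. Proof. exact/eqP/flat0. Qed.

Lemma rank_gt0 X : X != set0 -> 0 < rk X.
Proof.
case/set0Pn=> e eX; have := @rankS [set e] X.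
by rewrite sub1set rank_set1 => /(_ eX).
Qed.

Lemma cl_set1_atom e : is_atom I (cl [set e]).
Proof.
split; first exact/flatP/flat_cl.
  by apply/set0Pn; exists e; rewrite (subsetP (sub_cl _)) ?set11.
move=> X /flatP hX s; case: (altP (X =P set0)) => [->|h]; [by left|right].
by apply: flat_rank_eq => //; rewrite rank_cl rank_set1 rank_gt0.
Qed.

End MatroidRank.

(** * Building sets and nested sets *)

Section BuildingSets.
Variables (E : finType) (I Gs : {set {set E}}).
Hypotheses (matI : is_matroid I) (loopI : loopless I).
Hypothesis bldG : is_building_set I Gs.
Implicit Types (A B X Y Z F G K : {set E}) (S T P : {set {set E}}).
Notation rk := (mrank I).
Notation cl := (mcl I).
Notation flat := (mflat I).
Notation comps := (maxbelow Gs).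

Lemma building_flat G : G \in Gs -> flat G.
Proof. by move=> h; apply/flatP; case: bldG => /(_ G h)[]. Qed.

Lemma building_neq0 G : G \in Gs -> G != set0.
Proof. by move=> h; case: bldG => /(_ G h)[]. Qed.

Lemma compsP X K : reflect [/\ K \in Gs, K \subset X &
   forall H, H \in Gs -> H \subset X -> K \subset H -> H = K] (K \in comps X).
Proof.
rewrite inE; apply: (iffP and3P) => [[h1 h2 /forall_inP h3]|[h1 h2 h3]]; split=> //.
  by move=> H a b c; apply/eqP; apply: (implyP (h3 H a)); rewrite b.
by apply/forall_inP => H a; apply/implyP => /andP[b c]; apply/eqP/h3.
Qed.

Lemma comps_building X K : K \in comps X -> K \in Gs.
Proof. by case/compsP. Qed.

Lemma comps_sub X K : K \in comps X -> K \subset X.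
Proof. by case/compsP. Qed.

Lemma comps_above X G : G \in Gs -> G \subset X ->
  exists2 K, K \in comps X & G \subset K.
Proof.
move=> hG sG.
pose Q := [pred K : {set E} | [&& K \in Gs, K \subset X & G \subset K]].
have hQ : Q G by rewrite /Q /= hG sG subxx.
case: (arg_maxnP (fun K : {set E} => #|K|) hQ) => K /and3P[h1 h2 h3] hm.
exists K => //; apply/compsP; split=> // H a b c; apply/esym/eqP.
rewrite eqEcard c; apply: hm; rewrite /Q /= a b; exact: subset_trans c.
Qed.

Lemma bigcup_clE (J : finType) (Q : pred J) (f : J -> {set E}) :
  cl (\bigcup_(j | Q j) cl (f j)) = cl (\bigcup_(j | Q j) f j).
Proof.
apply/eqP; rewrite eqEsubset -(sub_clE matI); apply/andP; split.
  by apply/bigcupsP => j hj; apply: clS => //; apply: bigcup_sup.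
apply: clS => //; apply/bigcupsP => j hj; apply: subset_trans (sub_cl _ _) _ => //.
exact: (bigcup_sup j).
Qed.

(** The element of the product of intervals that is the atom of e at K and 0 elsewhere. Its join is
    cl {e} for every component K, so comparing such elements extracts what the poset isomorphism
    says about single elements of E. *)
Definition single_fun (K : {set E}) (e : E) : {ffun {set E} -> {set E}} :=
  [ffun G : {set E} => if G == K then cl [set e] else set0].

Lemma single_fun_prod X K e : K \in comps X -> e \in K ->
  in_prod I (comps X) (single_fun K e).
Proof.
move=> hK eK G; rewrite ffunE; case: eqP => [->|_].
  split=> [_|/negP//]; split; first exact/flatP/flat_cl.
  by apply: cl_sub => //; [exact/building_flat/comps_building/hK|rewrite sub1set].
by split=> // _; split; [exact/flatP/flat0|apply: sub0set].
Qed.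

Lemma single_fun_join X K e : K \in comps X ->
  join_map I (comps X) (single_fun K e) = cl [set e].
Proof.
move=> hK; rewrite /join_map -[RHS]cl_id //; congr (cl _).
apply/eqP; rewrite eqEsubset; apply/andP; split.
  by apply/bigcupsP => G _; rewrite ffunE; case: eqP => _ //; apply: sub0set.
by rewrite (bigcup_max K) // ffunE eqxx.
Qed.

(** The atom of e placed at K and the one placed at K' have the same join, and the join map is an
    order embedding. *)
Lemma comps_disjoint X K K' e : flat X -> K \in comps X -> K' \in comps X ->
  e \in K -> e \in K' -> K = K'.
Proof.
move=> hX hK hK' eK eK'; apply/eqP; apply: contraT => neq.
have X0 : X != set0 by apply/set0Pn; exists e; apply: (subsetP (comps_sub hK)).
case: bldG => _ /(_ X (elimT (flatP _ _) hX) X0)[_ emb _].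
have [_] := emb _ _ (single_fun_prod hK eK) (single_fun_prod hK' eK').
rewrite !single_fun_join // => /(_ (subxx _) K hK).
rewrite !ffunE eqxx (negPf neq) subset0 => /eqP h.
by have := subsetP (sub_cl I [set e]) e (set11 e); rewrite h inE.
Qed.

(** The join map reaches cl {e}; a nonzero coordinate of a preimage lies below this atom and so
    equals it. *)
Lemma comps_cover X e : flat X -> e \in X -> exists2 K, K \in comps X & e \in K.
Proof.
move=> hX eX; have X0 : X != set0 by apply/set0Pn; exists e.
case: bldG => _ /(_ X (elimT (flatP _ _) hX) X0)[_ _ /(_ (cl [set e]))].
case; [exact/flatP/flat_cl|by apply: cl_sub; rewrite ?sub1set|move=> h hh hj].
have [_ _ at3] := cl_set1_atom matI loopI e.
have /existsP[K /andP[hK hK0]] : [exists K in comps X, h K != set0].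
  apply: contraT => /existsPn hn.
  move: (set11 e) => /(subsetP (sub_cl I [set e])); rewrite -hj /join_map big1 ?cl0 ?inE //.
  by move=> G hG; apply/eqP; have := hn G; rewrite hG negbK.
have [hf hs] := (hh K).1 hK.
case: (at3 (h K) hf) => [|h0|h1].
- rewrite -hj; apply: subset_trans (sub_cl _ _) => //; exact: (bigcup_sup K).
- by rewrite h0 eqxx in hK0.
exists K => //; apply: (subsetP hs); rewrite h1; exact: (subsetP (sub_cl I _) _ (set11 e)).
Qed.

(** The tuple of all cl (Y :&: G), G a component, has join cl Y; the order embedding compares it at
    K with the atom of e. Together with [cl_compsC] this makes the restriction to X the direct sum
    of its components. *)
Lemma cl_comps X Y K e : flat X -> Y \subset X -> K \in comps X -> e \in K ->
  e \in cl Y -> e \in cl (Y :&: K).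
Proof.
move=> hX YX hK eK eY.
have X0 : X != set0 by apply/set0Pn; exists e; apply: (subsetP (comps_sub hK)).
case: bldG => _ /(_ X (elimT (flatP _ _) hX) X0)[_ emb _].
pose h : {ffun {set E} -> {set E}} :=
  [ffun G : {set E} => if G \in comps X then cl (Y :&: G) else set0].
have hp : in_prod I (comps X) h.
  move=> G; rewrite ffunE; case: ifP => hG; split=> // _; split.
    exact/flatP/flat_cl.
  by apply: cl_sub; rewrite ?subsetIr //; apply/building_flat/comps_building/hG.
have hj : join_map I (comps X) h = cl Y.
  rewrite /join_map (eq_bigr (fun G => cl (Y :&: G))); last first.
    by move=> G hG; rewrite ffunE hG.
  rewrite bigcup_clE; congr (cl _); apply/setP => z; apply/bigcupP/idP.
    by case=> G _ /setIP[].
  move=> zY; have [G hG zG] := comps_cover hX (subsetP YX z zY).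
  by exists G; rewrite // inE zY.
have [_] := emb _ _ (single_fun_prod hK eK) hp.
rewrite single_fun_join // hj -sub_clE // sub1set => /(_ eY K hK).
rewrite !ffunE eqxx hK -sub_clE // sub1set; exact.
Qed.

Lemma cl_compsC X Y K e : flat X -> Y \subset X -> K \in comps X ->
  e \in X -> e \notin K -> e \in cl Y -> e \in cl (Y :\: K).
Proof.
move=> hX YX hK eX eK eY; have [K' hK' eK'] := comps_cover hX eX.
have := cl_comps hX YX hK' eK' eY; apply: (subsetP (clS _ _)) => //.
apply/subsetP => z /setIP[zY zK']; rewrite inE zY andbT; apply: contra eK => zK.
by rewrite (comps_disjoint hX hK hK' zK zK').
Qed.

(** By the two closure lemmas, adding e raises the rank of Y exactly when it raises the rank of the
    part of Y, inside or outside K, that e joins. *)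
Lemma rank_split X Y K : flat X -> Y \subset X -> K \in comps X ->
  rk Y = rk (Y :&: K) + rk (Y :\: K).
Proof.
move=> hX + hK; move: {2}#|Y| (erefl #|Y|) => n; elim: n Y => [|n IH] Y.
  by move/eqP; rewrite cards_eq0 => /eqP-> _; rewrite set0I set0D rank0.
move=> hc hs; have /card_gt0P[e eY] : 0 < #|Y| by rewrite hc.
have hn : #|Y :\ e| = n by have := cardsD1 e Y; rewrite eY hc; lia.
have hs' : Y :\ e \subset X by apply: subset_trans hs; apply: subsetDl.
have IHe := IH _ hn hs'.
have rkadd Z : rk (e |: Z) = rk Z + (e \notin cl Z).
  rewrite mem_cl; case: eqP => [->|] /=; first by rewrite addn0.
  have := rankU1 matI e Z; have := rankS matI (subsetUr [set e] Z); lia.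
have eX := subsetP hs e eY.
rewrite -{1 2 3}(setD1K eY); case: (boolP (e \in K)) => eK.
  have -> : (e |: Y :\ e) :&: K = e |: (Y :\ e) :&: K.
    by rewrite setIUl; congr (_ :|: _); apply/setIidPl; rewrite sub1set.
  have -> : (e |: Y :\ e) :\: K = (Y :\ e) :\: K.
    by rewrite setDUl (_ : [set e] :\: K = set0) ?set0U //; apply/eqP; rewrite setD_eq0 sub1set.
  rewrite !rkadd IHe addnAC; congr (_ + nat_of_bool (~~ _) + _).
  apply/idP/idP; first exact: (cl_comps hX hs' hK eK).
  by apply: (subsetP (clS _ _)) => //; apply: subsetIl.
have -> : (e |: Y :\ e) :&: K = (Y :\ e) :&: K.
  by rewrite setIUl (_ : [set e] :&: K = set0) ?set0U //; apply/eqP; rewrite setI_eq0 disjoints1.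
have -> : (e |: Y :\ e) :\: K = e |: (Y :\ e) :\: K.
  rewrite setDUl; congr (_ :|: _); apply/setP => z; rewrite !inE.
  by case: eqP => [->|]; rewrite ?eK ?andbF.
rewrite !rkadd IHe addnA; congr (_ + nat_of_bool (~~ _)).
apply/idP/idP; first exact: (cl_compsC hX hs' hK eX eK).
by apply: (subsetP (clS _ _)) => //; apply: subsetDl.
Qed.

Lemma building_comps X K G : flat X -> K \in comps X -> G \in Gs -> G \subset X ->
  (G \subset K) || [disjoint G & K].
Proof.
move=> hX hK hG sG; have [K' hK' sK'] := comps_above hG sG.
case: (boolP [disjoint G & K]) => [_|]; first by rewrite orbT.
rewrite -setI_eq0 => /set0Pn[e /setIP[eG eK]]; rewrite orbF.
by rewrite (comps_disjoint hX hK hK' eK (subsetP sK' e eG)).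
Qed.

(** In the join X, the components above G and above K share e and coincide; this component contains
    G and K, hence is X. *)
Lemma building_join G K e : G \in Gs -> K \in Gs -> e \in G -> e \in K ->
  cl (G :|: K) \in Gs.
Proof.
move=> hG hK eG eK; set X := cl _.
have hX : flat X by apply: flat_cl.
have sub (H : {set E}) : H \subset G :|: K -> H \subset X.
  by move=> h; rewrite /X; apply: subset_trans h _; apply: sub_cl.
have [C hC GC] := comps_above hG (sub _ (subsetUl _ _)).
have [C' hC' KC'] := comps_above hK (sub _ (subsetUr _ _)).
have CC' := comps_disjoint hX hC hC' (subsetP GC e eG) (subsetP KC' e eK).
suff -> : X = C by apply: comps_building hC.
apply/eqP; rewrite eqEsubset (comps_sub hC) andbT; apply: cl_sub => //.
  exact/building_flat/comps_building/hC.
by rewrite subUset GC CC'.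
Qed.

Lemma building_atom a : is_atom I a -> a \in Gs.
Proof.
move=> [/flatP ha a0 hmin]; have /set0Pn[e ea] := a0.
have [K hK eK] := comps_cover ha ea.
have /flatP hKf := building_flat (comps_building hK).
case: (hmin K hKf (comps_sub hK)) => [K0|<-]; last exact: comps_building hK.
by rewrite K0 inE in eK.
Qed.

(** Read as an upper sum of the indicator of [comps X], this is the form in which components enter
    Moebius inversion later. *)
Lemma comps_sum X G : G \in Gs -> flat X ->
  #|[set K in comps X | G \subset K]| = (G \subset X).
Proof.
move=> hG hX; case: (boolP (G \subset X)) => sG; last first.
  apply/eqP; rewrite cards_eq0; apply/eqP/setP => K; rewrite !inE.
  apply/negP => /andP[/and3P[_ KX _] GK]; case/negP: sG; exact: subset_trans KX.
have [K hK GK] := comps_above hG sG.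
apply/eqP/cards1P; exists K; apply/setP => K'; rewrite in_set in_set1.
apply/andP/eqP => [[hK' GK']|->//].
have /set0Pn[e eG] := building_neq0 hG.
by apply: (comps_disjoint hX hK' hK (subsetP GK' e eG) (subsetP GK e eG)).
Qed.

(** * Nested sets and the components of their joins *)

Definition antichainb T := [forall X in T, forall Y in T, (X \subset Y) ==> (X == Y)].

Lemma antichainP T : reflect (antichain T) (antichainb T).
Proof.
apply: (iffP forall_inP) => [h X Y hX hY s|h X hX].
  by apply/eqP; apply: (implyP (forall_inP (h X hX) Y hY)).
by apply/forall_inP => Y hY; apply/implyP => s; apply/eqP/h.
Qed.

(** One quantifier replaces the two of [nested], as a subset of an antichain is an antichain. *)
Definition is_nested S := (S \subset Gs) &&
  [forall T : {set {set E}}, [&& T \subset S, antichainb T & 1 < #|T|]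
     ==> (cl (cover T) \notin Gs)].
Notation nestedb := is_nested.

Lemma nestedP S : reflect (nested I Gs S) (nestedb S).
Proof.
apply: (iffP andP) => [[h1 /forallP h2]|[h1 h2]]; split=> //.
  move=> Ac hs ha T hT c; apply: (implyP (h2 T)); rewrite c andbT.
  rewrite (subset_trans hT hs); apply/antichainP => X Y hX hY.
  by apply: ha; apply: (subsetP hT).
apply/forallP => T; apply/implyP => /and3P[a /antichainP b c].
exact: (h2 T a b T).
Qed.

Lemma nested_sub S T : nestedb S -> T \subset S -> nestedb T.
Proof.
move=> /andP[h1 /forallP h2] s; rewrite /nestedb (subset_trans s h1).
apply/forallP => U; apply/implyP => /and3P[a b c]; apply: (implyP (h2 U)).
by rewrite b c (subset_trans a s).
Qed.

Lemma nested_building S G : nestedb S -> G \in S -> G \in Gs.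
Proof. by move=> /andP[h _]; apply: (subsetP h). Qed.

Definition maxelts T := [set X in T | [forall Y in T, (X \subset Y) ==> (Y == X)]].

Lemma maxeltsP T X : reflect (X \in T /\ forall Y, Y \in T -> X \subset Y -> Y = X)
  (X \in maxelts T).
Proof.
rewrite inE; apply: (iffP andP) => [[h1 /forall_inP h2]|[h1 h2]]; split=> //.
  by move=> Y hY s; apply/eqP; apply: (implyP (h2 Y hY)).
by apply/forall_inP => Y hY; apply/implyP => s; apply/eqP/h2.
Qed.

Lemma maxelts_sub T : maxelts T \subset T.
Proof. by apply/subsetP => X /maxeltsP[]. Qed.

Lemma maxelts_above T X : X \in T -> exists2 Y, Y \in maxelts T & X \subset Y.
Proof.
move=> hX; pose Q := [pred K : {set E} | (K \in T) && (X \subset K)].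
have hQ : Q X by rewrite /Q /= hX subxx.
case: (arg_maxnP (fun K : {set E} => #|K|) hQ) => K /andP[h1 h2] hm.
exists K => //; apply/maxeltsP; split=> // Y a c; apply/esym/eqP.
by rewrite eqEcard c; apply: hm; rewrite /Q /= a; exact: subset_trans c.
Qed.

Lemma antichain_maxelts T : antichainb (maxelts T).
Proof.
by apply/antichainP => X Y /maxeltsP[_ h] /maxeltsP[hY _] s; apply/esym/h.
Qed.

Lemma cover_maxelts T : cover (maxelts T) = cover T.
Proof.
apply/eqP; rewrite eqEsubset; apply/andP; split; apply/bigcupsP => X hX.
  by apply: (bigcup_sup X); apply: (subsetP (maxelts_sub T)).
have [Y hY s] := maxelts_above hX; apply: subset_trans s _; exact: (bigcup_sup Y).
Qed.

(** By [cl_comps], a component K of the join is the join of the maximal members of S inside K. As K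
    is in the building set, nestedness leaves only one such member, which is then K itself. *)
Lemma comps_nested S : nestedb S -> comps (cl (cover S)) = maxelts S.
Proof.
move=> hS; set X := cl _; have hX : flat X by apply: flat_cl.
have subX G : G \in S -> G \subset X.
  by move=> hG; apply: subset_trans (sub_cl _ _) => //; apply: (bigcup_sup G).
have hsub : comps X \subset maxelts S.
  apply/subsetP => K hK; set T := [set G in maxelts S | G \subset K].
  have hTS : T \subset S.
    by apply/subsetP => G; rewrite inE => /andP[/(subsetP (maxelts_sub S))].
  have KE : K = cl (cover T).
    apply/eqP; rewrite eqEsubset; apply/andP; split.
      apply/subsetP => e eK.
      have eX : e \in cl (cover S) by apply: (subsetP (comps_sub hK)).
      have := cl_comps hX (sub_cl I _) hK eK eX.
      apply: (subsetP (clS _ _)) => //; apply/subsetP => z /setIP[].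
      rewrite -cover_maxelts => /bigcupP[G hG zG] zK; apply/bigcupP; exists G => //.
      rewrite in_set hG; have hGS := subsetP (maxelts_sub S) _ hG.
      have := building_comps hX hK (nested_building hS hGS) (subX _ hGS).
      by rewrite -setI_eq0 => /orP[//|/eqP/setP/(_ z)]; rewrite !inE zG zK.
    apply: cl_sub => //; first exact/building_flat/comps_building/hK.
    by apply/bigcupsP => G; rewrite inE => /andP[].
  have hT : #|T| = 1.
    have /andP[_ /forallP/(_ T)] := hS; rewrite hTS -KE (comps_building hK) /=.
    rewrite (_ : antichainb T) /=; last first.
      apply/antichainP => A B; rewrite in_set => /andP[hA _]; rewrite in_set => /andP[hB _].
      by move: A B hA hB; apply/antichainP/antichain_maxelts.
    rewrite implybF -leqNgt leq_eqVlt ltnS leqn0 cards_eq0 => /orP[/eqP//|/eqP T0].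
    have := building_neq0 (comps_building hK); rewrite KE T0 /cover big_set0 cl0 //.
    by rewrite eqxx.
  move/eqP/cards1P: hT => [G hG].
  have : G \in T by rewrite hG set11.
  rewrite in_set => /andP[hGm _]; rewrite KE hG /cover big_set1.
  have /eqP -> // := building_flat (nested_building hS (subsetP (maxelts_sub S) _ hGm)).
apply/eqP; rewrite eqEsubset hsub /=; apply/subsetP => G hG.
have hGS := subsetP (maxelts_sub S) _ hG.
have [K hK GK] := comps_above (nested_building hS hGS) (subX _ hGS).
have hKm := subsetP hsub _ hK.
case/maxeltsP: hG => _ /(_ K) <- //; exact: (subsetP (maxelts_sub S)).
Qed.

Definition belowset S G := [set H in S | H \proper G].
Definition rank_drop S G := rk G - rk (cover (belowset S G)).
Notation rkdrop := rank_drop.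

(** F is maximal in F |: P, hence a component of the join, and the rank splits at F; the part of P
    inside F consists of the members of S below F. So S can be built up in any order compatible with
    inclusion, each F adding its [rank_drop]. *)
Lemma nested_step S P F : nestedb S -> P \subset S -> F \in S ->
  belowset S F \subset P -> (forall H, H \in P -> ~~ (F \subset H)) ->
  F \in comps (cl (cover P :|: F)) /\ rk (cover P :|: F) = rk (cover P) + rkdrop S F.
Proof.
move=> hS PS FS bP nP.
have hPF : nestedb (F |: P) by apply: nested_sub hS _; rewrite subUset sub1set FS.
have cE : cover (F |: P) = cover P :|: F by rewrite /cover bigcup_setU big_set1 setUC.
have hF : F \in comps (cl (cover P :|: F)).
  rewrite -cE comps_nested //; apply/maxeltsP; rewrite setU11; split=> // Y.
  by case/setU1P => // /nP/negbTE->.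
split=> //; set X := cl _ in hF; have hX : flat X by apply: flat_cl.
have sX : cover P :|: F \subset X by apply: sub_cl.
have sX' : cover P \subset X by apply: subset_trans sX; apply: subsetUl.
rewrite (rank_split hX sX hF) (rank_split hX sX' hF).
have -> : (cover P :|: F) :&: F = F by apply/setIidPr/subsetUr.
have -> : (cover P :|: F) :\: F = cover P :\: F by rewrite setDUl setDv setU0.
have -> : cover P :&: F = cover (belowset S F).
  apply/eqP; rewrite eqEsubset; apply/andP; split.
    apply/subsetP => z /setIP[/bigcupP[H hH zH] zF]; apply/bigcupP; exists H => //.
    rewrite inE (subsetP PS) //= properE nP // andbT.
    have hHX : H \subset X by apply: subset_trans sX'; apply: (bigcup_sup H).
    have := building_comps hX hF (nested_building hS (subsetP PS _ hH)) hHX.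
    by rewrite -setI_eq0 => /orP[//|/eqP/setP/(_ z)]; rewrite !inE zH zF.
  apply/bigcupsP => H hH; rewrite subsetI; apply/andP; split.
    by apply: (bigcup_sup H); apply: (subsetP bP).
  by move: hH; rewrite inE => /andP[_ /proper_sub].
rewrite /rkdrop; have : rk (cover (belowset S F)) <= rk F.
  apply: rankS => //; apply/bigcupsP => H; rewrite inE => /andP[_ /proper_sub //].
lia.
Qed.

(** Otherwise G would be the join of the members properly below it, hence a component of that join,
    hence one of these members. *)
Lemma rkdrop_gt0 S G : nestedb S -> G \in Gs -> 0 < rkdrop S G.
Proof.
move=> hS hG; rewrite subn_gt0; set T := belowset S G.
have hT : nestedb T by apply: nested_sub hS _; apply/subsetP => H; rewrite inE => /andP[].
have sT : cover T \subset G by apply/bigcupsP => H; rewrite inE => /andP[_ /proper_sub].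
rewrite -(rank_cl matI (cover T)); apply: flat_rank_lt => //; first exact: flat_cl.
rewrite properEneq (cl_sub matI (building_flat hG) sT) andbT; apply/eqP => h.
have hcG : G \in comps (cl (cover T)).
  by rewrite h; apply/compsP; split=> // H _ a b; apply/eqP; rewrite eqEsubset a.
move: hcG; rewrite comps_nested // => /maxeltsP[]; rewrite inE => /andP[_].
by rewrite properxx.
Qed.

End BuildingSets.

Local Open Scope ring_scope.

(** * The Chow ideal and the spanning monomials *)

Section ChowIdeal.
Variables (E : finType) (I Gs : {set {set E}}).
Notation n := #|Gs|.
Notation R := {mpoly rat[n]}.
Notation ideal := (in_chow_ideal I Gs).
Implicit Types (p q r : R) (K G H J X : {set E}) (A : {set {set E}}).

Lemma chow_ideal0 : ideal 0.
Proof. by exists [::]; split=> //; rewrite big_nil. Qed.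

Lemma chow_idealD p q : ideal p -> ideal q -> ideal (p + q).
Proof.
move=> [s [hs ->]] [t [ht ->]]; exists (s ++ t); split; last by rewrite big_cat.
by move=> x; rewrite mem_cat => /orP[/hs|/ht].
Qed.

Lemma chow_idealMl p q : ideal q -> ideal (p * q).
Proof.
move=> [s [hs ->]]; exists [seq (p * x.1, x.2) | x <- s]; split.
  by move=> x /mapP[y /hs hy ->].
by rewrite big_map mulr_sumr; apply: eq_bigr => x _; rewrite mulrA.
Qed.

Lemma chow_idealMr p q : ideal q -> ideal (q * p).
Proof. by rewrite mulrC; apply: chow_idealMl. Qed.

Lemma chow_idealN p : ideal p -> ideal (- p).
Proof. by rewrite -mulN1r; apply: chow_idealMl. Qed.

Lemma chow_idealB p q : ideal p -> ideal q -> ideal (p - q).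
Proof. by move=> hp /chow_idealN; apply: chow_idealD. Qed.

Lemma chow_idealZ c p : ideal p -> ideal (c *: p).
Proof. by rewrite -mul_mpolyC; apply: chow_idealMl. Qed.

Lemma chow_ideal_sum (J : Type) (s : seq J) (Q : pred J) (f : J -> R) :
  (forall j, Q j -> ideal (f j)) -> ideal (\sum_(j <- s | Q j) f j).
Proof. by move=> h; apply: big_ind => //; [apply: chow_ideal0|apply: chow_idealD]. Qed.

Lemma chow_ideal_gen p : chow_gen I Gs p -> ideal p.
Proof.
move=> h; exists [:: (1, p)]; split; last by rewrite big_seq1 mul1r.
by move=> x; rewrite inE => /eqP ->.
Qed.

(* Variables indexed by sets; [xv G] is 0 when G is not in the building set. *)
Definition xv (G : {set E}) : R := \sum_(j < n | enum_val j == G) 'X_j.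
Definition hv (X : {set E}) : R := \sum_(j < n | X \subset enum_val j) 'X_j.

Lemma xv_val j : xv (enum_val j) = 'X_j.
Proof.
rewrite /xv (bigD1 j) //= big1 ?addr0 // => k /andP[/eqP/enum_val_inj-> /eqP//].
Qed.

Lemma hvE X : hv X = \sum_(K in Gs | X \subset K) xv K.
Proof.
rewrite (big_enum_val_cond (fun K : {set E} => X \subset K)).
by apply: eq_bigr => j _; rewrite xv_val.
Qed.

Definition xprod (A : {set {set E}}) : R := \prod_(K in A) xv K.

Lemma xprodU1 K A : K \notin A -> xprod (K |: A) = xv K * xprod A.
Proof. by move=> h; rewrite /xprod big_setU1. Qed.

Lemma xprod_ind A : A \subset Gs ->
  xprod A = \prod_(j in [set j : 'I_n | enum_val j \in A]) 'X_j.
Proof.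
move=> sA; rewrite /xprod.
rewrite (eq_bigl (fun K => (K \in Gs) && (K \in A))); last first.
  by move=> K; case: (boolP (K \in A)) => h; rewrite ?andbF ?(subsetP sA).
rewrite (big_enum_val_cond (fun K : {set E} => K \in A)).
by apply: eq_big => j; rewrite ?inE // xv_val.
Qed.

Lemma enum_val_im A : A \subset Gs ->
  [set enum_val j | j in [set j : 'I_n | enum_val j \in A]] = A.
Proof.
move=> sA; apply/setP => K; apply/imsetP/idP => [[j]|hK]; first by rewrite inE => h ->.
by exists (enum_rank_in (subsetP sA K hK) K);
   rewrite ?inE enum_rankK_in // (subsetP sA).
Qed.

Lemma chow_ideal_nonnested A : A \subset Gs -> ~~ is_nested I Gs A -> ideal (xprod A).
Proof.
move=> sA hA; apply: chow_ideal_gen; left.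
exists [set j : 'I_n | enum_val j \in A]; split; last exact: xprod_ind.
by rewrite enum_val_im //; apply/nestedP.
Qed.

Hypotheses (matI : is_matroid I) (loopI : loopless I).
Hypothesis bldG : is_building_set I Gs.
Notation rk := (mrank I).
Notation cl := (mcl I).

Lemma chow_ideal_pair G K e : G \in Gs -> K \in Gs -> e \in G -> e \in K ->
  ~~ (G \subset K) -> ~~ (K \subset G) -> ideal (xv G * xv K).
Proof.
move=> hG hK eG eK GK KG.
have GnK : G \notin [set K] by rewrite inE; apply: contraNneq GK => ->.
rewrite (_ : xv G * xv K = xprod [set G; K]); last first.
  by rewrite setUC /xprod setUC big_setU1 //= big_set1.
apply: chow_ideal_nonnested; first by rewrite subUset !sub1set hG.
apply/negP => /andP[_ /forallP/(_ [set G; K])].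
rewrite subxx cards2 -(in_set1 G K) GnK /= andbT (_ : antichainb _) /=; last first.
  apply/antichainP => X Y /set2P[]-> /set2P[]-> //.
    by rewrite (negPf GK).
  by rewrite (negPf KG).
by rewrite /cover bigcup_setU !big_set1 (building_join matI loopI bldG hG hK eG eK).
Qed.

(** With J = G v K, the difference h_G - h_J consists of the x_H with H above G but not above J.
    Such an H is incomparable to K and shares e with it, so x_H x_K is in the ideal. *)
Lemma chow_ideal_xh G K e d : G \in Gs -> K \in Gs -> e \in G -> e \in K ->
  ~~ (G \subset K) ->
  ideal (xv K * (hv G ^+ d - hv (cl (G :|: K)) ^+ d)).
Proof.
move=> hG hK eG eK GK; rewrite subrXX mulrA; apply: chow_idealMr.
set J := cl _.
have -> : hv G - hv J = \sum_(H in Gs | (G \subset H) && ~~ (J \subset H)) xv H.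
  rewrite !hvE [X in X - _](bigID (fun H => J \subset H)) /=.
  rewrite [X in X + _ - _](eq_bigl (fun H => (H \in Gs) && (J \subset H))).
    by rewrite [LHS]addrC addKr; apply: eq_bigl => H; rewrite andbA.
  move=> H; rewrite -andbA; congr (_ && _); case: (boolP (J \subset H)); rewrite ?andbF // andbT.
  apply: subset_trans; apply: subset_trans (sub_cl _ _); exact: subsetUl.
rewrite mulr_sumr; apply: chow_ideal_sum => H /and3P[hH GH JH].
apply: (chow_ideal_pair (e := e)) => //; first exact: (subsetP GH).
  apply: contra JH => KH; apply: cl_sub => //; first exact: building_flat hH.
  by rewrite subUset GH.
by apply: contra GK; apply: subset_trans GH.
Qed.

(* The relations of Feichtner and Yuzvinsky. *)
Lemma chow_ideal_FY d A G : A \subset Gs -> G \in Gs ->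
  (forall K, K \in A -> K \proper G) -> (rk G <= rk (cover A) + d)%N ->
  ideal (xprod A * hv G ^+ d).
Proof.
elim: d A G => [|d IH] A G sA hG pA hr.
  rewrite expr0 mulr1; apply: chow_ideal_nonnested => //; apply/negP => hA.
  have sc : cover A \subset G by apply/bigcupsP => K /pA/proper_sub.
  have eG : cl (cover A) = G.
    apply: (flat_rank_eq matI (flat_cl matI _)).
      by apply: cl_sub => //; exact: building_flat hG.
    by rewrite rank_cl // -[X in (_ <= X)%N]addn0.
  have : G \in maxbelow Gs (cl (cover A)).
    by rewrite eG; apply/compsP; split=> // H _ a b; apply/eqP; rewrite eqEsubset a.
  rewrite (comps_nested matI loopI bldG hA) => /(subsetP (maxelts_sub _)) /pA.
  by rewrite properxx.
case: (leqP (rk G) (rk (cover A) + d)) => [h|h].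
  by rewrite exprSr mulrA; apply: chow_idealMr; apply: IH.
(* One factor h_G is traded for variables that enlarge A: modulo the linear relation at the atom of
   e, h_G is minus the sum of the x_K with K containing e but not G. As e is outside the closure of
   A, the rank of the cover grows and pays for the lost factor. *)
have /subsetPn[e eG eA] : ~~ (G \subset cl (cover A)).
  by apply: contraTN h => /(rankS matI); rewrite rank_cl //; lia.
have rkA : (rk (cover A) < rk (e |: cover A))%N.
  rewrite ltn_neqAle rankS ?subsetUr // andbT eq_sym.
  by move: eA; rewrite mem_cl.
have aE K : K \in Gs -> (cl [set e] \subset K) = (e \in K).
  move=> hK; apply/idP/idP => [s|eK].
    by apply: (subsetP s); apply: (subsetP (sub_cl _ _)); rewrite set11.
  by apply: cl_sub; rewrite ?sub1set //; exact: building_flat hK.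
have ha : ideal (hv (cl [set e])).
  by apply: chow_ideal_gen; right; exists (cl [set e]); split=> //; apply: cl_set1_atom.
pose hG' := hv (cl [set e]) - \sum_(K in Gs | (e \in K) && ~~ (G \subset K)) xv K.
have hGE : hG' = hv G.
  rewrite /hG' !hvE [X in X - _](bigID (fun K => G \subset K)) /=.
  rewrite [X in _ + X - _](eq_bigl (fun K => [&& K \in Gs, e \in K & ~~ (G \subset K)])); last first.
    by move=> K; case: (boolP (K \in Gs)) => //= hK; rewrite aE.
  rewrite addrK; apply: eq_bigl => K; case: (boolP (K \in Gs)) => //= hK; rewrite aE //.
  by case: (boolP (G \subset K)); rewrite ?andbF // andbT => /subsetP/(_ e eG)->.
rewrite exprS -{1}hGE {1}/hG' mulrBl mulrBr; apply: chow_idealB.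
  by rewrite mulrCA; apply: chow_idealMr.
rewrite mulr_suml mulr_sumr; apply: chow_ideal_sum => K /and3P[hK eK GK].
have KA : K \notin A.
  apply: contra eA => hKA; apply: (subsetP (sub_cl _ _)).
  by apply: (subsetP (bigcup_sup K hKA)).
have cKA : cover (K |: A) = K :|: cover A by rewrite /cover bigcup_setU big_set1.
have sKA : K |: A \subset Gs by rewrite subUset sub1set hK.
have rkKA : (rk (cover A) < rk (cover (K |: A)))%N.
  apply: leq_trans rkA _; apply: rankS => //; rewrite cKA subUset sub1set inE eK /=.
  exact: subsetUr.
rewrite mulrA [_ * xv K]mulrC -xprodU1 //.
case: (boolP (K \subset G)) => KG.
  apply: IH => //; last by rewrite (leq_trans hr) // addnS -addSn leq_add2r.
  by move=> H /setU1P[->|/pA//]; rewrite properE KG.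
(* For K not inside G, the induction hypothesis is applied to J in place of G: next to x_K the
   powers of h_G and h_J agree modulo the ideal, and submodularity bounds rk J. *)
set J := cl (G :|: K).
have hJ : J \in Gs by apply: building_join hG hK eG eK.
have GJ : G \subset J by apply: subset_trans (sub_cl _ _); apply: subsetUl.
have KJ : K \subset J by apply: subset_trans (sub_cl _ _); apply: subsetUr.
suff h1 : ideal (xprod (K |: A) * hv J ^+ d).
  rewrite -[hv G ^+ d](subrK (hv J ^+ d)) mulrDr; apply: chow_idealD => //.
  rewrite xprodU1 // mulrAC; apply: chow_idealMr; exact: (chow_ideal_xh (e := e)).
apply: IH => //.
  move=> H /setU1P[->|/pA/proper_sub_trans]; last exact.
  rewrite properE KJ; apply: contra GK; exact: subset_trans.
have := rank_submod matI G (K :|: cover A); rewrite -cKA.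
have h1 : (rk J <= rk (G :|: cover (K |: A)))%N.
  by rewrite rank_cl //; apply: rankS => //; apply: setUS; rewrite cKA subsetUl.
have h2 : (rk (e |: cover A) <= rk (G :&: cover (K |: A)))%N.
  apply: rankS => //; rewrite subsetI cKA !subUset !sub1set eG inE eK subsetUr /=.
  by rewrite andbT; apply/bigcupsP => H /pA/proper_sub.
by move: h1 h2 rkA hr; clear; lia.
Qed.

(** * Standard monomials and leading terms *)

Implicit Types m : 'X_{1..n}.

Definition msets m : {set {set E}} := [set enum_val j | j in [set j | m j != 0%N]].

Lemma mem_msets m j : (enum_val j \in msets m) = (m j != 0%N).
Proof.
apply/imsetP/idP => [[k]|h]; last by exists j; rewrite ?inE.
by rewrite inE => h /enum_val_inj ->.
Qed.

Lemma msets_building m : msets m \subset Gs.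
Proof. by apply/subsetP => K /imsetP[j _ ->]; apply: enum_valP. Qed.

Definition standard_mnm m := is_nested I Gs (msets m) &&
  [forall j, (m j != 0%N) ==> (m j < rank_drop I (msets m) (enum_val j))%N].
Notation standard := standard_mnm.

(** For this weight x_G is the only lightest term of h_G, since a set properly above G has more
    elements. The weight is bounded in each degree, so rewriting towards larger weight
    terminates. *)
Definition mwt m : nat := \sum_(j < n) m j * #|enum_val j|.

Lemma mwtD m1 m2 : mwt (m1 + m2) = (mwt m1 + mwt m2)%N.
Proof.
by rewrite /mwt -big_split; apply: eq_bigr => j _; rewrite mnmDE mulnDl.
Qed.

Lemma mwt_le m : (mwt m <= mdeg m * #|E|)%N.
Proof.
rewrite mdegE big_distrl; apply: leq_sum => j _.
by rewrite leq_mul2l max_card orbT.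
Qed.

Definition hw d w p : Prop := forall m, m \in msupp p -> mdeg m = d /\ (w <= mwt m)%N.

Lemma hw0 d w : hw d w 0.
Proof. by move=> m; rewrite msupp0. Qed.

Lemma hwD d w p q : hw d w p -> hw d w q -> hw d w (p + q).
Proof.
by move=> hp hq m /msuppD_le; rewrite mem_cat => /orP[/hp|/hq].
Qed.

Lemma hwN d w p : hw d w p -> hw d w (- p).
Proof. by move=> hp m; rewrite (perm_mem (msuppN p)) => /hp. Qed.

Lemma hw_sum (J : Type) (s : seq J) (Q : pred J) (f : J -> R) d w :
  (forall j, Q j -> hw d w (f j)) -> hw d w (\sum_(j <- s | Q j) f j).
Proof. by move=> h; apply: big_ind => //; [apply: hw0|apply: hwD]. Qed.

Lemma hwM d w d' w' p q : hw d w p -> hw d' w' q -> hw (d + d') (w + w') (p * q).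
Proof.
move=> hp hq m /msuppM_le /allpairsP[[m1 m2] /= [/hp[<- h1] /hq[<- h2] ->]].
by rewrite mdegD mwtD leq_add.
Qed.

Lemma hwW d w w' p : (w' <= w)%N -> hw d w p -> hw d w' p.
Proof. by move=> h hp m /hp[-> h']; split=> //; apply: leq_trans h'. Qed.

Lemma hw1 : hw 0 0 1.
Proof. by move=> m; rewrite msupp1 inE => /eqP->; rewrite mdeg0. Qed.

Lemma hwX m : hw (mdeg m) (mwt m) 'X_[m].
Proof. by move=> m'; rewrite msuppX inE => /eqP->. Qed.

Lemma hwU (j : 'I_n) : hw 1 #|enum_val j| 'X_j.
Proof.
move=> m; rewrite msuppX inE => /eqP->; rewrite mdeg1; split=> //.
by rewrite /mwt (bigD1 j) //= mnm1E eqxx mul1n leq_addr.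
Qed.

Definition leading d w p q : Prop := hw d w q /\ hw d w.+1 (p - q).

Lemma leading_hw d w p q : leading d w p q -> hw d w p.
Proof.
by move=> [h1 h2]; rewrite -[p](subrK q); apply: hwD => //; apply: hwW h2.
Qed.

Lemma leadingM d w d' w' p q p' q' : leading d w p q -> leading d' w' p' q' ->
  leading (d + d') (w + w') (p * p') (q * q').
Proof.
move=> h h'; have hp' := leading_hw h'; case: h h' => [h1 h2] [h1' h2'].
split; first exact: hwM.
rewrite (_ : _ - _ = (p - q) * p' + q * (p' - q')); last by ring.
by apply: hwD; [rewrite -addSn; apply: hwM|rewrite -addnS; apply: hwM].
Qed.

Lemma leading1 : leading 0 0 1 1.
Proof. by split; [apply: hw1|rewrite subrr; apply: hw0]. Qed.

Lemma leadingX d w p q k : leading d w p q -> leading (k * d) (k * w) (p ^+ k) (q ^+ k).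
Proof.
move=> h; elim: k => [|k IH]; first exact: leading1.
by rewrite !exprS !mulSn; apply: leadingM.
Qed.

Lemma leading_prod (J : Type) (s : seq J) (d w : J -> nat) (p q : J -> R) :
  (forall j, leading (d j) (w j) (p j) (q j)) ->
  leading (\sum_(j <- s) d j) (\sum_(j <- s) w j) (\prod_(j <- s) p j) (\prod_(j <- s) q j).
Proof.
move=> h; elim: s => [|j s IH]; first by rewrite !big_nil; apply: leading1.
by rewrite !big_cons; apply: leadingM.
Qed.

Lemma leadingU (j : 'I_n) : leading 1 #|enum_val j| 'X_j 'X_j.
Proof. by split; [apply: hwU|rewrite subrr; apply: hw0]. Qed.

Lemma leading_hv (j : 'I_n) : leading 1 #|enum_val j| (hv (enum_val j)) 'X_j.
Proof.
split; first exact: hwU.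
rewrite /hv (bigD1 j) //= addrAC subrr add0r; apply: hw_sum => k /andP[s kj].
apply: hwW (hwU (j:=k)); apply: proper_card; rewrite properEneq s andbT.
by apply: contra kj => /eqP/enum_val_inj->.
Qed.

Section Spanning.
Variables (b : 'X_{1..n} -> R) (i : nat).
Hypothesis b_leading : forall m, leading (mdeg m) (mwt m) (b m) 'X_[m].

(** Any family b with leading monomials 'X_[m] is allowed, because independence is shown below for
    the products [bpol] and not for the monomials themselves. *)
Definition spanned p : Prop := exists c : 'X_{1..n} -> rat,
  ideal (p - \sum_(m : 'X_{1..n < i.+1} | standard m && (mdeg m == i)) c m *: b m).

Lemma spanned0 : spanned 0.
Proof.
exists (fun=> 0); rewrite big1 ?subr0; first exact: chow_ideal0.
by move=> m _; rewrite scale0r.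
Qed.

Lemma spannedD p q : spanned p -> spanned q -> spanned (p + q).
Proof.
move=> [c hc] [d hd]; exists (fun m => c m + d m).
under eq_bigr do rewrite scalerDl.
by rewrite big_split /= opprD addrACA; apply: chow_idealD.
Qed.

Lemma spannedZ a p : spanned p -> spanned (a *: p).
Proof.
move=> [c hc]; exists (fun m => a * c m).
under eq_bigr do rewrite -scalerA.
by rewrite -scaler_sumr -scalerBr; apply: chow_idealZ.
Qed.

Lemma spanned_ideal p q : ideal (p - q) -> spanned q -> spanned p.
Proof.
move=> h [c hc]; exists c; rewrite -[p](subrK q) -addrA; exact: chow_idealD.
Qed.

Lemma spanned_b m : standard m -> mdeg m = i -> spanned (b m).
Proof.
move=> hm hd; exists (fun m' => (m' == m)%:R).
have hd' : (mdeg m < i.+1)%N by rewrite hd.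
rewrite (bigD1 (BMultinom hd')) /= ?hm ?hd ?eqxx // scale1r big1 ?addr0 ?subrr.
  exact: chow_ideal0.
by move=> m' /andP[_ ]; rewrite -val_eqE /= => /negPf->; rewrite scale0r.
Qed.

(** Descending induction on the weight. A standard monomial is b m up to heavier terms; one with
    non-nested support is in the ideal; and if m_G >= d = d_G, with A the members of the support
    below G, the relation x_A h_G^d = 0 lets x_A (x_G^d - h_G^d), all of whose terms are heavier,
    replace x_A x_G^d. *)
Lemma spanned_mon m : mdeg m = i -> spanned 'X_[m].
Proof.
move: {2}(i * #|E| - mwt m)%N (leqnn (i * #|E| - mwt m)) => k.
elim/ltn_ind: k m => k IH m hk hd.
have rec p : hw i (mwt m).+1 p -> spanned p.
  move=> hp; rewrite [p]mpolyE big_seq; apply: big_ind.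
  - exact: spanned0.
  - exact: spannedD.
  move=> m' /hp[h1 h2]; apply: spannedZ; apply: (IH (i * #|E| - mwt m')%N) => //.
  by have := mwt_le m'; rewrite h1; lia.
case: (boolP (standard m)) => [hm|].
  rewrite -[X in spanned X](subKr (b m)); apply: spannedD; first exact: spanned_b.
  by apply: rec; apply: hwN; rewrite -hd; case: (b_leading m).
rewrite negb_and; case: (boolP (is_nested I Gs (msets m))) => /= [hn|hn _]; last first.
  apply: spanned_ideal spanned0; rewrite subr0.
  pose t : 'X_{1..n} := [multinom nat_of_bool (m j != 0%N) | j < n].
  have tm : (t <= m)%MM by apply/mnm_lepP => j; rewrite mnmE; case: (m j).
  rewrite -(submK tm) mpolyXD; apply: chow_idealMl.
  suff -> : 'X_[t] = xprod (msets m) by apply: chow_ideal_nonnested => //; exact: msets_building.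
  rewrite xprod_ind ?msets_building // mpolyXE_id [RHS]big_mkcond /=.
  by apply: eq_bigr => j _; rewrite mnmE inE mem_msets; case: (m j).
rewrite negb_forall => /existsP[j]; rewrite negb_imply -leqNgt => /andP[hj hle].
set G := enum_val j in hle; set d := rank_drop _ _ _ in hle.
have hG : G \in Gs by apply: enum_valP.
set A := belowset (msets m) G.
have sA : A \subset Gs.
  by apply: subset_trans (msets_building m); apply/subsetP => K; rewrite inE => /andP[].
pose tA : 'X_{1..n} := [multinom nat_of_bool (enum_val j \in A) | j < n].
have tAm : (tA + U_(j) *+ d <= m)%MM.
  apply/mnm_lepP => l; rewrite mnmDE mnmE mulmnE mnm1E; case: eqP => [<-|_].
    by rewrite inE properxx andbF mul1n.
  by rewrite mul0n addn0 inE mem_msets; case: (m l); case: (_ \proper _).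
have XA : 'X_[tA] = xprod A.
  rewrite xprod_ind // mpolyXE_id [RHS]big_mkcond /=.
  apply: eq_bigr => l _; rewrite mnmE.
  have -> : (l \in [set j0 : 'I_n | enum_val j0 \in A]) = (enum_val l \in A) by rewrite in_set.
  by case: (_ \in A).
have iA : ideal (xprod A * hv G ^+ d).
  apply: chow_ideal_FY => //; first by move=> K; rewrite inE => /andP[].
  by rewrite /d /rank_drop -/A; lia.
have eX : 'X_[m] = 'X_[m - (tA + U_(j) *+ d)] * (xprod A * 'X_j ^+ d).
  by rewrite -{1}(submK tAm) !mpolyXD XA -mpolyXn.
apply: (@spanned_ideal _ ('X_[m] - 'X_[m - (tA + U_(j) *+ d)] * (xprod A * hv G ^+ d))).
  by rewrite subKr; apply: chow_idealMl.
apply: rec; rewrite {1}eX -!mulrBr -XA mulrA -mpolyXD.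
have [_] := leadingX d (leading_hv j).
rewrite -/G muln1 => /hwN; rewrite opprB => h.
have := hwM (@hwX (m - (tA + U_(j) *+ d) + tA)) h.
rewrite addnS.
have -> : (mdeg (m - (tA + U_(j) *+ d) + tA) + d)%N = i.
  by rewrite -hd -{2}(submK tAm) !mdegD mdegMn mdeg1 mul1n addnA.
rewrite (_ : (mwt _ + _)%N = mwt m) //.
rewrite -{2}(submK tAm) !mwtD addnA; congr (_ + _)%N.
rewrite /mwt (bigD1 j) //= big1 ?addn0 ?mulmnE ?mnm1E ?eqxx ?mul1n // => l lj.
by rewrite mulmnE mnm1E eq_sym (negPf lj).
Qed.

Lemma spanned_homog p : homog_of_deg i p -> spanned p.
Proof.
move=> hp; rewrite [p]mpolyE big_seq; apply: big_ind.
- exact: spanned0.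
- exact: spannedD.
by move=> m /hp h; apply: spannedZ; apply: spanned_mon.
Qed.

End Spanning.

End ChowIdeal.

(** * The dragon Hall-Rado functional *)

Section MonomialFunctional.
Variables (n : nat) (f : 'X_{1..n} -> rat).

Definition mlin (p : {mpoly rat[n]}) : rat := \sum_(m <- msupp p) p@_m * f m.

Lemma mlinE p i : (msize p <= i)%N ->
  mlin p = \sum_(m : 'X_{1..n < i}) p@_m * f m.
Proof.
move=> le_pi; pose J : subFinType _ := 'X_{1..n < i}.
rewrite /mlin (big_mksub J) ?msupp_uniq //=; first last.
  by move=> x /msize_mdeg_lt /leq_trans; apply.
by rewrite big_rmcond //= => j /memN_msupp_eq0 ->; rewrite mul0r.
Qed.

Lemma mlin_is_additive : additive mlin.
Proof.
move=> p q; set i := maxn (msize (p - q)) (maxn (msize p) (msize q)).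
rewrite !(@mlinE _ i) /i ?leq_maxl //.
- by rewrite -sumrB; apply/eq_bigr => m _; rewrite mcoeffB mulrBl.
- by rewrite !leq_max leqnn !orbT.
- by rewrite !leq_max leqnn !orbT.
Qed.

HB.instance Definition _ :=
  GRing.isAdditive.Build {mpoly rat[n]} rat mlin mlin_is_additive.

Lemma mlinZ c p : mlin (c *: p) = c * mlin p.
Proof.
set i := maxn (msize (c *: p)) (msize p).
rewrite !(@mlinE _ i) /i ?leq_maxl ?leq_maxr //.
by rewrite mulr_sumr; apply/eq_bigr => m _; rewrite mcoeffZ mulrA.
Qed.

Lemma mlinX m : mlin 'X_[m] = f m.
Proof. by rewrite /mlin msuppX big_seq1 mcoeffX eqxx mul1r. Qed.

End MonomialFunctional.

Section DragonFunctional.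
Variables (E : finType) (I Gs : {set {set E}}).
Hypotheses (matI : is_matroid I) (loopI : loopless I).
Hypothesis bldG : is_building_set I Gs.
Notation rk := (mrank I).
Notation cl := (mcl I).
Notation N := #|{: {set E}}|.
Notation Y := {mpoly rat[N]}.
Implicit Types (p q r : Y) (A F G H J K X Z W : {set E}) (T S : {set {set E}}).
Implicit Types (mu nu : {set E} -> nat).

Definition contr_rank A X : nat := rk (X :|: A) - rk A.
Notation crk := contr_rank.

Lemma crkE A X : (crk A X + rk A)%N = rk (X :|: A).
Proof. by rewrite subnK // rankS ?subsetUr. Qed.

Lemma crkS A X Z : X \subset Z -> (crk A X <= crk A Z)%N.
Proof. by move=> h; apply: leq_sub2r; apply: rankS; rewrite ?setSU. Qed.

Lemma crk_cl A X Z : X \subset cl Z -> Z \subset cl X -> crk A X = crk A Z.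
Proof.
move=> h1 h2; rewrite /crk; congr (_ - _)%N; apply: rank_eq_cl => //.
by apply/eqP; rewrite eqEsubset !clUS.
Qed.

Lemma crk_submod A X Z W : W \subset X -> W \subset Z ->
  (crk A (X :|: Z) + crk A W <= crk A X + crk A Z)%N.
Proof.
move=> h1 h2; have := rank_submod matI (X :|: A) (Z :|: A).
rewrite -setUUl.
have := @rankS _ _ matI (W :|: A) ((X :|: A) :&: (Z :|: A)).
rewrite -setUIl setSU ?subsetI ?h1 // => /(_ isT).
rewrite -!crkE; lia.
Qed.

Definition tot mu T : nat := \sum_(X in T) mu X.

Lemma totS mu T S : T \subset S -> (tot mu T <= tot mu S)%N.
Proof.
move=> h; rewrite /tot [X in (_ <= X)%N](big_setID T) /= (setIidPr h).
exact: leq_addr.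
Qed.

Lemma totUI mu T S : (tot mu (T :|: S) + tot mu (T :&: S) = tot mu T + tot mu S)%N.
Proof.
have -> : tot mu (T :|: S) = (tot mu T + tot mu (S :\: T))%N.
  rewrite /tot (big_setID T) /= setIUl setIid (setUidPl _) ?subsetIr //.
  by rewrite setDUl setDv set0U.
have -> : tot mu S = (tot mu (T :&: S) + tot mu (S :\: T))%N.
  by rewrite /tot (big_setID T) /= setIC.
lia.
Qed.

(* The dragon Hall--Rado condition for the multiset mu of subsets of M/A. *)
Definition dragon_hall_rado A mu : bool :=
  [forall T : {set {set E}}, (tot mu T == 0%N) || (tot mu T < crk A (cover T))%N].
Notation dhr := dragon_hall_rado.

(* X has rank at least k after generic points of the members of mu are contracted. *)
Definition quot_rank_ge A mu k X : bool :=
  [forall T : {set {set E}}, (tot mu T + k <= crk A (X :|: cover T))%N].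
Notation rkge := quot_rank_ge.

Lemma dhrP A mu T : dhr A mu -> (tot mu T <= crk A (cover T))%N.
Proof. by move=> /forallP/(_ T)/orP[/eqP->|/ltnW]. Qed.

Lemma eq_tot mu nu T : mu =1 nu -> tot mu T = tot nu T.
Proof. by move=> h; apply: eq_bigr. Qed.

Lemma eq_dhr A mu nu : mu =1 nu -> dhr A mu = dhr A nu.
Proof. by move=> h; apply: eq_forallb => T; rewrite !(eq_tot _ h). Qed.

Definition add1 F mu : {set E} -> nat := fun X => (mu X + (X == F))%N.

Lemma tot_add1 F mu T : tot (add1 F mu) T = (tot mu T + (F \in T))%N.
Proof.
rewrite /tot /add1 big_split /=; congr (_ + _)%N.
case: (boolP (F \in T)) => hF.
  by rewrite (bigD1 F) //= eqxx big1 // => X /andP[_ /negPf->].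
by rewrite big1 // => X XT; case: eqP XT hF => // -> ->.
Qed.

Lemma coverU1 F T : cover (F |: T) = F :|: cover T.
Proof. by rewrite /cover bigcup_setU big_set1. Qed.

(** A family containing F counts it once more, so its strict inequality asks for rank at least tot
    mu T + 2; conversely F can be joined to any T. Multiplication by y_F thus becomes a condition on
    the rank left to F. *)
Lemma dhr_add1 A F mu : dhr A (add1 F mu) = dhr A mu && rkge A mu 2 F.
Proof.
apply/forallP/andP => [h|[/forallP h1 /forallP h2] T].
  split; apply/forallP => T.
    have := h T; rewrite tot_add1; case: eqP => //=; lia.
  have := h (F |: T); rewrite tot_add1 setU11 coverU1.
  have := totS mu (subsetUr [set F] T); lia.
rewrite tot_add1; case: (boolP (F \in T)) => hF; last by rewrite addn0.
have := h2 T; rewrite (_ : F :|: cover T = cover T); first lia.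
by apply/setUidPr; apply: (bigcup_sup F).
Qed.

Lemma rkge_add1 A F mu k X : rkge A (add1 F mu) k X =
  rkge A mu k X && rkge A mu k.+1 (X :|: F).
Proof.
apply/forallP/andP => [h|[/forallP h1 /forallP h2] T].
  split; apply/forallP => T.
    have := h T; rewrite tot_add1; lia.
  have := h (F |: T); rewrite tot_add1 setU11 coverU1 setUA.
  have := totS mu (subsetUr [set F] T); lia.
rewrite tot_add1; case: (boolP (F \in T)) => hF; last by rewrite addn0.
have := h2 T; rewrite -setUA (_ : F :|: cover T = cover T); first lia.
by apply/setUidPr; apply: (bigcup_sup F).
Qed.

Lemma rkge_cl A mu k X Z : X \subset cl Z -> Z \subset cl X ->
  rkge A mu k X = rkge A mu k Z.
Proof.
move=> h1 h2; apply: eq_forallb => T; congr (_ <= _)%N; apply: crk_cl.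
  by apply: subset_trans (sub_cl I _) _; apply: clUS.
by apply: subset_trans (sub_cl I _) _; apply: clUS.
Qed.

Lemma rkgeW A mu k X : rkge A mu k.+1 X -> rkge A mu k X.
Proof. by move/forallP=> h; apply/forallP => T; have := h T; lia. Qed.

(** There is a variable for every subset of E, not only for the building set: [dkernel_list] passes
    through unions that need not even be flats. *)
Definition yv X : Y := 'X_(enum_rank X).
Definition ymon mu : Y := \prod_(X : {set E}) yv X ^+ mu X.

Lemma ymonE mu : ymon mu = 'X_[[multinom mu (enum_val j) | j < N]].
Proof.
rewrite mpolyXE_id /ymon (reindex (@enum_val _ (mem {: {set E}}))) /=; last first.
  by exists enum_rank => ? _; [apply: enum_valK|apply: enum_rankK].
by apply: eq_bigr => j _; rewrite /yv enum_valK mnmE.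
Qed.

Lemma ymon_add1 F mu : ymon (add1 F mu) = yv F * ymon mu.
Proof.
rewrite /ymon (bigD1 F) //= [in RHS](bigD1 F) //= /add1 eqxx addn1 exprS -mulrA.
by congr (_ * (_ * _)); apply: eq_bigr => X /negPf->; rewrite addn0.
Qed.

Lemma ymonX m : 'X_[m] = ymon (fun X => m (enum_rank X)).
Proof.
by rewrite ymonE; congr 'X_[_]; apply/mnmP => j; rewrite mnmE enum_valK.
Qed.

Lemma ymonD mu nu : ymon (fun X => mu X + nu X)%N = ymon mu * ymon nu.
Proof. by rewrite /ymon -big_split; apply: eq_bigr => X _; rewrite exprD. Qed.

Lemma ymon0 mu : mu =1 (fun=> 0%N) -> ymon mu = 1.
Proof. by move=> h; rewrite /ymon big1 // => X _; rewrite h. Qed.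

Definition dragon_lin A : Y -> rat :=
  mlin (fun m : 'X_{1..N} => (dhr A (fun X => m (enum_rank X)))%:R).
Notation dlin := dragon_lin.

HB.instance Definition _ A := GRing.Additive.on (dlin A).

Lemma dlinZ A c p : dlin A (c *: p) = c * dlin A p.
Proof. exact: mlinZ. Qed.

Lemma dlin_ymon A mu : dlin A (ymon mu) = (dhr A mu)%:R.
Proof.
rewrite ymonE /dlin mlinX; congr (nat_of_bool _)%:R; apply: eq_dhr => X.
by rewrite mnmE enum_rankK.
Qed.

(** The radical of the bilinear form (p, q) -> [dlin A (p * q)]; unlike the kernel of [dlin A] it is
    an ideal. *)
Definition dragon_kernel A q : Prop := forall p, dlin A (p * q) = 0.
Notation dkernel := dragon_kernel.

Lemma dkernel_ymon A q : (forall mu, dlin A (ymon mu * q) = 0) -> dkernel A q.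
Proof.
move=> h p; rewrite [p]mpolyE mulr_suml raddf_sum big1 // => m _ /=.
by rewrite -scalerAl dlinZ ymonX h mulr0.
Qed.

Lemma dkernelMl A p q : dkernel A q -> dkernel A (p * q).
Proof. by move=> h r; rewrite mulrA. Qed.

Lemma dkernelMr A p q : dkernel A p -> dkernel A (p * q).
Proof. by rewrite mulrC; apply: dkernelMl. Qed.

Lemma dkernel0 A : dkernel A 0.
Proof. by move=> p; rewrite mulr0 raddf0. Qed.

Lemma dkernelD A p q : dkernel A p -> dkernel A q -> dkernel A (p + q).
Proof. by move=> hp hq r; rewrite mulrDr raddfD /= hp hq addr0. Qed.

Lemma dkernelB A p q : dkernel A p -> dkernel A q -> dkernel A (p - q).
Proof. by move=> hp hq r; rewrite mulrBr raddfB /= hp hq subr0. Qed.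

Lemma dkernel_sum A (L : Type) (s : seq L) (Q : pred L) (f : L -> Y) :
  (forall j, Q j -> dkernel A (f j)) -> dkernel A (\sum_(j <- s | Q j) f j).
Proof. by move=> h; apply: big_ind => //; [apply: dkernel0|apply: dkernelD]. Qed.

(** For mu satisfying the condition, let gF and gG say that F and G keep rank at least 2 after
    contracting mu, and h that J keeps rank at least 3. The four terms add up to h (1 - gF)(1 - gG).
    If gF and gG fail, the two families witnessing this combine by submodularity into one that
    contradicts h. *)
Lemma dkernel2 A F G J : F \subset cl J -> G \subset cl J -> J \subset cl (F :|: G) ->
  dkernel A ((yv F - yv J) * (yv G - yv J)).
Proof.
move=> FJ GJ JFG; apply: dkernel_ymon => mu.
have -> : ymon mu * ((yv F - yv J) * (yv G - yv J)) =
  yv F * (yv G * ymon mu) - yv F * (yv J * ymon mu) - yv J * (yv G * ymon mu)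
  + yv J * (yv J * ymon mu) by ring.
rewrite -!ymon_add1 raddfD !raddfB /= !dlin_ymon !dhr_add1 !rkge_add1.
have e1 : rkge A mu 3 (F :|: G) = rkge A mu 3 J by apply: rkge_cl => //; rewrite subUset FJ.
have e2 : rkge A mu 3 (F :|: J) = rkge A mu 3 J.
  apply: rkge_cl; rewrite ?subUset ?FJ ?sub_cl //.
  by apply: subset_trans (sub_cl I _); apply: subsetUr.
have e3 : rkge A mu 3 (J :|: G) = rkge A mu 3 J.
  apply: rkge_cl; rewrite ?subUset ?GJ ?sub_cl //.
  by apply: subset_trans (sub_cl I _); apply: subsetUl.
rewrite e1 e2 e3 setUid.
case hd : (dhr A mu); rewrite /= ?subrr ?addr0 //.
case h3 : (rkge A mu 3 J); rewrite ?andbF ?subrr ?addr0 //.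
rewrite (rkgeW h3) !andbT /=.
case hF : (rkge A mu 2 F); case hG : (rkge A mu 2 G); rewrite /= ?subrr ?subr0 ?sub0r ?addNr //.
case/negP: (negbT hF); rewrite -(negbK (rkge _ _ _ _)); apply/negP.
rewrite negb_forall => /existsP[T1]; rewrite -ltnNge => h1.
move/negbT: hG; rewrite negb_forall => /existsP[T2]; rewrite -ltnNge => h2.
move: h3; rewrite -e1 => /forallP/(_ (T1 :|: T2)).
have h4 := dhrP (T1 :&: T2) hd.
have cI1 : cover (T1 :&: T2) \subset F :|: cover T1.
  apply: subset_trans (subsetUr _ _); apply/bigcupsP => X /setIP[hX _].
  exact: (bigcup_sup X).
have cI2 : cover (T1 :&: T2) \subset G :|: cover T2.
  apply: subset_trans (subsetUr _ _); apply/bigcupsP => X /setIP[_ hX].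
  exact: (bigcup_sup X).
have := crk_submod A cI1 cI2.
have -> : F :|: cover T1 :|: (G :|: cover T2) = F :|: G :|: cover (T1 :|: T2).
  by rewrite setUACA /cover bigcup_setU.
have := totUI mu T1 T2.
move: h1 h2 h4; clear; lia.
Qed.

(** Let J' be the union of all sets but F. Modulo y_J' - y_J the product over the rest may be taken
    with J' in place of J, and is then in the kernel by induction; the correction is a multiple of
    (y_F - y_J)(y_J' - y_J). *)
Lemma dkernel_list A (l : seq {set E}) J : l != [::] ->
  (forall G, G \in l -> G \subset cl J) -> J \subset cl (\bigcup_(G <- l) G) ->
  dkernel A (\prod_(G <- l) (yv G - yv J)).
Proof.
elim: l J => // F l IH J _ hl hJ; rewrite big_cons.
have FJ : F \subset cl J by apply: hl; rewrite mem_head.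
case: (altP (l =P [::])) => [l0|l0].
  rewrite l0 big_nil mulr1; apply: dkernel_ymon => mu.
  rewrite mulrC mulrBl raddfB /= -!ymon_add1 !dlin_ymon !dhr_add1 (@rkge_cl _ _ _ F J) ?subrr //.
  by move: hJ; rewrite l0 big_seq1.
set J' := \bigcup_(G <- l) G.
have J'J : J' \subset cl J.
  by rewrite /J' bigcup_seq; apply/bigcupsP => G hG; apply: hl; rewrite inE hG orbT.
have k1 : dkernel A (\prod_(G <- l) (yv G - yv J')).
  apply: IH => //; last exact: sub_cl.
  move=> G hG; apply: subset_trans (sub_cl I _); rewrite /J' bigcup_seq.
  exact: (bigcup_sup G).
have k2 : dkernel A ((yv F - yv J) * (yv J' - yv J)).
  apply: dkernel2 => //; by move: hJ; rewrite big_cons.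
have [q ->] : exists q, \prod_(G <- l) (yv G - yv J) =
    \prod_(G <- l) (yv G - yv J') + (yv J' - yv J) * q.
  elim: (l) => [|G l' [q IHq]]; first by exists 0; rewrite !big_nil mulr0 addr0.
  exists ((yv G - yv J') * q + \prod_(G <- l') (yv G - yv J)).
  rewrite !big_cons; move: (\prod_(_ <- _) _) (\prod_(_ <- _) _) IHq => b a IHq.
  transitivity ((yv G - yv J') * a + (yv J' - yv J) * a); first by ring.
  by rewrite {1}IHq; ring.
rewrite mulrDr; apply: dkernelD; first exact: dkernelMl.
by rewrite mulrA; apply: dkernelMr.
Qed.

End DragonFunctional.

(** * The functional kills the Chow ideal *)

Section ChangeOfVariables.
Variables (E : finType) (I Gs : {set {set E}}).
Hypotheses (matI : is_matroid I) (loopI : loopless I).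
Hypothesis bldG : is_building_set I Gs.
Notation rk := (mrank I).
Notation cl := (mcl I).
Notation n := #|Gs|.
Notation N := #|{: {set E}}|.
Notation Y := {mpoly rat[N]}.
Implicit Types (A F G H J K X Z W : {set E}) (T S : {set {set E}}).
Implicit Types (mu nu : {set E} -> nat).
Notation dkernel := (dragon_kernel I).
Notation dlin := (dragon_lin I).

(* Moebius inversion of [yv G = \sum_(K in Gs | G \subset K) xi K]; the fuel k
   suffices as soon as it exceeds #|E| - #|G|. *)
Fixpoint xi_rec k G : Y :=
  if k is k'.+1 then yv G - \sum_(K in Gs | G \proper K) xi_rec k' K else 0.

Definition xi_var G : Y := xi_rec #|E|.+1 G.
Notation xi := xi_var.

Lemma card_setE K : (#|K| <= #|E|)%N.
Proof. exact: max_card. Qed.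

Lemma xi_rec_stable k k' G : (#|E| - #|G| < k)%N -> (#|E| - #|G| < k')%N ->
  xi_rec k G = xi_rec k' G.
Proof.
elim: k k' G => [|k IH] [|k'] G // h h' /=; congr (_ - _).
apply: eq_bigr => K /andP[_ /proper_card pK].
by have cK := card_setE K; apply: IH; [move: h|move: h']; lia.
Qed.

Lemma xi_sum G : G \in Gs -> \sum_(K in Gs | G \subset K) xi K = yv G.
Proof.
move=> hG; rewrite (bigD1 G) ?hG ?subxx //=.
rewrite (_ : xi G = yv G - \sum_(K in Gs | G \proper K) xi_rec #|E| K) //.
rewrite [X in _ - _ + X](eq_bigl (fun K => (K \in Gs) && (G \proper K))); last first.
  by move=> K; rewrite properEneq [G == K]eq_sym -andbA; congr (_ && _); rewrite andbC.
rewrite [X in _ - X + _](eq_bigr xi) ?subrK // => K /andP[_ /proper_card pK].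
by apply: xi_rec_stable; have := card_setE K; lia.
Qed.

(** Substituting [xi] for the x_G turns h_G into the variable y_G, so the functional can be tested
    on the Chow ideal. *)
Definition xituple : n.-tuple Y := [tuple xi (enum_val j) | j < n].
Notation phi := (comp_mpoly xituple).

Lemma phiX (j : 'I_n) : phi 'X_j = xi (enum_val j).
Proof. by rewrite comp_mpolyXU -tnth_nth tnth_mktuple. Qed.

Lemma phi_xv G : G \in Gs -> phi (xv Gs G) = xi G.
Proof.
move=> hG; rewrite -(enum_rankK_in hG hG) xv_val phiX; congr xi.
Qed.

Lemma phi_hv G : G \in Gs -> phi (hv Gs G) = yv G.
Proof.
move=> hG; rewrite hvE rmorph_sum /= -xi_sum //.
by apply: eq_bigr => K /andP[hK _]; rewrite phi_xv.
Qed.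

Lemma building_join_seq J (s : seq {set E}) : J \in Gs ->
  (forall K, K \in s -> K \in Gs /\ exists2 e, e \in J & e \in K) ->
  cl (J :|: \bigcup_(K <- s) K) \in Gs.
Proof.
elim: s J => [|K s IH] J hJ hs.
  by rewrite big_nil setU0 (eqP (building_flat bldG hJ)).
have [hK [e eJ eK]] := hs K (mem_head _ _).
rewrite big_cons setUA -clUcl //; apply: IH.
  exact: (building_join matI loopI bldG hJ hK eJ eK).
move=> H hH; have [|hHG [e' e'J e'H]] := hs H; first by rewrite inE hH orbT.
split=> //; exists e' => //; apply: (subsetP (sub_cl _ _)).
by rewrite inE e'J.
Qed.

(** Expand the product of the y_(g i) - y_J, which is in the kernel: each factor is the sum of the
    [xi K] with K above g i but not above J. One term is the product sought; the others belong to
    families of larger sets, whose join is again in the building set because all members meet J.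
    Indexed families are needed, as enlarging may identify members. *)
Lemma dkernel_nonnested A k (g : {ffun 'I_k -> {set E}}) :
  (forall i, g i \in Gs) -> cl (\bigcup_i g i) \in Gs ->
  (forall i, ~~ (cl (\bigcup_i g i) \subset g i)) ->
  dkernel A (\prod_i xi (g i)).
Proof.
move: {2}(\sum_i (#|E| - #|g i|))%N (leqnn (\sum_i (#|E| - #|g i|))) => w.
elim/ltn_ind: w g => w IH g hw hg; set J := cl _ => hJ nJ.
have subJ i : g i \subset J.
  by apply: subset_trans (sub_cl _ _); apply: (bigcup_sup i).
have ker : dkernel A (\prod_i (yv (g i) - yv J)).
  rewrite -big_enum /= -(big_map g xpredT (fun G => yv G - yv J)).
  apply: dkernel_list => //.
  - rewrite -size_eq0 size_map size_enum_ord; apply/negP => /eqP k0.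
    have := building_neq0 bldG hJ; rewrite /J big1 ?cl0 ?eqxx //.
    by move=> i; have := ltn_ord i; rewrite {2}k0.
  - by move=> G /mapP[i _ ->]; apply: subset_trans (subJ i) _; apply: sub_cl.
  - by rewrite big_map big_enum.
have difE i : yv (g i) - yv J = \sum_(K | [&& K \in Gs, g i \subset K & ~~ (J \subset K)]) xi K.
  rewrite -!xi_sum // (bigID (fun K => J \subset K)) /=.
  rewrite [X in X + _ - _](eq_bigl (fun K => (K \in Gs) && (J \subset K))).
    by rewrite [LHS]addrC addKr; apply: eq_bigl => K; rewrite andbA.
  move=> K; rewrite -andbA; congr (_ && _).
  case: (boolP (J \subset K)); rewrite ?andbF // andbT; exact: subset_trans.
move: ker; under eq_bigr do rewrite difE.
rewrite bigA_distr_big_dep (bigD1 g) /=; last first.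
  by apply/familyP => i; rewrite unfold_in /= hg subxx nJ.
set r := \sum_(_ | _) _; move=> h; rewrite -[\prod_i _](addrK r); apply: dkernelB => //.
apply: dkernel_sum => f /andP[/familyP hf fg].
have {}hf i : [&& f i \in Gs, g i \subset f i & ~~ (J \subset f i)] by apply: hf.
have gf : J \subset cl (\bigcup_i f i).
  apply: clS => //; apply/bigcupsP => i _; apply: subset_trans (bigcup_sup i _) => //.
  by have /and3P[] := hf i.
have J'E : cl (\bigcup_i f i) = cl (J :|: \bigcup_(K <- map f (enum 'I_k)) K).
  have -> : \bigcup_(K <- map f (enum 'I_k)) K = \bigcup_i f i by rewrite big_map big_enum.
  apply/eqP; rewrite eqEsubset; apply/andP; split.
    by rewrite clS // subsetUr.
  by apply: cl_sub; rewrite ?flat_cl // subUset gf; exact: sub_cl.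
apply: (IH (\sum_i (#|E| - #|f i|))%N) => //.
- have le i : (#|E| - #|f i| <= #|E| - #|g i|)%N.
    by have /and3P[_ s _] := hf i; have := subset_leq_card s; lia.
  have /existsP[i0 hi0] : [exists i, f i != g i].
    apply: contraR fg => /existsPn h'; apply/eqP/ffunP => i; apply/eqP.
    by have := h' i; rewrite negbK.
  have lt : (#|E| - #|f i0| < #|E| - #|g i0|)%N.
    have /and3P[_ s _] := hf i0.
    have pf : g i0 \proper f i0 by rewrite properEneq eq_sym hi0.
    by have := proper_card pf; have := card_setE (f i0); lia.
  apply: leq_trans hw; rewrite (bigD1 i0) //= [X in (_ < X)%N](bigD1 i0) //=.
  by rewrite -addSn; apply: leq_add lt _; apply: leq_sum => i _; apply: le.
- by move=> i; have /and3P[] := hf i.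
- rewrite J'E; apply: building_join_seq => // K /mapP[i _ ->].
  have /and3P[h1 h2 _] := hf i; split=> //.
  have /set0Pn[e eg] := building_neq0 bldG (hg i).
  by exists e; [apply: (subsetP (subJ i))|apply: (subsetP h2)].
move=> i; have /and3P[_ _ h3] := hf i; apply: contra h3; exact: subset_trans.
Qed.

(** An atom has rank 1, never the 2 that [dhr_add1] asks for. For a non-nested monomial, no member
    of an antichain with at least two members contains its join, so [dkernel_nonnested] applies. *)
Lemma dlin_ideal p : in_chow_ideal I Gs p -> dlin set0 (phi p) = 0.
Proof.
move=> [s [hs ->]]; rewrite rmorph_sum raddf_sum big_seq big1 //= => x /hs hx.
rewrite rmorphM /=; suff : dkernel set0 (phi x.2) by apply.
case: hx => [[U [/nestedP hU ->]]|[a [ha ->]]]; last first.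
  rewrite -/(hv Gs a) phi_hv ?(building_atom matI loopI bldG ha) //.
  apply: dkernel_ymon => mu; rewrite mulrC -ymon_add1 dlin_ymon dhr_add1.
  rewrite (_ : quot_rank_ge _ _ _ _ _ = false) ?andbF //.
  apply/negbTE; rewrite negb_forall; apply/existsP; exists set0.
  rewrite /tot big_set0 /cover big_set0 setU0 /contr_rank setU0 rank0 // subn0 -ltnNge.
  case: ha => [/flatP fa /set0Pn[e ea] hmin].
  case: (hmin (cl [set e])) => [||h0|<-]; last by rewrite rank_cl ?rank_set1.
  - exact/flatP/flat_cl.
  - by apply: cl_sub; rewrite ?sub1set.
  by have := subsetP (sub_cl I [set e]) e (set11 e); rewrite h0 inE.
set A := [set enum_val j | j in U] in hU.
have sA : A \subset Gs by apply/subsetP => K /imsetP[j _ ->]; apply: enum_valP.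
have -> : phi (\prod_(j in U) 'X_j) = \prod_(K in A) xi K.
  rewrite rmorph_prod /= big_imset /=; last by move=> ? ? _ _; apply: enum_val_inj.
  by apply: eq_bigr => j _; rewrite phiX.
move: hU; rewrite /is_nested sA /= negb_forall => /existsP[T].
rewrite negb_imply negbK => /andP[/and3P[TA /antichainP anT cT] hJ].
rewrite (big_setID T) /= (setIidPr TA); apply: dkernelMr.
rewrite (big_enum_val (fun K => xi K)).
have := @dkernel_nonnested set0 #|T| [ffun i => enum_val i].
have -> : \bigcup_i [ffun i : 'I_#|T| => enum_val i] i = cover T.
  by rewrite /cover [RHS](big_enum_val (fun K => K)); apply: eq_bigr => i _; rewrite ffunE.
under [\prod_i xi _]eq_bigr do rewrite ffunE.
apply=> // [i|i]; rewrite ffunE; first by apply: (subsetP sA); apply: (subsetP TA); apply: enum_valP.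
apply/negP => sJ; have hi := enum_valP i.
suff : (#|T| <= 1)%N by rewrite leqNgt cT.
rewrite (_ : T = [set enum_val i]) ?cards1 //; apply/setP => K; rewrite inE.
apply/idP/eqP => [hK|->//]; apply: anT => //.
apply: subset_trans sJ; apply: subset_trans (sub_cl _ _); exact: (bigcup_sup K).
Qed.

End ChangeOfVariables.

(** * Residues *)

Section Residues.
Variables (E : finType) (I Gs : {set {set E}}).
Hypotheses (matI : is_matroid I) (loopI : loopless I).
Hypothesis bldG : is_building_set I Gs.
Notation rk := (mrank I).
Notation cl := (mcl I).
Notation N := #|{: {set E}}|.
Notation Y := {mpoly rat[N]}.
Implicit Types (A B F G H J K X Z W : {set E}) (T S P : {set {set E}}).
Implicit Types (mu nu : {set E} -> nat) (p q : Y).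
Notation dlin := (dragon_lin I).
Notation crk := (contr_rank I).
Notation dhr := (dragon_hall_rado I).
Notation rkge := (quot_rank_ge I).
Notation comps := (maxbelow Gs).
Notation flat := (mflat I).
Notation xi := (xi_var Gs).
Notation top := (maxbelow Gs [set: E]).

(** Replaces explicit inversion: a proposed value of [dlin A (xi F * ymon mu)] is checked on upper
    sums, which are values of the functional on monomials. *)
Lemma mobius_uniq (v w : {set E} -> rat) F : F \in Gs ->
  (forall K, K \in Gs -> F \subset K ->
     \sum_(H in Gs | K \subset H) v H = \sum_(H in Gs | K \subset H) w H) ->
  v F = w F.
Proof.
move=> hF hs; suff h k K : (#|E| - #|K| <= k)%N -> K \in Gs -> F \subset K -> v K = w K.
  exact: (h _ F (leqnn _)).
elim/ltn_ind: k K => k IH K hk hK FK.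
have := hs K hK FK.
rewrite [in LHS](bigD1 K) ?hK ?subxx //= [in RHS](bigD1 K) ?hK ?subxx //=.
rewrite (eq_bigr w) => [/addIr//|H /andP[/andP[hH KH] HK]].
have lt : (#|K| < #|H|)%N.
  by apply: proper_card; rewrite properEneq KH eq_sym HK.
have cH : (#|H| <= #|E|)%N := card_setE H.
apply: (IH (#|E| - #|H|)%N) => //; last exact: subset_trans KH.
by move: hk lt cH; clear; lia.
Qed.

Lemma comps_sumr X G : flat X -> G \in Gs ->
  \sum_(H in Gs | G \subset H) (H \in comps X)%:R = (G \subset X)%:R :> rat.
Proof.
move=> hX hG; rewrite -(comps_sum matI loopI bldG hG hX) -sum1_card natr_sum.
rewrite [LHS](bigID (fun H => H \in comps X)) /= [X in _ + X]big1 ?addr0; last first.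
  by move=> H /andP[_ /negPf->].
apply: eq_big => [H|H /andP[_ ->]//].
have -> : (H \in [set K in comps X | G \subset K]) = (H \in comps X) && (G \subset H).
  by rewrite in_set.
case: (boolP (H \in comps X)); rewrite ?andbF ?andbT //=.
by move/comps_building => ->.
Qed.

Lemma dlin_xi_sum A mu K : K \in Gs ->
  \sum_(H in Gs | K \subset H) dlin A (xi H * ymon mu) = (dhr A (add1 K mu))%:R.
Proof.
move=> hK; rewrite -raddf_sum -mulr_suml xi_sum //= -ymon_add1; exact: dlin_ymon.
Qed.

Lemma dlin_xi_ndhr A mu F : F \in Gs -> ~~ dhr A mu -> dlin A (xi F * ymon mu) = 0.
Proof.
move=> hF hn; apply: (mobius_uniq (w := fun=> 0) (v := fun H => dlin A (xi H * ymon mu))) => //.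
by move=> K hK _; rewrite dlin_xi_sum // dhr_add1 (negPf hn) big1.
Qed.

Lemma rkgeS A mu k F K : F \subset K -> rkge A mu k F -> rkge A mu k K.
Proof.
move=> s /forallP h; apply/forallP => T; apply: leq_trans (h T) _.
by apply: crkS => //; apply: setSU.
Qed.

(** All upper sums equal 1, and so do those of the indicator of the components of E. *)
Lemma dlin_xi_rk2 A mu F : F \in Gs -> dhr A mu -> rkge A mu 2 F ->
  dlin A (xi F * ymon mu) = (F \in top)%:R.
Proof.
move=> hF hd h2.
apply: (mobius_uniq (w := fun H => (H \in top)%:R) (v := fun H => dlin A (xi H * ymon mu))) => //.
move=> K hK FK; rewrite dlin_xi_sum // dhr_add1 hd (rkgeS FK h2) comps_sumr ?flatT //.
by rewrite subsetT.
Qed.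

(* T is the largest family whose generic points span the closure of F in the
   contracted matroid. *)
Lemma dlin_xi_rk1 A mu F : F \in Gs -> dhr A mu -> rkge A mu 1 F -> ~~ rkge A mu 2 F ->
  exists T, [/\ (crk A (F :|: cover T) <= (tot mu T).+1)%N,
    (forall T', (crk A (F :|: cover T') <= (tot mu T').+1)%N -> T' \subset T) &
    dlin A (xi F * ymon mu) = (F \in top)%:R - (F \in comps (cl (F :|: cover T :|: A)))%:R].
Proof.
move=> hF hd h1; rewrite negb_forall => /existsP[T0]; rewrite -ltnNge addn2 ltnS => hT0.
pose tight T := (crk A (F :|: cover T) <= (tot mu T).+1)%N.
have [T hT hmax] : exists2 T, tight T & forall T', tight T' -> (#|T'| <= #|T|)%N.
  case: (arg_maxnP (fun T : {set {set E}} => #|T|) (P := tight) hT0) => T hT h.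
  by exists T => // T' /h.
(* Submodularity makes the union of two tight families tight, so one of maximal cardinality contains
   all others. *)
have hmax' T' : tight T' -> T' \subset T.
  move=> hT'; suff /hmax : tight (T :|: T').
    move=> h; have /eqP -> : T == T :|: T' by rewrite eqEcard subsetUl.
    exact: subsetUr.
  have cI1 : F :|: cover (T :&: T') \subset F :|: cover T.
    by apply: setUS; apply/bigcupsP => X /setIP[hX _]; apply: (bigcup_sup X).
  have cI2 : F :|: cover (T :&: T') \subset F :|: cover T'.
    by apply: setUS; apply/bigcupsP => X /setIP[_ hX]; apply: (bigcup_sup X).
  have := crk_submod matI A cI1 cI2; rewrite -setUUr.
  rewrite (_ : cover T :|: cover T' = cover (T :|: T')); last by rewrite /cover bigcup_setU.
  have := totUI mu T T'; move/forallP/(_ (T :&: T')): h1.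
  by move: hT hT'; rewrite /tight; clear; lia.
exists T; split=> //; set Z := cl _.
have hZ : flat Z by apply: flat_cl.
have TZ : F :|: cover T :|: A \subset Z by apply: sub_cl.
apply: (mobius_uniq (w := fun H => (H \in top)%:R - (H \in comps Z)%:R)
  (v := fun H => dlin A (xi H * ymon mu))) => //.
move=> K hK FK; rewrite dlin_xi_sum // sumrB !comps_sumr ?flatT // subsetT dhr_add1 hd /=.
(* Above F, the sets left with rank at least 2 are those not inside Z; the upper sums are thus 1 -
   [K \subset Z], those of the difference of two indicators. *)
suff -> : rkge A mu 2 K = ~~ (K \subset Z) by case: (K \subset Z); rewrite ?subrr ?subr0.
apply/idP/idP => [/forallP/(_ T)|].
  apply: contraTN => KZ; rewrite -ltnNge addn2 ltnS; apply: leq_trans hT.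
  rewrite leq_sub2r // -(rank_cl matI (F :|: cover T :|: A)); apply: rankS => //.
  rewrite -/Z -setUA subUset KZ; apply: subset_trans TZ; apply: setSU; exact: subsetUr.
apply: contraNT; rewrite negb_forall => /existsP[T']; rewrite -ltnNge addn2 ltnS => hT'.
have tT' : tight T' by apply: leq_trans hT'; apply: crkS => //; apply: setSU.
have sT' := hmax' _ tT'.
have e : (crk A (K :|: cover T') <= crk A (F :|: cover T'))%N.
  by apply: leq_trans hT' _; move/forallP/(_ T'): h1; rewrite addn1.
have : K :|: cover T' :|: A \subset cl (F :|: cover T' :|: A).
  apply: sub_cl_rank => //; first by apply: setSU; apply: setSU.
  by rewrite -!(crkE matI) leq_add2r.
rewrite -setUA subUset => /andP[KZ _]; apply: subset_trans KZ _; apply: clS => //.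
apply: setSU; apply: setUS; apply/bigcupsP => X hX; apply: (bigcup_sup X).
exact: (subsetP sT').
Qed.

Lemma rkge1 A mu F : dhr A mu -> (0 < crk A F)%N -> rkge A mu 1 F.
Proof.
move=> hd h0; apply/forallP => T; move/forallP/(_ T): hd => /orP[/eqP->|h].
  by apply: leq_trans h0 _; apply: crkS => //; apply: subsetUl.
by rewrite addn1; apply: leq_trans h _; apply: crkS => //; apply: subsetUr.
Qed.

Lemma crk_split X A B G : flat X -> G \in comps X -> A \subset X -> B \subset X ->
  [disjoint B & G] -> crk A (G :|: B) = (crk A G + crk A B)%N.
Proof.
move=> hX hG sA sB dBG; have sG := comps_sub hG.
have BG : B :&: G = set0 by apply/eqP; rewrite setI_eq0.
have e1 := crkE matI A (G :|: B); have e2 := crkE matI A G; have e3 := crkE matI A B.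
move: e1 e2 e3.
rewrite (rank_split matI loopI bldG (Y := G :|: B :|: A) hX _ hG) ?subUset ?sG ?sB ?sA //.
rewrite (rank_split matI loopI bldG (Y := G :|: A) hX _ hG) ?subUset ?sG ?sA //.
rewrite (rank_split matI loopI bldG (Y := B :|: A) hX _ hG) ?subUset ?sB ?sA //.
rewrite (rank_split matI loopI bldG (Y := A) hX _ hG) //.
have -> : (G :|: B :|: A) :&: G = G by apply/setIidPr; rewrite -setUA subsetUl.
have -> : (G :|: A) :&: G = G by apply/setIidPr; rewrite subsetUl.
have -> : (B :|: A) :&: G = A :&: G by rewrite setIUl BG set0U.
have -> : (G :|: B :|: A) :\: G = (B :|: A) :\: G by rewrite -setUA setDUl setDv set0U.
have -> : (G :|: A) :\: G = A :\: G by rewrite setDUl setDv set0U.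
lia.
Qed.

Lemma cover_comps X F T : flat X -> F \in comps X -> T \subset Gs -> cover T \subset X ->
  (forall H, H \in T -> ~~ (H \subset F)) -> [disjoint cover T & F].
Proof.
move=> hX hF hT sX hn; apply/pred0P => e /=; apply/negP => /andP[/bigcupP[H hH eH] eF].
have HX : H \subset X by apply: subset_trans sX; apply: (bigcup_sup H).
have := building_comps matI loopI bldG hX hF (subsetP hT _ hH) HX.
rewrite (negPf (hn _ hH)) /= => /pred0P/(_ e); by rewrite /= eH eF.
Qed.

Lemma tot_supp mu T : tot mu T = tot mu [set X in T | mu X != 0%N].
Proof.
rewrite /tot (bigID (fun X => mu X != 0%N)) /= [X in (_ + X)%N]big1 ?addn0; last first.
  by move=> X /andP[_ /negPn/eqP].
by apply: eq_bigl => X; rewrite in_set.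
Qed.

Definition below mu F : nat := \sum_(X : {set E} | X \subset F) mu X.

(* Degree reasons: a term contributing to the residue along F must have a monomial
   of full degree rk F - 1 on the restriction to F. *)
Lemma dlin_xi_count mu F : F \in Gs -> F \notin top ->
  (forall X, mu X != 0%N -> X \in Gs) -> dlin set0 (xi F * ymon mu) != 0 ->
  (rk F <= (below mu F).+1)%N.
Proof.
move=> hF nF hmu; case: (boolP (dhr set0 mu)) => hd; last by rewrite dlin_xi_ndhr ?eqxx.
have c0 X : crk set0 X = rk X by rewrite /contr_rank setU0 rank0 // subn0.
have h1 : rkge set0 mu 1 F by apply: rkge1 => //; rewrite c0 rank_gt0 // (building_neq0 bldG hF).
case: (boolP (rkge set0 mu 2 F)) => h2.
  by rewrite dlin_xi_rk2 // (negPf nF) eqxx.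
have [T [hT _ ->]] := dlin_xi_rk1 hF hd h1 h2; rewrite (negPf nF) setU0.
set Z := cl _; case: (boolP (F \in comps Z)) => hFZ; last by rewrite subr0 eqxx.
move=> _; have hZ : flat Z by apply: flat_cl.
pose T2 := [set X in T | (mu X != 0%N) && ~~ (X \subset F)].
have sT2 : cover T2 \subset Z.
  apply: subset_trans (sub_cl I _); apply: subset_trans (subsetUr _ _).
  by apply/bigcupsP => X; rewrite in_set => /andP[hX _]; apply: (bigcup_sup X).
have dT2 : [disjoint cover T2 & F].
  apply: (cover_comps hZ hFZ _ sT2).
    by apply/subsetP => X; rewrite in_set => /and3P[_ /hmu].
  by move=> X; rewrite in_set => /and3P[].
have e : rk (F :|: cover T2) = (rk F + rk (cover T2))%N.
  by have := crk_split hZ hFZ (sub0set _) sT2 dT2; rewrite !c0.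
have le1 : (rk (F :|: cover T2) <= rk (F :|: cover T))%N.
  apply: rankS => //; apply: setUS; apply/bigcupsP => X; rewrite in_set => /andP[hX _].
  exact: (bigcup_sup X).
have le2 : (tot mu T <= below mu F + tot mu T2)%N.
  rewrite tot_supp /tot (bigID (fun X => X \subset F)) /=; apply: leq_add.
    rewrite /below [X in (_ <= X)%N](bigID (fun X => X \in [set X0 in T | mu X0 != 0%N])) /=.
    by apply: leq_trans (leq_addr _ _); apply: eq_leq; apply: eq_bigl => X; rewrite andbC.
  by apply: eq_leq; apply: eq_bigl => X; rewrite !in_set andbA.
have := dhrP T2 hd; move: hT; rewrite !c0.
move: e le1 le2; clear; lia.
Qed.

Definition addk k F mu : {set E} -> nat := fun X => (mu X + k * (X == F))%N.

Lemma tot_addk k F mu T : tot (addk k F mu) T = (tot mu T + k * (F \in T))%N.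
Proof.
rewrite /tot /addk big_split /=; congr (_ + _)%N.
case: (boolP (F \in T)) => hF.
  by rewrite (bigD1 F) //= eqxx big1 ?addn0 // => X /andP[_ /negPf->]; rewrite muln0.
by rewrite big1 ?muln0 // => X XT; case: eqP XT hF => [-> ->//|_]; rewrite muln0.
Qed.

Lemma ymon_addk k F mu : ymon (addk k F mu) = yv F ^+ k * ymon mu.
Proof.
rewrite /ymon (bigD1 F) //= [in RHS](bigD1 F) //= /addk eqxx muln1 addnC exprD -mulrA.
by congr (_ * (_ * _)); apply: eq_bigr => X /negPf->; rewrite muln0 addn0.
Qed.

Lemma crkU A F X : crk A (F :|: X) = (crk A F + crk (A :|: F) X)%N.
Proof.
have e1 := crkE matI A (F :|: X); have e2 := crkE matI A F.
have e3 := crkE matI (A :|: F) X; move: e1 e2 e3.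
rewrite (_ : X :|: (A :|: F) = F :|: X :|: A); first by rewrite [A :|: F]setUC; lia.
by rewrite [A :|: F]setUC setUA [X :|: F]setUC.
Qed.

(** The power of y_F leaves F with rank 1, so [dlin_xi_rk1] gives minus the indicator that F is a
    component of Z. If mu satisfies the condition over A :|: F, the tight family contains nothing of
    mu and Z = cl (A :|: F). If not, a violating family is tight and lies in Z; were F a component
    of Z, contracting F would not change the rank of that family, which would then violate the
    condition over A. *)
Lemma dlin_residue_ymon A F mu : F \in Gs -> F \notin top -> F \in comps (cl (A :|: F)) ->
  (0 < crk A F)%N -> (forall X, mu X != 0%N -> X \in Gs /\ ~~ (X \subset cl (A :|: F))) ->
  dlin A (xi F * (yv F ^+ (crk A F).-1 * ymon mu)) = - dlin (A :|: F) (ymon mu).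
Proof.
move=> hF nF hFA d0 hmu; rewrite -ymon_addk dlin_ymon.
set d := crk A F in d0 *; set nu := addk _ _ _.
have muF : mu F = 0%N.
  apply/eqP; apply: contraT => /hmu[_ /negP[]].
  by apply: subset_trans (sub_cl I _); apply: subsetUr.
have totE T : tot nu T = (tot mu T + d.-1 * (F \in T))%N by rewrite tot_addk.
have n2 : ~~ rkge A nu 2 F.
  rewrite negb_forall; apply/existsP; exists [set F]; rewrite totE set11 /cover big_set1 setUid.
  by rewrite /tot big_set1 muF -/d -ltnNge; move: d0; clear; lia.
case: (boolP (dhr A nu)) => hd; last first.
  rewrite dlin_xi_ndhr // (_ : dhr (A :|: F) mu = false) ?oppr0 //.
  apply: contraNF hd => /forallP h; apply/forallP => T; rewrite totE.
  have := h T; case: (boolP (F \in T)) => FT.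
    have -> : cover T = F :|: cover T by apply/esym/setUidPr; apply: (bigcup_sup F).
    have -> : crk (A :|: F) (F :|: cover T) = crk (A :|: F) (cover T).
      rewrite /contr_rank; congr (rk _ - _)%N; rewrite -setUA; apply/setUidPr.
      by rewrite setUA; apply: subsetUr.
    by rewrite crkU -/d; move: d0; clear; lia.
  rewrite muln0 addn0 => /orP[-> //|h']; apply/orP; right; apply: leq_trans h' _.
  have := crkU A F (cover T); have := rank_submod matI (cover T :|: A) (A :|: F).
  have := @rankS _ _ matI A ((cover T :|: A) :&: (A :|: F)).
  rewrite subsetI subsetUr subsetUl => /(_ isT).
  rewrite /contr_rank (_ : cover T :|: A :|: (A :|: F) = cover T :|: (A :|: F)); first by lia.
  by rewrite -setUA (setUA A A) setUid.
have h1 : rkge A nu 1 F by apply: rkge1.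
have [T [hT hmax ->]] := dlin_xi_rk1 hF hd h1 n2; rewrite (negPf nF) sub0r; congr (- _).
set Z := cl _; have hZ : flat Z by apply: flat_cl.
congr (nat_of_bool _)%:R; apply/idP/idP => [hFZ|/forallP hmu'].
  apply: contraT; rewrite negb_forall => /existsP[T1]; rewrite negb_or -leqNgt => /andP[t0 t1].
  pose T2 := [set X in T1 | mu X != 0%N].
  have tT2 : tot mu T2 = tot mu T1 by rewrite [RHS]tot_supp.
  have cT2 : cover T2 \subset cover T1.
    by apply/bigcupsP => X; rewrite in_set => /andP[hX _]; apply: (bigcup_sup X).
  have c2 : (crk (A :|: F) (cover T2) <= tot mu T2)%N.
    by rewrite tT2; apply: leq_trans t1; apply: crkS.
  have FT2 : F \notin T2 by rewrite in_set muF eqxx andbF.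
  have sT : F |: T2 \subset T.
    apply: hmax; rewrite coverU1 setUA setUid crkU totE setU11 muln1 -/d.
    rewrite /tot big_setU1 //= muF add0n -/(tot mu T2).
    by move: c2 d0; clear; lia.
  have AZ : A \subset Z by apply: subset_trans (sub_cl I _); apply: subsetUr.
  have sT2 : cover T2 \subset Z.
    apply: subset_trans (sub_cl I _); apply: subset_trans (subsetUl _ _).
    apply: subset_trans (subsetUr _ _); apply/bigcupsP => X hX; apply: (bigcup_sup X).
    by apply: (subsetP sT); rewrite inE hX orbT.
  have dT2 : [disjoint cover T2 & F].
    apply: (cover_comps hZ hFZ _ sT2).
      by apply/subsetP => X; rewrite in_set => /andP[_ /hmu[]].
    move=> X; rewrite in_set => /andP[_ /hmu[_]]; apply: contra => s.
    by apply: subset_trans (sub_cl I _); apply: subset_trans s (subsetUr _ _).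
  have := crk_split hZ hFZ AZ sT2 dT2; rewrite crkU => /eqP; rewrite eqn_add2l => /eqP e.
  move/forallP/(_ T2): hd; rewrite totE (negPf FT2) muln0 addn0 -e.
  by move: c2 t0; rewrite -tT2; clear; lia.
suff -> : Z = cl (A :|: F) by [].
have t0 : tot mu T = 0%N.
  have := hmu' T => /orP[/eqP//|h].
  move: hT; rewrite crkU -/d totE; case: (F \in T); move: h d0; clear; lia.
have c0 : crk (A :|: F) (cover T) = 0%N.
  by move: hT; rewrite crkU -/d totE t0; case: (F \in T); move: d0; clear; lia.
have sT : cover T \subset cl (A :|: F).
  apply/sub_clP => //; have := crkE matI (A :|: F) (cover T); rewrite c0 add0n => ->.
  by rewrite setUC.
apply/eqP; rewrite eqEsubset; apply/andP; split.
  apply: cl_sub; rewrite ?flat_cl // !subUset sT andbT.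
  by rewrite -subUset setUC sub_cl.
by apply: clS => //; rewrite subUset subsetUr -setUA subsetUl.
Qed.

(** About the factors [xi K] it only matters which monomials occur in them; their coefficients are
    never computed. *)
Inductive mspan (Q : ({set E} -> nat) -> Prop) : Y -> Prop :=
| mspan_mon mu : Q mu -> mspan Q (ymon mu)
| mspan_add p q : mspan Q p -> mspan Q q -> mspan Q (p + q)
| mspan_scale c p : mspan Q p -> mspan Q (c *: p).

Lemma mspanW (Q Q' : ({set E} -> nat) -> Prop) p : (forall mu, Q mu -> Q' mu) ->
  mspan Q p -> mspan Q' p.
Proof.
move=> h; elim=> [mu /h|q r _ hq _ hr|c q _ hq]; first exact: mspan_mon.
  exact: mspan_add.
exact: mspan_scale.
Qed.

Lemma mspanM (Q1 Q2 Q : ({set E} -> nat) -> Prop) p q :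
  (forall mu nu, Q1 mu -> Q2 nu -> Q (fun X => mu X + nu X)%N) ->
  mspan Q1 p -> mspan Q2 q -> mspan Q (p * q).
Proof.
move=> h hp; elim: hp q => [mu hmu|p1 p2 _ IH1 _ IH2|c p1 _ IH] q hq.
- elim: hq => [nu hnu|q1 q2 _ IH1 _ IH2|c q1 _ IH].
  + by rewrite -ymonD; apply: mspan_mon; apply: h.
  + by rewrite mulrDr; apply: mspan_add.
  + by rewrite -scalerAr; apply: mspan_scale.
- by rewrite mulrDl; apply: mspan_add; [apply: IH1|apply: IH2].
- by rewrite -scalerAl; apply: mspan_scale; apply: IH.
Qed.

Definition single X : {set E} -> nat := fun Z => nat_of_bool (Z == X).

Lemma ymon_single X : ymon (single X) = yv X.
Proof.
rewrite (_ : ymon _ = ymon (add1 X (fun=> 0%N))) ?ymon_add1 ?ymon0 ?mulr1 //.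
Qed.

Lemma mspan_xi (Q : ({set E} -> nat) -> Prop) K : K \in Gs ->
  (forall H, H \in Gs -> K \subset H -> Q (single H)) -> mspan Q (xi K).
Proof.
move=> hK hQ; suff h k H : (#|E| - #|H| <= k)%N -> H \in Gs -> K \subset H -> mspan Q (xi H).
  exact: (h _ K (leqnn _)).
elim/ltn_ind: k H => k IH H hk hH KH.
have mspan0 : mspan Q 0.
  by rewrite -(scale0r (yv H)) -ymon_single; apply/mspan_scale/mspan_mon/hQ.
have := xi_sum hH; rewrite (bigD1 H) ?hH ?subxx //= => /(canRL (addrK _)) ->.
apply: mspan_add; first by rewrite -ymon_single; apply/mspan_mon/hQ.
rewrite -scaleN1r; apply: mspan_scale; apply: big_ind => // [p q|G /andP[/andP[hG HG] GH]].
  exact: mspan_add.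
have lt : (#|H| < #|G|)%N by apply: proper_card; rewrite properEneq HG eq_sym GH.
have cG : (#|G| <= #|E|)%N := card_setE G.
apply: (IH (#|E| - #|G|)%N) => //; last exact: subset_trans HG.
by move: hk lt cG; clear; lia.
Qed.

Definition avoids Z mu : Prop := forall X, mu X != 0%N -> X \in Gs /\ ~~ (X \subset Z).

Lemma avoidsD Z mu nu : avoids Z mu -> avoids Z nu -> avoids Z (fun X => mu X + nu X)%N.
Proof. by move=> h1 h2 X; rewrite addn_eq0 negb_and => /orP[/h1|/h2]. Qed.

Lemma avoids_single Z H : H \in Gs -> ~~ (H \subset Z) -> avoids Z (single H).
Proof. by move=> h1 h2 X; rewrite /single; case: (altP (X =P H)) => [->|]. Qed.

Lemma dlin_residue A F p : F \in Gs -> F \notin top -> F \in comps (cl (A :|: F)) ->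
  (0 < crk A F)%N -> mspan (avoids (cl (A :|: F))) p ->
  dlin A (xi F * (yv F ^+ (crk A F).-1 * p)) = - dlin (A :|: F) p.
Proof.
move=> hF nF hFA d0; elim=> [mu hmu|q r _ IH1 _ IH2|c q _ IH].
- exact: dlin_residue_ymon.
- by rewrite !mulrDr !raddfD /= IH1 IH2.
- by rewrite -!scalerAr !dlinZ IH mulrN.
Qed.

End Residues.

(** * The monomial basis of the Chow ring *)

Section ChowBasis.
Variables (E : finType) (I Gs : {set {set E}}).
Hypotheses (matI : is_matroid I) (loopI : loopless I).
Hypothesis bldG : is_building_set I Gs.
Notation rk := (mrank I).
Notation cl := (mcl I).
Notation n := #|Gs|.
Notation N := #|{: {set E}}|.
Notation Y := {mpoly rat[N]}.
Implicit Types (A B F G H J K X Z W : {set E}) (T S P : {set {set E}}).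
Implicit Types (mu nu : {set E} -> nat) (p q : Y) (m : 'X_{1..n}).
Notation dlin := (dragon_lin I).
Notation crk := (contr_rank I).
Notation dhr := (dragon_hall_rado I).
Notation comps := (maxbelow Gs).
Notation flat := (mflat I).
Notation xi := (xi_var Gs).
Notation top := (maxbelow Gs [set: E]).
Notation phi := (comp_mpoly (xituple Gs)).
Notation nestedb := (is_nested I Gs).
Notation rkdrop := (rank_drop I).

(** A member of largest cardinality is maximal, and by [nested_step] its removal lowers the rank by
    its [rank_drop]. *)
Lemma sum_rkdrop S : nestedb S -> (\sum_(H in S) rkdrop S H)%N = rk (cover S).
Proof.
move: {2}#|S| (erefl #|S|) => k; elim: k S => [|k IH] S.
  by move/eqP; rewrite cards_eq0 => /eqP-> _; rewrite /cover !big_set0 rank0.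
move=> hc hS; have /card_gt0P[F0 hF0] : (0 < #|S|)%N by rewrite hc.
case: (arg_maxnP (fun K : {set E} => #|K|) hF0) => F hF hmax; have {}hF : F \in S := hF.
set P := S :\ F.
have hcP : #|P| = k by have := cardsD1 F S; rewrite hF hc add1n => -[].
have PS : P \subset S by apply: subsetDl.
have nFP H : H \in P -> ~~ (F \subset H).
  rewrite !inE => /andP[HF hH]; apply: contra HF => s.
  by rewrite eq_sym eqEcard s; apply: hmax.
have bP : belowset S F \subset P.
  apply/subsetP => H; rewrite !inE => /andP[-> pH]; rewrite andbT.
  by apply: contraTneq pH => ->; rewrite properxx.
have [_ rkF] := nested_step matI loopI bldG hS PS hF bP nFP.
rewrite (big_setD1 F) //= -/P.
have -> : cover S = cover P :|: F.
  by rewrite -(setD1K hF) coverU1 setUC.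
rewrite rkF -IH ?(nested_sub hS) // addnC; congr (_ + _)%N.
apply: eq_bigr => H hH; rewrite /rank_drop; congr (_ - rk (cover _))%N.
apply/setP => K; rewrite !inE; case: eqP => //= ->; rewrite properE.
by rewrite (negPf (nFP H hH)) !andbF.
Qed.

(** P holds the members already contracted, and the head meets the conditions of [nested_step].
    Maximal elements of the building set are excluded, since no residue is taken at them. *)
Fixpoint ordered S P (s : seq {set E}) : Prop :=
  if s is F :: s' then
    [/\ F \in S, F \notin top, belowset S F \subset P & forall H, H \in P -> ~~ (F \subset H)]
    /\ ordered S (F |: P) s'
  else True.

Lemma ordered_mem S P s F : ordered S P s -> F \in s -> F \in S.
Proof.
elim: s P => //= G s IH P [[h1 _ _ _] h2]; rewrite inE => /orP[/eqP->//|].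
exact: IH h2.
Qed.

Lemma ordered_avoid S P s F H : ordered S P s -> F \in s -> H \in P -> ~~ (F \subset H).
Proof.
elim: s P => //= G s IH P [[_ _ _ h1] h2]; rewrite inE => /orP[/eqP->|hF hH].
  exact: h1.
by apply: (IH _ h2) => //; rewrite inE hH orbT.
Qed.

Lemma nested_avoid P F : nestedb P -> F \in Gs -> (forall H, H \in P -> ~~ (F \subset H)) ->
  ~~ (F \subset cl (cover P)).
Proof.
move=> hP hF hn; apply/negP => s.
have [K] := comps_above hF s; rewrite comps_nested // => /(subsetP (maxelts_sub P)) hK.
exact/negP/hn.
Qed.

(** Repeated residues, each with sign -1. By [nested_step], F is a component once P is contracted
    and its contracted rank is d_F; the remaining factors involve only sets not inside what has been
    contracted. *)
Lemma chain_eval S s P q : nestedb S -> P \subset S -> ordered S P s ->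
  mspan (avoids Gs (cl (cover ([set X in s] :|: P)))) q ->
  dlin (cover P) (\prod_(F <- s) (xi F * yv F ^+ (rkdrop S F).-1) * q) =
  (-1) ^+ size s * dlin (cover ([set X in s] :|: P)) q.
Proof.
move=> hS; elim: s P => [|F s IH] P PS /= hs hq.
  by rewrite big_nil mul1r expr0 mul1r (_ : [set X in [::]] = set0) ?set0U //;
     apply/setP => X; rewrite !inE.
case: hs => [[FS nF bF aF] hs].
have hFG := nested_building hS FS.
have [hFc rkF] := nested_step matI loopI bldG hS PS FS bF aF.
have cE : crk (cover P) F = rkdrop S F by rewrite /contr_rank setUC rkF addKn.
have setE : [set X in F :: s] :|: P = [set X in s] :|: (F |: P).
  by apply/setP => X; rewrite !inE; case: (X == F); case: (X \in s).
have PS' : F |: P \subset S by rewrite subUset sub1set FS.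
have covE : cover P :|: F = cover (F |: P) by rewrite coverU1 setUC.
rewrite big_cons -!mulrA -cE.
rewrite dlin_residue ?cE ?(rkdrop_gt0 matI loopI bldG hS hFG) //.
  rewrite covE IH // -?setE // exprS mulN1r mulNr //.
rewrite covE.
have hPF : nestedb (F |: P) by apply: nested_sub hS PS'.
have avK K : K \in Gs -> (forall H, H \in F |: P -> ~~ (K \subset H)) ->
    forall H, H \in Gs -> K \subset H -> avoids Gs (cl (cover (F |: P))) (single H).
  move=> hK hn H hH KH; apply: avoids_single => //; apply: contra (nested_avoid hPF hK hn).
  exact: subset_trans.
apply: (mspanM (Q1 := avoids Gs (cl (cover (F |: P)))) (Q2 := avoids Gs (cl (cover (F |: P))))).
- exact: avoidsD.
- have m1 : mspan (avoids Gs (cl (cover (F |: P)))) 1.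
    by rewrite -(ymon0 (mu := fun=> 0%N)) //; apply: mspan_mon => X; rewrite eqxx.
  rewrite big_seq; apply: big_ind => // [p1 p2|K hK].
    exact/mspanM/avoidsD.
  have hKn H : H \in F |: P -> ~~ (K \subset H) by apply: ordered_avoid hs hK.
  have hKG := nested_building hS (ordered_mem hs hK).
  apply: (mspanM (@avoidsD _ Gs _)).
    exact/mspan_xi/avK.
  elim: (_.-1) => [|k IHk]; first by rewrite expr0.
  rewrite exprS; apply: (mspanM (@avoidsD _ Gs _)) => //.
  by rewrite -ymon_single; apply: mspan_mon; apply: (avK K).
apply: mspanW hq => mu h X /h[h1 h2]; split=> //; apply: contra h2 => s1.
apply: subset_trans s1 _; apply: clS => //; rewrite setE.
by apply/bigcupsP => K hK; apply: (bigcup_sup K); rewrite inE hK orbT.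
Qed.

Definition nontops := sort (fun X Y : {set E} => #|X| <= #|Y|)%N (enum (Gs :\: top)).

Lemma mem_nontops X : (X \in nontops) = (X \in Gs) && (X \notin top).
Proof. by rewrite mem_sort mem_enum in_setD andbC. Qed.

Lemma nontops_uniq : uniq nontops.
Proof. by rewrite sort_uniq enum_uniq. Qed.

Lemma nontops_cat l1 F l2 : nontops = l1 ++ F :: l2 ->
  (forall H, H \in l1 -> (#|H| <= #|F|)%N) /\ (forall H, H \in l2 -> (#|F| <= #|H|)%N).
Proof.
move=> e; have tr : transitive (fun X Y : {set E} => #|X| <= #|Y|)%N.
  by move=> ? ? ?; apply: leq_trans.
have : sorted (fun X Y : {set E} => #|X| <= #|Y|)%N nontops.
  by apply: sort_sorted => X Z; apply: leq_total.
rewrite e sorted_pairwise // pairwise_cat => /and3P[/allrelP h1 _ /= /andP[/allP h2 _]].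
by split=> H hH; [apply: h1; rewrite ?mem_head|apply: h2].
Qed.

Lemma proper_nontop H G : G \in Gs -> H \proper G -> H \notin top.
Proof.
move=> hG pH; apply/negP => /compsP[_ _ h]; have := h G hG (subsetT _) (proper_sub pH).
by move=> e; rewrite e properxx in pH.
Qed.

Lemma below_before l1 G l2 H : nontops = l1 ++ G :: l2 -> H \in Gs -> H \proper G -> H \in l1.
Proof.
move=> e hH pH; have [_ h2] := nontops_cat e.
have hG : G \in Gs.
  by have := mem_nontops G; rewrite e mem_cat mem_head orbT => /esym/andP[].
have := mem_nontops H; rewrite hH (proper_nontop hG pH) e mem_cat inE.
case/or3P => // [/eqP HG|/h2]; first by rewrite HG properxx in pH.
by rewrite leqNgt proper_card.
Qed.

Lemma nontops_ordered S : nestedb S -> ordered S set0 [seq G <- nontops | G \in S].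
Proof.
move=> hS; suff h l1 l2 : nontops = l1 ++ l2 ->
    ordered S [set G in S | G \in l1] [seq G <- l2 | G \in S].
  have := h [::] nontops erefl; congr (ordered S _ _).
  by apply/setP => X; rewrite !inE andbF.
elim: l2 l1 => //= F l2 IH l1 e.
have IH' := IH (rcons l1 F); rewrite cat_rcons in IH'; move/IH': (e) => {}IH.
case: ifP => FS; last first.
  move: IH; congr (ordered S _ _); apply/setP => X; rewrite !inE mem_rcons inE.
  by case: eqP => [->|]; rewrite ?FS.
split; last first.
  move: IH; congr (ordered S _ _); apply/setP => X; rewrite !inE mem_rcons inE.
  by case: eqP => [->|]; rewrite ?FS.
have [hle _] := nontops_cat e.
have Fn : F \in nontops by rewrite e mem_cat mem_head orbT.
split=> //.
- by move: Fn; rewrite mem_nontops => /andP[].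
- apply/subsetP => H; rewrite !inE => /andP[HS pH]; rewrite HS.
  exact: (below_before e (nested_building hS HS) pH).
move=> H; rewrite inE => /andP[HS hH]; apply/negP => s.
have HF : F = H by apply/eqP; rewrite eqEcard s hle.
have := nontops_uniq; rewrite e cat_uniq => /and3P[_ /hasPn/(_ F)].
by rewrite mem_head => /(_ isT); rewrite HF hH.
Qed.

(** * The pairing of the candidate basis with h-monomials *)

Definition mf m X : nat := \sum_(j < n | enum_val j == X) m j.

Lemma mf_val m (j : 'I_n) : mf m (enum_val j) = m j.
Proof.
rewrite /mf (bigD1 j) //= big1 ?addn0 // => k /andP[/eqP/enum_val_inj-> /eqP//].
Qed.

Lemma mf_building m X : mf m X != 0%N -> X \in Gs.
Proof.
rewrite /mf sum_nat_eq0 negb_forall => /existsP[j]; rewrite negb_imply => /andP[/eqP<- _].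
exact: enum_valP.
Qed.

Lemma mf_msets m X : (X \in msets m) = (mf m X != 0%N).
Proof.
apply/idP/idP => [/imsetP[j]|h].
  by rewrite inE => h ->; rewrite mf_val.
have hX := mf_building h; move: h.
by rewrite -(enum_rankK_in hX hX) mf_val mem_msets.
Qed.

Lemma mf_inj m m' : (forall X, X \in Gs -> mf m X = mf m' X) -> m = m'.
Proof. by move=> h; apply/mnmP => j; rewrite -!mf_val h // enum_valP. Qed.

Lemma mdeg_mf m : mdeg m = (\sum_(X in Gs) mf m X)%N.
Proof. by rewrite mdegE [RHS]big_enum_val; apply: eq_bigr => j _; rewrite mf_val. Qed.

Notation standard := (standard_mnm I (Gs:=Gs)).

Lemma standard_nested m : standard m -> nestedb (msets m).
Proof. by case/andP. Qed.

Lemma standard_lt m X : standard m -> X \in Gs -> (mf m X < rkdrop (msets m) X)%N.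
Proof.
move=> hm hX; have hn := standard_nested hm.
case: (eqVneq (mf m X) 0%N) => [->|h]; first exact: (rkdrop_gt0 matI loopI bldG hn hX).
case/andP: hm => _ /forallP/(_ (enum_rank_in hX X)).
by rewrite -mf_val enum_rankK_in // h.
Qed.

(* [bpol m] has leading monomial 'X_[m] and pairs with [qpol m] to 1 or -1. For a
   maximal G the exponents of the pair add up to one less, as x_G = h_G there. *)
Definition bfac G k : {mpoly rat[n]} :=
  if G \in top then hv Gs G ^+ k else if k is k'.+1 then xv Gs G * hv Gs G ^+ k' else 1.
Definition bpol m := \prod_(j < n) bfac (enum_val j) (m j).
Definition qexp m G : nat :=
  if G \in top then ((rkdrop (msets m) G).-1 - mf m G)%N
  else if mf m G == 0%N then 0%N else (rkdrop (msets m) G - mf m G)%N.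
Definition qpol m := \prod_(j < n) hv Gs (enum_val j) ^+ qexp m (enum_val j).

Lemma bpol_leading m : leading (mdeg m) (mwt m) (bpol m) 'X_[m].
Proof.
rewrite mdegE mpolyXE_id; apply: leading_prod => j.
rewrite /bfac; case: ifP => _; first by have := leadingX (m j) (leading_hv j); rewrite muln1.
case: (m j) => [|k]; first exact: leading1.
rewrite xv_val exprS mulSn -add1n; apply: leadingM; first exact: leadingU.
by have := leadingX k (leading_hv j); rewrite muln1.
Qed.

(** The exponent of y_X left in the image of [bpol m * qpol m'] once the factors [xi] are set
    aside. *)
Definition nuexp m m' X : nat :=
  if X \in Gs then ((if X \in top then mf m X else (mf m X).-1) + qexp m' X)%N else 0%N.

Lemma phi_bq m m' : phi (bpol m * qpol m') =
  (\prod_(G in msets m :\: top) xi G) * ymon (nuexp m m').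
Proof.
rewrite rmorphM !rmorph_prod /= -big_split /=.
transitivity (\prod_(G in Gs) ((if G \in msets m :\: top then xi G else 1) * yv G ^+ nuexp m m' G)).
  rewrite [RHS]big_enum_val; apply: eq_bigr => j _; have hj := enum_valP j.
  rewrite rmorphXn /= phi_hv // /nuexp hj exprD mulrA; congr (_ * _).
  rewrite /bfac -mf_val in_setD mf_msets; case: ifP => ht /=.
    by rewrite rmorphXn /= phi_hv // mul1r.
  case: (mf m (enum_val j)) => [|k] /=; first by rewrite rmorph1 mul1r.
  by rewrite rmorphM rmorphXn /= phi_hv // phi_xv.
rewrite big_split /=; congr (_ * _).
  rewrite -big_mkcondr /=; apply: eq_bigl => G; case: (boolP (G \in _ :\: _)); rewrite ?andbF //.
  by rewrite in_setD mf_msets => /andP[_ /mf_building->].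
rewrite /ymon [RHS](bigID (mem Gs)) /= [X in _ * X]big1 ?mulr1 // => X /negPf h.
by rewrite /nuexp h.
Qed.

Definition counts G c mu : Prop := (forall X, mu X != 0%N -> X \in Gs) /\ (below mu G <= c)%N.

Lemma countsD G c c' mu nu : counts G c mu -> counts G c' nu ->
  counts G (c + c') (fun X => mu X + nu X)%N.
Proof.
move=> [h1 h2] [h1' h2']; split; last by rewrite /below big_split leq_add.
by move=> X; rewrite addn_eq0 negb_and => /orP[/h1|/h1'].
Qed.

Lemma dlin_counts G c p : G \in Gs -> G \notin top -> mspan (counts G c) p ->
  (c.+1 < rk G)%N -> dlin set0 (xi G * p) = 0.
Proof.
move=> hG nG hp hc; elim: hp => [mu [h1 h2]|q r _ IH1 _ IH2|a q _ IH].
- apply/eqP; apply: contraTT hc => h.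
  by rewrite -leqNgt; apply: leq_trans (dlin_xi_count matI loopI bldG hG nG h1 h) _.
- by rewrite mulrDr raddfD /= IH1 IH2 addr0.
- by rewrite -scalerAr dlinZ IH mulr0.
Qed.

Lemma mspan_counts_prod G T mu : T \subset Gs -> (forall X, mu X != 0%N -> X \in Gs) ->
  mspan (counts G (#|[set H in T | H \subset G]| + below mu G))
    (\prod_(H in T) xi H * ymon mu).
Proof.
move=> sT hmu; apply: (mspanM (@countsD _ _ _)); last by apply: mspan_mon.
rewrite -sum1_card (eq_bigl (fun H => (H \in T) && (H \subset G))); last first.
  by move=> H; rewrite inE.
rewrite big_mkcondr /=; apply: (big_ind2 (fun p c => mspan (counts G c) p)).
- rewrite -(ymon0 (mu := fun=> 0%N)) //; apply: mspan_mon; split=> [X|]; first by rewrite eqxx.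
  by rewrite /below big1.
- by move=> p1 c1 p2 c2; apply: mspanM; apply: countsD.
move=> H hH; have hHG := subsetP sT _ hH; apply: mspan_xi => // K hK HK; split.
  by move=> X; rewrite /single; case: (altP (X =P K)) => [->|].
rewrite /below /single -big_mkcondr /= sum1dep_card; case: ifP => HG.
  rewrite -(cards1 K); apply: subset_leq_card; apply/subsetP => X.
  by rewrite !inE => /andP[].
rewrite leqn0 cards_eq0; apply/eqP/setP => X; rewrite !inE; apply/negP => /andP[XG /eqP XK].
by move/negP: HG; apply; apply: subset_trans XG; rewrite XK.
Qed.

Definition agree m m' G := forall H, H \in Gs -> H \proper G -> mf m H = mf m' H.

Lemma belowset_agree m m' G : agree m m' G ->
  belowset (msets m) G = belowset (msets m') G.
Proof.
move=> h; apply/setP => H; rewrite !in_set !mf_msets.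
case: (boolP (H \proper G)) => pH; rewrite ?andbF // !andbT.
apply/idP/idP => h'; have hH := mf_building h'; by move: h'; rewrite (h H hH pH).
Qed.

Lemma rkdrop_agree m m' G : agree m m' G -> rkdrop (msets m) G = rkdrop (msets m') G.
Proof. by move=> /belowset_agree h; rewrite /rank_drop h. Qed.

Lemma agreeS m m' G H : agree m m' G -> H \proper G -> agree m m' H.
Proof. by move=> h pH K hK pK; apply: h => //; apply: proper_trans pH. Qed.

(** Below G the exponents agree, and each H in the support contributes 1 + (m_H - 1) + (d_H - m_H) =
    d_H to the degree inside G; these add up to the rank of the join below G. By [dlin_xi_count] the
    total must be at least rk G - 1, that is, d_G <= m_G + q, where q = 0 if m'_G = 0 and q = d_G -
    m'_G otherwise. *)
Lemma first_diff m m' G : standard m -> standard m' -> G \in Gs -> G \notin top ->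
  agree m m' G -> mf m G != 0%N -> dlin set0 (phi (bpol m * qpol m')) != 0 ->
  (0 < mf m' G)%N && (mf m' G <= mf m G)%N.
Proof.
move=> hm hm' hG nG hag mG; rewrite phi_bq.
have hS := standard_nested hm; set S := msets m in hS *.
have GS : G \in S :\: top by rewrite in_setD nG mf_msets.
rewrite (big_setD1 G) //= -mulrA; set T := (S :\: top) :\ G => hL.
have sT : T \subset Gs.
  apply/subsetP => X; rewrite !in_setD mf_msets => /and3P[_ _]; exact: mf_building.
have hnu X : nuexp m m' X != 0%N -> X \in Gs by rewrite /nuexp; case: ifP.
have hc : (rk G <= (#|[set H in T | H \subset G]| + below (nuexp m m') G).+1)%N.
  rewrite leqNgt; apply: contra hL => hc; apply/eqP.
  exact: (dlin_counts hG nG (mspan_counts_prod G sT hnu) hc).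
set B := belowset S G.
have hB : nestedb B by apply: nested_sub hS _; apply/subsetP => H; rewrite in_set => /andP[].
have sumE : (#|[set H in T | H \subset G]| + below (nuexp m m') G =
    rk (cover B) + nuexp m m' G)%N.
  rewrite -sum_rkdrop // /below (bigD1 G) //= addnCA addnC; congr (_ + _)%N.
  rewrite -sum1_card.
  rewrite [X in (X + _)%N](eq_bigl (fun H => ((H \subset G) && (H != G)) && (H \in S :\: top))); last first.
    move=> H; rewrite -[LHS]/(H \in [set K in T | K \subset G]).
    by rewrite [LHS]in_set in_setD1 andbC andbA.
  rewrite big_mkcondr /= -big_split /=.
  rewrite [RHS](eq_bigl (fun H => ((H \subset G) && (H != G)) && (H \in S))); last first.
    by move=> H; rewrite in_set properEneq andbC [(_ != _) && _]andbC.
  rewrite [RHS]big_mkcondr /=; apply: eq_bigr => H /andP[sH neH].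
  have pH : H \proper G by rewrite properEneq neH.
  have nH := proper_nontop hG pH; rewrite in_setD nH /=.
  have dE : rkdrop B H = rkdrop S H.
    rewrite /rank_drop; congr (_ - rk (cover _))%N; apply/setP => K; rewrite !in_set.
    case: (boolP (K \proper H)) => pK; rewrite ?andbF // !andbT.
    by rewrite (proper_trans pK pH) andbT.
  have dE' : rkdrop S H = rkdrop (msets m') H by apply: rkdrop_agree; apply: agreeS hag pH.
  rewrite dE /nuexp /qexp (negPf nH) mf_msets; case: (boolP (H \in Gs)) => hH; last first.
    by case: (eqVneq (mf m H) 0%N) => // /mf_building h; rewrite h in hH.
  have lt := standard_lt hm' hH; rewrite -dE' in lt *.
  rewrite -(hag _ hH pH) in lt *.
  by case: eqP => h0; move: lt h0; clear => /=; lia.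
move: hc; rewrite sumE /nuexp hG /qexp (negPf nG).
have := standard_lt hm hG; have := standard_lt hm' hG.
rewrite -(rkdrop_agree hag) -/S.
have : rkdrop S G = (rk G - rk (cover B))%N by [].
case: (mf m' G =P 0%N) => h0; move: mG h0; clear => /=.
  by lia.
by lia.
Qed.

Definition nutop m m' X : nat :=
  if X \in top then (mf m X + ((rkdrop (msets m) X).-1 - mf m' X))%N else 0%N.

(** When m and m' agree off [top], y_G has exponent (m_G - 1) + (d_G - m_G) = d_G - 1 for each
    non-maximal G in the support, just what the residue at G consumes. A monomial in the maximal
    elements remains. *)
Lemma top_eval m m' : standard m -> standard m' ->
  (forall X, X \in nontops -> mf m X = mf m' X) ->
  dlin set0 (phi (bpol m * qpol m')) =
  (-1) ^+ size [seq G <- nontops | G \in msets m]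
    * (dhr (cover (msets m :\: top)) (nutop m m'))%:R.
Proof.
move=> hm hm' hag; have hS := standard_nested hm; set S := msets m in hS *.
have hag' G : G \in Gs -> agree m m' G.
  by move=> hG H hH pH; apply: hag; rewrite mem_nontops hH (proper_nontop hG pH).
set s := [seq _ <- _ | _].
have memS X : (X \in s) = (X \in S :\: top).
  rewrite mem_filter mem_nontops in_setD /S mf_msets.
  case: (eqVneq (mf m X) 0%N) => [_|/mf_building->]; first by rewrite andbF.
  by rewrite andbT.
have us : uniq s by rewrite filter_uniq // nontops_uniq.
have setS : [set X in s] :|: set0 = S :\: top.
  by apply/setP => X; rewrite setU0 in_set memS.
have := @chain_eval S s set0 (ymon (nutop m m')) hS (sub0set _) (nontops_ordered hS).
rewrite setS (_ : cover set0 = set0); last by rewrite /cover big_set0.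
rewrite dlin_ymon => <-; last first.
  apply: mspan_mon => X; rewrite /nutop; case: ifP => // ht _.
  have hX := comps_building ht; split=> //.
  apply: nested_avoid => //; first by apply: nested_sub hS _; apply: subsetDl.
  move=> H; rewrite in_setD => /andP[nH hH]; apply: contra nH => XH.
  case/compsP: (ht) => _ _ h.
  by rewrite (h H (nested_building hS hH) (subsetT _) XH).
congr (dlin _ _); rewrite phi_bq big_split /= -mulrA.
have prodE (f : {set E} -> Y) : \prod_(F <- s) f F = \prod_(F in S :\: top) f F.
  by rewrite big_uniq //; apply: eq_bigl => X; rewrite memS.
rewrite !prodE; congr (_ * _).
rewrite big_mkcond /= /ymon -big_split /=; apply: eq_bigr => X _.
rewrite /nuexp /nutop /qexp in_setD.
case: (boolP (X \in top)) => ht /=.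
  by rewrite (comps_building ht) mul1r -(rkdrop_agree (hag' X (comps_building ht))).
case: (boolP (X \in Gs)) => hX; last first.
  rewrite mf_msets; case: (eqVneq (mf m X) 0%N) => [|/mf_building h]; last by rewrite h in hX.
  by rewrite mulr1.
rewrite mulr1 mf_msets -hag ?mem_nontops ?hX // -(rkdrop_agree (hag' X hX)).
have := standard_lt hm hX; case: eqP => /= [->//|h0 lt].
by congr (_ ^+ _); move: h0 lt; rewrite /S; clear; lia.
Qed.

Lemma crk_top m G : standard m -> G \in top ->
  crk (cover (msets m :\: top)) G = rkdrop (msets m) G.
Proof.
move=> hm hG; have hS := standard_nested hm; set S := msets m in hS *.
have := crkE matI (cover (S :\: top)) G.
rewrite (rank_split matI loopI bldG (flatT I) (subsetT (G :|: _)) hG).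
rewrite [rk (cover _)](rank_split matI loopI bldG (flatT I) (subsetT _) hG).
have -> : (G :|: cover (S :\: top)) :&: G = G by apply/setIidPr/subsetUl.
have -> : (G :|: cover (S :\: top)) :\: G = cover (S :\: top) :\: G.
  by rewrite setDUl setDv set0U.
have -> : cover (S :\: top) :&: G = cover (belowset S G).
  apply/eqP; rewrite eqEsubset; apply/andP; split.
    apply/subsetP => z /setIP[/bigcupP[H hH zH] zG]; apply/bigcupP; exists H => //.
    move: hH; rewrite in_setD => /andP[nH hH]; rewrite in_set hH properEneq.
    have HG : H != G by apply: contraNneq nH => ->.
    rewrite HG; have := building_comps matI loopI bldG (flatT I) hG (nested_building hS hH) (subsetT _).
    by case/orP=> // /pred0P/(_ z); rewrite /= zH zG.
  apply/bigcupsP => H; rewrite in_set => /andP[hH pH]; rewrite subsetI (proper_sub pH) andbT.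
  by apply: (bigcup_sup H); rewrite in_setD hH (proper_nontop (comps_building hG) pH).
rewrite /rank_drop -/S; lia.
Qed.

Lemma crk_tops A T : T \subset top -> crk A (cover T) = (\sum_(G in T) crk A G)%N.
Proof.
move: {2}#|T| (erefl #|T|) => k; elim: k T => [|k IH] T.
  move/eqP; rewrite cards_eq0 => /eqP-> _; rewrite big_set0 /cover big_set0.
  by rewrite /contr_rank set0U subnn.
move=> hc hT; have /card_gt0P[G hG] : (0 < #|T|)%N by rewrite hc.
have hk : #|T :\ G| = k by have := cardsD1 G T; rewrite hG hc add1n => -[].
have hT' : T :\ G \subset top by apply: subset_trans hT; apply: subsetDl.
have hGt := subsetP hT _ hG.
rewrite (big_setD1 G) //= -IH // -{1}(setD1K hG) coverU1.
apply: (crk_split matI loopI bldG (flatT I)) => //.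
apply/pred0P => e /=; apply/negP => /andP[/bigcupP[H hH eH] eG].
move: hH; rewrite in_setD1 => /andP[/eqP HG hH]; apply: HG.
exact: (comps_disjoint matI loopI bldG (flatT I) (subsetP hT _ hH) hGt eH eG).
Qed.

(** The remaining exponents are d_G - 1 at each maximal G, and the contracted ranks d_G of the
    maximal elements add up, so every nonempty family of them has total below its rank. *)
Lemma bq_diag m : standard m -> dlin set0 (phi (bpol m * qpol m)) != 0.
Proof.
move=> hm; rewrite top_eval //; set s := size _; set A := cover _.
suff -> : dhr A (nutop m m) by rewrite mulr1 expf_neq0 // oppr_eq0 oner_eq0.
have nuE X : X \in top -> (nutop m m X).+1 = crk A X.
  move=> hX; rewrite /nutop hX crk_top //.
  by have := standard_lt hm (comps_building hX); lia.
apply/forallP => T; pose T' := T :&: top.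
have tE : tot (nutop m m) T = tot (nutop m m) T'.
  rewrite /tot (big_setID top) /= [X in (_ + X)%N]big1 ?addn0 // => X.
  by rewrite in_setD /nutop => /andP[/negPf->].
case: (set_0Vmem T') => [T0|[G hG]]; first by rewrite tE T0 /tot big_set0.
apply/orP; right; rewrite tE.
have le : (crk A (cover T') <= crk A (cover T))%N.
  apply: crkS => //; apply/bigcupsP => X /setIP[hX _]; exact: (bigcup_sup X).
apply: leq_trans le; rewrite crk_tops ?subsetIr // /tot.
rewrite (big_setD1 G) //= [X in (_ < X)%N](big_setD1 G) //= -nuE; last by case/setIP: hG.
rewrite ltnS leq_add2l; apply: leq_sum => X; rewrite in_setD1 => /andP[_ /setIP[_ hX]].
by rewrite -nuE.
Qed.

(** For the family consisting of X alone the condition gives m_X <= m'_X, as d_X - 1 - m'_X + m_X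
    must stay below d_X; equal degrees then force equality. *)
Lemma top_diff m m' : standard m -> standard m' -> mdeg m = mdeg m' ->
  (forall X, X \in nontops -> mf m X = mf m' X) ->
  dlin set0 (phi (bpol m * qpol m')) != 0 -> m = m'.
Proof.
move=> hm hm' hd hag; rewrite top_eval //.
case: (boolP (dhr _ _)) => h; last by rewrite mulr0 eqxx.
move=> _; have le X : X \in Gs -> (mf m X <= mf m' X)%N.
  move=> hX; case: (boolP (X \in top)) => ht; last by rewrite hag // mem_nontops hX.
  move/forallP/(_ [set X]): h; rewrite /tot /cover !big_set1 crk_top // /nutop ht.
  have hag' : agree m m' X.
    by move=> H hH pH; apply: hag; rewrite mem_nontops hH (proper_nontop hX pH).
  have := standard_lt hm' hX; rewrite -(rkdrop_agree hag'); lia.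
have [_] := leqif_sum (P := fun X => X \in Gs) (fun X hX => leqif_eq (le X hX)).
rewrite -!mdeg_mf hd eqxx => /esym/forall_inP h'.
by apply: mf_inj => X hX; apply/eqP/h'.
Qed.

Section Independence.
Variable i : nat.

(* Exponent 0 counts as the largest one: at the first difference G, a nonzero
   pairing of m with m' forces G into the support of m' if it is in that of m. *)
Definition kap k : nat := if k == 0%N then i.+1 else k.
(** Lexicographic comparison of the digits [kap], in base i + 2, packed into one natural number that
    can be maximised; a is the value of the digits already read. *)
Definition keyr (a : nat) (l : seq {set E}) m :=
  foldl (fun a G => (a * i.+2 + kap (mf m G))%N) a l.

Lemma mf_le m X : (mf m X <= mdeg m)%N.
Proof.
case: (boolP (X \in Gs)) => hX; first by rewrite mdeg_mf (bigD1 X) //= leq_addr.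
by case: (eqVneq (mf m X) 0%N) => [->//|/mf_building h]; rewrite h in hX.
Qed.

Lemma kap_lt m X : mdeg m = i -> (kap (mf m X) < i.+2)%N.
Proof. by move=> h; have := mf_le m X; rewrite h /kap; case: eqP; lia. Qed.

Lemma keyr_lt a a' l m m' : mdeg m = i -> (a < a')%N -> (keyr a l m < keyr a' l m')%N.
Proof.
move=> hd; elim: l a a' => //= G l IH a a' lt; apply: IH.
have := kap_lt G hd; nia.
Qed.

Lemma keyr_diff m m' : standard m -> standard m' -> mdeg m = i -> mdeg m' = i ->
  m != m' -> dlin set0 (phi (bpol m * qpol m')) != 0 ->
  (keyr 0 nontops m' < keyr 0 nontops m)%N.
Proof.
move=> hm hm' hd hd' ne hL.
suff h l1 l2 a : nontops = l1 ++ l2 -> (forall X, X \in l1 -> mf m X = mf m' X) ->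
    (keyr a l2 m' < keyr a l2 m)%N by apply: (h [::]).
elim: l2 l1 a => [|G l2 IH] l1 a e hag.
  case/eqP: ne; apply: top_diff => //; first by rewrite hd.
  by move=> X; rewrite e cats0 => /hag.
case: (eqVneq (mf m G) (mf m' G)) => [eG|nG].
  rewrite /keyr /= eG -/(keyr _ _ _) -/(keyr _ _ _); apply: (IH (rcons l1 G)).
    by rewrite cat_rcons.
  by move=> X; rewrite mem_rcons inE => /orP[/eqP->|/hag].
apply: (@keyr_lt (a * i.+2 + kap (mf m' G)) (a * i.+2 + kap (mf m G)) l2) => //; rewrite ltn_add2l.
have : G \in nontops by rewrite e mem_cat mem_head orbT.
rewrite mem_nontops => /andP[hG ntG].
have ag : agree m m' G by move=> H hH pH; apply: hag; apply: (below_before e).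
case: (eqVneq (mf m G) 0%N) => [m0|m0].
  have := mf_le m' G; rewrite /kap m0 /= hd'; rewrite m0 eq_sym in nG.
  by rewrite (negPf nG); lia.
have := first_diff hm hm' hG ntG ag m0 hL; rewrite /kap (negPf m0).
by case: eqP; move: nG; lia.
Qed.

(** Pair the relation with [qpol m0], where m0 has the largest key among the monomials with nonzero
    coefficient: by [keyr_diff], any other one with nonzero pairing would have a larger key. *)
Lemma bpol_free (c : 'X_{1..n} -> rat) :
  in_chow_ideal I Gs (\sum_(m : 'X_{1..n < i.+1} | standard m && (mdeg m == i)) c m *: bpol m) ->
  forall m : 'X_{1..n < i.+1}, standard m -> mdeg m = i -> c m = 0.
Proof.
move=> hI m1 hm1 hd1; apply/eqP; apply: contraT => c1.
pose Q := [pred m : 'X_{1..n < i.+1} | [&& standard m, mdeg m == i & c m != 0]].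
have Q1 : Q m1 by rewrite /= hm1 hd1 eqxx.
case: (arg_maxnP (fun m : 'X_{1..n < i.+1} => keyr 0 nontops m) Q1).
move=> m0 /and3P[hm0 /eqP hd0 c0] hmax.
have := dlin_ideal matI loopI bldG (chow_idealMr (qpol m0) hI).
rewrite mulr_suml rmorph_sum raddf_sum (bigD1 m0) /= ?hm0 ?hd0 ?eqxx // big1.
  rewrite addr0 -scalerAl comp_mpolyZ dlinZ => /eqP; rewrite mulf_eq0 (negPf c0) /=.
  by rewrite (negPf (bq_diag hm0)).
move=> m /andP[/andP[hm /eqP hd] ne]; rewrite -scalerAl comp_mpolyZ dlinZ.
case: (eqVneq (c m) 0) => [->|cm]; first by rewrite mul0r.
case: (eqVneq (dlin set0 (phi (bpol m * qpol m0))) 0) => [->|hL]; first by rewrite mulr0.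
have := keyr_diff hm hm0 hd hd0 ne hL; rewrite ltnNge => /negP[]; apply: hmax.
by rewrite /= hm hd eqxx.
Qed.

Lemma chow_dim_standard :
  chow_dim I Gs i #|[pred m : 'X_{1..n < i.+1} | standard m && (mdeg m == i)]|.
Proof.
set Q := [pred m | _]; pose ev (j : 'I_#|Q|) : 'X_{1..n < i.+1} := enum_val j.
exists (fun j => bpol (ev j)).
have hQ j : standard (ev j) /\ mdeg (ev j) = i.
  by have := enum_valP j; rewrite inE => /andP[h /eqP].
split.
- move=> j m hm; have [_ <-] := hQ j.
  by have [->] := leading_hw (bpol_leading (ev j)) hm.
- move=> c hc j.
  pose c' (m : 'X_{1..n}) : rat := \sum_(l < #|Q| | bmnm (ev l) == m) c l.
  have c'E l : c' (ev l) = c l.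
    rewrite /c' (bigD1 l) //= big1 ?addr0 // => k /andP[/eqP h /negP[]].
    by apply/eqP/enum_val_inj/val_inj.
  rewrite -c'E; have [h1 h2] := hQ j; apply: bpol_free => //.
  rewrite (big_enum_val (A := Q) (fun m : 'X_{1..n < i.+1} => c' m *: bpol m)).
  rewrite (eq_bigr (fun l => c l *: bpol (ev l))) // => l _.
  by rewrite -(c'E l).
move=> p /(spanned_homog matI loopI bldG bpol_leading)[c hc].
exists (fun j => c (ev j)).
by rewrite -(big_enum_val (A := Q) (fun m : 'X_{1..n < i.+1} => c m *: bpol m)).
Qed.

End Independence.

End ChowBasis.

(** * The cone of gamma-positive polynomials *)

Section GammaCone.
Implicit Types p q : {poly rat}.

Definition gmon (d i : nat) : {poly rat} := 'X^i * (1 + 'X) ^+ (d - 2 * i).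

(** Here d is a formal degree, twice the centre of symmetry; the degree itself can be smaller, as
    for [tp d]. *)
Inductive gpos (d : nat) : {poly rat} -> Prop :=
| gpos0 : gpos d 0
| gpos_add p q : gpos d p -> gpos d q -> gpos d (p + q)
| gpos_mon i c : 0 <= c -> (2 * i <= d)%N -> gpos d (c *: gmon d i).

Lemma gpos_sum d (J : Type) (s : seq J) (Q : pred J) (f : J -> {poly rat}) :
  (forall j, Q j -> gpos d (f j)) -> gpos d (\sum_(j <- s | Q j) f j).
Proof. by move=> h; apply: big_ind => //; [apply: gpos0|apply: gpos_add]. Qed.

Lemma gposM d d' p q : gpos d p -> gpos d' q -> gpos (d + d') (p * q).
Proof.
move=> hp; elim: hp q => [q _|p1 p2 _ IH1 _ IH2 q hq|i c hc hi q hq].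
- by rewrite mul0r; apply: gpos0.
- by rewrite mulrDl; apply: gpos_add; [apply: IH1|apply: IH2].
elim: hq => [|q1 q2 _ IH1 _ IH2|j c' hc' hj].
- by rewrite mulr0; apply: gpos0.
- by rewrite mulrDr; apply: gpos_add.
rewrite -scalerAl -scalerAr scalerA.
have -> : gmon d i * gmon d' j = gmon (d + d') (i + j).
  rewrite /gmon mulrACA -!exprD; congr (_ * _ ^+ _).
  by move: hi hj; lia.
by apply: gpos_mon; [apply: mulr_ge0|lia].
Qed.

Lemma gpos1 : gpos 0 1.
Proof.
have := @gpos_mon 0 0 1 ler01 (leqnn 0).
by rewrite scale1r /gmon muln0 subnn !expr0 mulr1.
Qed.

Lemma gposX1 d : gpos d ((1 + 'X) ^+ d).
Proof.
have := @gpos_mon d 0 1 ler01 (leq0n d).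
by rewrite scale1r /gmon muln0 subn0 expr0 mul1r.
Qed.

Lemma gpos_expand d p : gpos d p -> exists g : nat -> rat, (forall i, 0 <= g i) /\
  p = \sum_(i < (d %/ 2).+1) g i *: gmon d i.
Proof.
elim=> [|p1 p2 _ [g1 [h1 ->]] _ [g2 [h2 ->]]|i c hc hi].
- by exists (fun=> 0); split=> //; rewrite big1 // => i _; rewrite scale0r.
- exists (fun i => g1 i + g2 i); split; first by move=> i; apply: addr_ge0.
  by rewrite -big_split; apply: eq_bigr => i _; rewrite /= scalerDl.
have hi' : (i < (d %/ 2).+1)%N by rewrite ltnS leq_divRL // mulnC.
exists (fun j => if j == i then c else 0); split; first by move=> j; case: ifP.
rewrite (bigD1 (Ordinal hi')) //= eqxx big1 ?addr0 // => j; rewrite -val_eqE /= => /negPf->.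
by rewrite scale0r.
Qed.

Lemma size_gmon d i : (2 * i <= d)%N -> size (gmon d i) = (d - i).+1.
Proof.
move=> h; have e : 1 + 'X = 'X + 1%:P :> {poly rat} by rewrite addrC polyC1.
rewrite /gmon e size_monicM ?monicXn ?size_polyXn //; last first.
  by rewrite expf_neq0 // -size_poly_eq0 size_XaddC.
by rewrite -[1%:P]opprK -polyCN size_exp_XsubC /=; lia.
Qed.

(** Only the summand i = 0 has a constant term, so g_0 = 1 and the degree is exactly d, which is how
    [gamma_positive] reads it off from [size]. *)
Lemma gpos_gamma d p : gpos d p -> p`_0 = 1 -> gamma_positive p.
Proof.
move=> /gpos_expand[g [hg hp]] p0.
have g0 : g 0%N = 1.
  move: p0; rewrite hp coef_sum big_ord_recl big1 ?addr0.
    by rewrite coefZ /gmon /= expr0 mul1r -horner_coef0 horner_exp hornerD hornerX -polyC1 hornerC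
       addr0 expr1n mulr1.
  by move=> i _; rewrite coefZ /gmon coefXnM /= mulr0.
have sz : size p = d.+1.
  rewrite hp big_ord_recl /= g0 scale1r size_polyDl; first by rewrite size_gmon ?subn0.
  rewrite size_gmon // subn0 (leq_ltn_trans (size_sum _ _ _)) // ltnS.
  apply/bigmax_leqP => i _; apply: leq_trans (size_scale_leq _ _) _.
  have hi : (2 * bump 0 i <= d)%N.
    by rewrite /bump /= add1n mulnC -leq_divRL.
  by rewrite size_gmon // /bump /=; move: hi; rewrite /bump /=; lia.
by exists g; split=> //; rewrite sz /= hp.
Qed.

(* [tp] and [vp] arise by summing products of the [up] over compositions of d, the
   last factor being [up], respectively [1 + up]. *)
Definition up (d : nat) : {poly rat} := \sum_(1 <= a < d) 'X^a.
Definition tp (d : nat) : {poly rat} := if (1 < d)%N then 'X * (1 + 'X) ^+ (d - 2) else 0.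
Definition vp (d : nat) : {poly rat} := (1 + 'X) ^+ d.-1.

Lemma up1 : up 1 = 0. Proof. by rewrite /up big_geq. Qed.

Lemma upS d : (0 < d)%N -> up d.+1 = 'X * up d + 'X.
Proof.
move=> h; rewrite /up big_ltn // expr1 addrC big_add1 /=; congr (_ + _).
by rewrite mulr_sumr; apply: eq_bigr => a _; rewrite exprS.
Qed.

Lemma vp1 : vp 1 = 1. Proof. by rewrite /vp expr0. Qed.
Lemma tp1 : tp 1 = 0. Proof. by []. Qed.
Lemma tp2 : tp 2 = 'X. Proof. by rewrite /tp /= subnn expr0 mulr1. Qed.

Lemma vp_rec d : (0 < d)%N -> vp d = (1 + up d) + \sum_(1 <= j < d) up j * vp (d - j).
Proof.
elim: d => // -[_ _|d IH _].
  by rewrite up1 big_geq // !addr0 /vp expr0.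
rewrite big_nat_recr //= subSnn vp1 mulr1.
have -> : \sum_(1 <= j < d.+1) up j * vp (d.+2 - j) =
    (1 + 'X) * \sum_(1 <= j < d.+1) up j * vp (d.+1 - j).
  rewrite mulr_sumr; apply: eq_big_nat => j /andP[_ hj].
  rewrite mulrCA; congr (_ * _); rewrite /vp -exprS; congr (_ ^+ _).
  by move: hj; lia.
rewrite upS // [LHS](_ : _ = (1 + 'X) * vp d.+1); last by rewrite /vp -exprS.
rewrite IH //; ring.
Qed.

Lemma tp_rec d : (0 < d)%N -> tp d = up d + \sum_(1 <= j < d) up j * tp (d - j).
Proof.
elim: d => // -[_ _|d IH _]; first by rewrite up1 big_geq // addr0.
rewrite big_nat_recr //= subSnn tp1 mulr0 addr0.
(* Multiplication by 1 + t takes [tp k] to [tp k.+1] only from k = 2 on, as [tp 1] is 0 and [tp 2]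
   is t; hence the last two terms of the convolution are split off. *)
have tpS k : (1 < k)%N -> tp k.+1 = (1 + 'X) * tp k.
  by case: k => [|[|k]] //= _; rewrite /tp /= mulrCA -exprS !subSS !subn0.
case: d IH => [|d] IH.
  by rewrite big_geq // addr0 upS // up1 mulr0 add0r tp2.
rewrite big_nat_recr //= subSn // subSnn.
have -> : \sum_(1 <= j < d.+1) up j * tp (d.+3 - j) =
    (1 + 'X) * \sum_(1 <= j < d.+1) up j * tp (d.+2 - j).
  rewrite mulr_sumr; apply: eq_big_nat => j /andP[_ hj].
  by rewrite mulrCA -tpS ?subSn //; move: hj; lia.
have := IH isT; rewrite big_nat_recr //= subSnn tp1 mulr0 addr0 => e.
rewrite tpS // e (upS (d := d.+2)) // (upS (d := d.+1)) // tp2.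
ring.
Qed.

Lemma gpos_tp d : gpos d (tp d).
Proof.
rewrite /tp; case: ifP => h; last exact: gpos0.
by have := @gpos_mon d 1 1 ler01 h; rewrite scale1r /gmon expr1 muln1.
Qed.

End GammaCone.

(** * Sums over nested sets *)

Section NestedSums.
Variables (E : finType) (I Gs : {set {set E}}).
Hypotheses (matI : is_matroid I) (loopI : loopless I).
Hypothesis bldG : is_building_set I Gs.
Notation rk := (mrank I).
Notation cl := (mcl I).
Notation comps := (maxbelow Gs).
Notation flat := (mflat I).
Notation nestedb := (is_nested I Gs).
Notation rkdrop := (rank_drop I).
Implicit Types (A B C D F G H K R X Y Z : {set E}) (S T : {set {set E}}).

Definition wgt S : {poly rat} := \prod_(G in S) up (rkdrop S G).
Definition nested_sum X : {poly rat} := \sum_(S | nestedb S && (cl (cover S) == X)) wgt S.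
Notation av := nested_sum.
(** For X = [setT] this is the Chow polynomial, by [hpart_coef]; other X arise when it is split into
    components. *)
Definition hpart X : {poly rat} := \sum_(S | nestedb S && (cover S \subset X)) wgt S.

Lemma nested0 : nestedb set0.
Proof.
rewrite /is_nested sub0set; apply/forallP => T; apply/implyP.
by rewrite subset0 => /and3P[/eqP-> _]; rewrite cards0.
Qed.

Lemma cover0 : cover (set0 : {set {set E}}) = set0.
Proof. by rewrite /cover big_set0. Qed.

Lemma cover_eq0 S : nestedb S -> (cover S == set0) = (S == set0).
Proof.
move=> hS; apply/eqP/eqP => [h|->]; last exact: cover0.
apply/eqP; rewrite -subset0; apply/subsetP => G hG.
have := building_neq0 bldG (nested_building hS hG); rewrite -subset0 -h.
by rewrite (bigcup_sup G).
Qed.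

Lemma wgt0 : wgt set0 = 1.
Proof. by rewrite /wgt big_set0. Qed.

Lemma av0 : av set0 = 1.
Proof.
rewrite /av (bigD1 set0) /= ?nested0 ?cover0 ?cl0 ?eqxx // wgt0 big1 ?addr0 //.
move=> S /andP[/andP[hS /eqP h] /negP[]]; rewrite -cover_eq0 // -subset0 -h; exact: sub_cl.
Qed.

Lemma hpart0 : hpart set0 = 1.
Proof.
rewrite /hpart (bigD1 set0) /= ?nested0 ?cover0 ?sub0set // wgt0 big1 ?addr0 //.
by move=> S /andP[/andP[hS h] /negP[]]; rewrite -cover_eq0 // -subset0.
Qed.

(** * Multiplicativity over the components of a flat *)

Section Split.
Variables (X K : {set E}).
Hypotheses (hX : flat X) (hK : K \in comps X).
Let R := X :\: K.

Lemma split_sub : K \subset X. Proof. exact: comps_sub hK. Qed.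

Lemma flat_comp : flat K. Proof. exact/building_flat/comps_building/hK. Qed.

Lemma splitX : X = K :|: R.
Proof.
apply/setP => z; rewrite /R !inE.
by case: (boolP (z \in K)) => //= zK; rewrite (subsetP split_sub).
Qed.

Lemma cl_split_sub Y Z : Y \subset K -> Z \subset R -> cl (Y :|: Z) \subset cl Y :|: cl Z.
Proof.
move=> YK ZR; apply/subsetP => e he.
have YZX : Y :|: Z \subset X.
  by rewrite subUset (subset_trans YK split_sub) (subset_trans ZR (subsetDl _ _)).
have eX : e \in X by apply: (subsetP (cl_sub matI hX YZX)).
rewrite inE; case: (boolP (e \in K)) => eK.
  apply/orP; left; have := cl_comps matI loopI bldG hX YZX hK eK he.
  apply: (subsetP (clS _ _)) => //; apply/subsetP => z.
  rewrite !inE => /andP[/orP[//|/(subsetP ZR)]]; rewrite inE => /andP[/negPf->] //.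
apply/orP; right; have := cl_compsC matI loopI bldG hX YZX hK eX eK he.
apply: (subsetP (clS _ _)) => //; apply/subsetP => z.
by rewrite !inE => /andP[zK /orP[/(subsetP YK) h|//]]; rewrite h in zK.
Qed.

Lemma cl_split Y Z : Y \subset K -> Z \subset R -> cl (Y :|: Z) = cl Y :|: cl Z.
Proof.
move=> YK ZR; apply/eqP; rewrite eqEsubset cl_split_sub //=.
by rewrite subUset !clS ?subsetUl ?subsetUr.
Qed.

Lemma flat_compC : flat R.
Proof.
rewrite /mflat eqEsubset sub_cl andbT; apply/subsetP => e he.
have RX : R \subset X by apply: subsetDl.
have eX : e \in X by apply: (subsetP (cl_sub matI hX RX)).
rewrite inE eX andbT; apply/negP => eK.
have := cl_comps matI loopI bldG hX RX hK eK he.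
rewrite (_ : R :&: K = set0) ?cl0 ?inE //; apply/setP => z.
by rewrite /R !inE; case: (z \in K); rewrite ?andbF.
Qed.

Lemma flat_union Y Z : Y \subset K -> Z \subset R -> flat Y -> flat Z -> flat (Y :|: Z).
Proof. by move=> YK ZR /eqP hY /eqP hZ; rewrite /mflat cl_split // hY hZ. Qed.

Lemma unionK Y Z : Y \subset K -> Z \subset R -> (Y :|: Z) :&: K = Y.
Proof.
move=> YK ZR; apply/setP => z; rewrite !inE.
case: (boolP (z \in Y)) => [/(subsetP YK)-> //|_] /=.
by case: (boolP (z \in Z)) => // /(subsetP ZR); rewrite inE => /andP[/negPf->].
Qed.

Lemma unionR Y Z : Y \subset K -> Z \subset R -> (Y :|: Z) :\: K = Z.
Proof.
move=> YK ZR; apply/setP => z; rewrite !inE.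
case: (boolP (z \in Z)) => [/(subsetP ZR)|_] /=; first by rewrite inE orbT => /andP[->].
by rewrite orbF; case: (boolP (z \in Y)); rewrite ?andbF // => /(subsetP YK)->.
Qed.

Lemma rank_union Y Z : Y \subset K -> Z \subset R -> rk (Y :|: Z) = (rk Y + rk Z)%N.
Proof.
move=> YK ZR; rewrite (rank_split matI loopI bldG hX _ hK) ?unionK ?unionR //.
by rewrite subUset (subset_trans YK split_sub) (subset_trans ZR (subsetDl _ _)).
Qed.

Definition lowS S := [set G in S | G \subset K].
Definition highS S := [set G in S | ~~ (G \subset K)].

Lemma low_high S : S = lowS S :|: highS S.
Proof. by apply/setP => G; rewrite !inE; case: (G \in S); case: (G \subset K). Qed.

Lemma sub_disj G : G \in Gs -> G \subset X -> (G \subset R) = ~~ (G \subset K).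
Proof.
move=> hG GX; have := building_comps matI loopI bldG hX hK hG GX.
have /set0Pn[e eG] := building_neq0 bldG hG.
rewrite /R subsetD GX /=; case: (boolP (G \subset K)) => //= s _.
by apply/negP => /pred0P/(_ e); rewrite /= eG (subsetP s).
Qed.

Lemma cover_low S : cover (lowS S) \subset K.
Proof. by apply/bigcupsP => G; rewrite inE => /andP[]. Qed.

Lemma cover_high S : S \subset Gs -> cover S \subset X -> cover (highS S) \subset R.
Proof.
move=> hS sX; apply/bigcupsP => G; rewrite inE => /andP[GS nG].
rewrite sub_disj ?(subsetP hS) //; apply: subset_trans sX; exact: (bigcup_sup G).
Qed.

Lemma cover_low_high S : cover S = cover (lowS S) :|: cover (highS S).
Proof. by rewrite {1}(low_high S) /cover bigcup_setU. Qed.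

(** The join of a violating antichain would be in the building set and inside X, hence inside K or
    inside R, so the whole antichain would come from S or from T. *)
Lemma nested_union S T : nestedb S -> nestedb T -> cover S \subset K -> cover T \subset R ->
  nestedb (S :|: T).
Proof.
move=> hS hT sK tR; have sSG : S \subset Gs by case/andP: hS.
have tTG : T \subset Gs by case/andP: hT.
rewrite /is_nested subUset sSG tTG; apply/forallP => U; apply/implyP => /and3P[hU aU cU].
apply/negP => hJ; set J := cl _ in hJ.
have UX : cover U \subset X.
  apply/bigcupsP => G /(subsetP hU); rewrite inE => /orP[h|h].
    by apply: subset_trans split_sub; apply: subset_trans sK; apply: (bigcup_sup G).
  apply: subset_trans (subsetDl X K); apply: subset_trans tR; exact: (bigcup_sup G).
have JX : J \subset X by apply: cl_sub.
have GJ G : G \in U -> G \subset J.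
  by move=> hG; apply: subset_trans (sub_cl _ _); apply: (bigcup_sup G).
have nem G : G \in U -> exists e, e \in G.
  move=> hG; apply/set0Pn/(building_neq0 bldG).
  by move: (subsetP hU _ hG); rewrite inE => /orP[/(subsetP sSG)|/(subsetP tTG)].
case: (boolP (J \subset K)) => JK.
  case/andP: hS => _ /forallP/(_ U)/implyP h.
  suff US : U \subset S by move: h; rewrite US aU cU hJ => /(_ isT).
  apply/subsetP => G hG; have := subsetP hU _ hG; rewrite inE => /orP[//|hGT].
  have [e eG] := nem G hG; have : e \in R by apply: (subsetP tR); apply/bigcupP; exists G.
  by rewrite inE (subsetP (subset_trans (GJ G hG) JK)).
have JR : J \subset R by rewrite sub_disj.
case/andP: hT => _ /forallP/(_ U)/implyP h.
suff UT : U \subset T by move: h; rewrite UT aU cU hJ => /(_ isT).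
apply/subsetP => G hG; have := subsetP hU _ hG; rewrite inE => /orP[hGS|//].
have [e eG] := nem G hG; have eK : e \in K by apply: (subsetP sK); apply/bigcupP; exists G.
by have := subsetP (subset_trans (GJ G hG) JR) e eG; rewrite inE eK.
Qed.

Lemma union_low S T : nestedb S -> nestedb T -> cover S \subset K -> cover T \subset R ->
  lowS (S :|: T) = S /\ highS (S :|: T) = T.
Proof.
move=> hS hT sK tR.
have inS G : G \in S -> G \subset K by move=> h; apply: subset_trans sK; apply: (bigcup_sup G).
have inT G : G \in T -> ~~ (G \subset K).
  move=> h; have GR : G \subset R by apply: subset_trans tR; apply: (bigcup_sup G).
  rewrite -sub_disj ?(nested_building hT h) //; exact: subset_trans GR (subsetDl _ _).
split; apply/setP => G; rewrite !inE.
  case: (boolP (G \in S)) => [/inS->//|_] /=.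
  by case: (boolP (G \in T)) => // /inT/negPf.
case: (boolP (G \in T)) => [/inT->|_]; rewrite ?orbT ?orbF //.
by case: (boolP (G \in S)) => // /inS->.
Qed.

Lemma wgt_split S : nestedb S -> cover S \subset X -> wgt S = wgt (lowS S) * wgt (highS S).
Proof.
move=> hS sX; have sSG : S \subset Gs by case/andP: hS.
rewrite /wgt [LHS](bigID (fun G => G \subset K)) /=; congr (_ * _).
  rewrite (eq_bigl (fun G => G \in lowS S)); last by move=> G; rewrite inE.
  apply: eq_bigr => G; rewrite inE => /andP[GS GK]; congr (up (_ - rk (cover _)))%N.
  apply/setP => H; rewrite !inE; case: (boolP (H \proper G)); rewrite ?andbF //= !andbT.
  by move/proper_sub/subset_trans => ->; rewrite ?andbT.
rewrite (eq_bigl (fun G => G \in highS S)); last by move=> G; rewrite inE.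
apply: eq_bigr => G; rewrite inE => /andP[GS GK]; congr (up (_ - rk (cover _)))%N.
apply/setP => H; rewrite !inE; case: (boolP (H \proper G)); rewrite ?andbF //= !andbT.
move/proper_sub => HG; case: (boolP (H \in S)) => //= HS.
have GX : G \subset X by apply: subset_trans sX; apply: (bigcup_sup G).
rewrite -sub_disj ?(subsetP sSG) ?(subset_trans HG) //.
by rewrite sub_disj ?(subsetP sSG).
Qed.

(** S corresponds to the pair of its parts inside K and inside R; the predicates let one bijection
    serve both [hpart_split] and [av_split]. *)
Lemma nested_sum_split (Q1 Q2 : pred {set {set E}}) :
  \sum_(S | [&& nestedb S, cover S \subset X, Q1 (lowS S) & Q2 (highS S)]) wgt S =
  (\sum_(S | [&& nestedb S, cover S \subset K & Q1 S]) wgt S) *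
  (\sum_(S | [&& nestedb S, cover S \subset R & Q2 S]) wgt S).
Proof.
rewrite big_distrlr /= pair_big /=.
rewrite [RHS](reindex_onto (fun S => (lowS S, highS S)) (fun p => p.1 :|: p.2)) /=; last first.
  move=> [S T] /= /andP[/and3P[h1 h2 _] /and3P[h3 h4 _]].
  by have [-> ->] := union_low h1 h3 h2 h4.
apply: eq_big => [S|S /and4P[h1 h2 _ _]]; last exact: wgt_split.
rewrite -low_high eqxx andbT cover_low.
apply/and4P/andP => [[h1 h2 h3 h4]|[/and3P[h1 _ h3] /and3P[h4 h5 h6]]].
  rewrite h3 h4 !andbT cover_high //; last by case/andP: h1.
  rewrite andbT; split; apply: nested_sub h1 _; apply/subsetP => G; by rewrite inE => /andP[].
split=> //; first by rewrite (low_high S); apply: nested_union => //; apply: cover_low.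
rewrite cover_low_high subUset (subset_trans (cover_low S) split_sub).
exact: subset_trans h5 (subsetDl _ _).
Qed.

Lemma hpart_split : hpart X = hpart K * hpart R.
Proof.
have := nested_sum_split xpredT xpredT.
rewrite (eq_bigl (fun S => nestedb S && (cover S \subset X))); last by move=> S; rewrite !andbT.
rewrite -/(hpart X) => ->; congr (_ * _); apply: eq_bigl => S; by rewrite andbT.
Qed.

Lemma av_split Y Z : Y \subset K -> Z \subset R -> flat Y -> flat Z ->
  av (Y :|: Z) = av Y * av Z.
Proof.
move=> YK ZR hY hZ.
have := nested_sum_split (fun S => cl (cover S) == Y) (fun S => cl (cover S) == Z).
rewrite /av => h; rewrite [LHS](eq_bigl (fun S => [&& nestedb S, cover S \subset X,
  cl (cover (lowS S)) == Y & cl (cover (highS S)) == Z])); last first.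
  move=> S; case: (boolP (nestedb S)) => //= hS; apply/eqP/and3P => [e|[h1 /eqP e1 /eqP e2]].
    have sX : cover S \subset X.
      apply: subset_trans (sub_cl I _) _; rewrite e subUset (subset_trans YK split_sub).
      exact: subset_trans ZR (subsetDl _ _).
    have cL := cover_low S; have cH : cover (highS S) \subset R.
      by apply: cover_high => //; case/andP: hS.
    have eS : cl (cover (lowS S)) :|: cl (cover (highS S)) = Y :|: Z.
      by rewrite -cl_split // -cover_low_high.
    have cL' := cl_sub matI flat_comp cL; have cH' := cl_sub matI flat_compC cH.
    split=> //; apply/eqP.
      by rewrite -(unionK cL' cH') eS unionK.
    by rewrite -(unionR cL' cH') eS unionR.
  rewrite cover_low_high cl_split ?e1 ?e2 //; first exact: cover_low.
  by apply: cover_high => //; case/andP: hS.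
rewrite h; congr (_ * _); apply: eq_bigl => S; congr (_ && _); apply: andb_idl => /eqP e.
  by apply: subset_trans YK; rewrite -e sub_cl.
by apply: subset_trans ZR; rewrite -e sub_cl.
Qed.

End Split.

Lemma belowset_top G S : (forall H, H \in S -> H \proper G) -> belowset (G |: S) G = S.
Proof.
move=> h; apply/setP => H; rewrite !inE; case: eqP => [->|_] /=.
  by rewrite properxx; apply/esym/negP => /h; rewrite properxx.
by apply: andb_idr => /h.
Qed.

Lemma nested_add G S : G \in Gs -> nestedb S -> (forall H, H \in S -> H \proper G) ->
  nestedb (G |: S).
Proof.
move=> hG hS hp; have sSG : S \subset Gs by case/andP: hS.
rewrite /is_nested subUset sub1set hG sSG; apply/forallP => T.
apply/implyP => /and3P[hT aT cT].
case/andP: hS => _ /forallP/(_ T)/implyP h.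
suff TS : T \subset S by apply: h; rewrite TS aT.
apply/subsetP => H hH; have := subsetP hT _ hH; rewrite inE in_set1 => /orP[/eqP HG|//].
have : (1 < #|T|)%N by []; rewrite (cardsD1 G) -HG hH add1n ltnS => /card_gt0P[K].
rewrite !inE => /andP[KH KT]; have := subsetP hT _ KT; rewrite inE in_set1.
rewrite -HG (negPf KH) /= => /hp/proper_sub KG.
move/antichainP: aT => /(_ K H KT hH); rewrite -HG in KG => /(_ KG) e.
by rewrite e eqxx in KH.
Qed.

Lemma wgt_add G S : (forall H, H \in S -> H \proper G) ->
  wgt (G |: S) = up (rk G - rk (cover S)) * wgt S.
Proof.
move=> hp; have nG : G \notin S by apply/negP => /hp; rewrite properxx.
rewrite /wgt big_setU1 //=; congr (_ * _).
  by rewrite /rank_drop belowset_top.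
apply: eq_bigr => H hH; congr (up (_ - rk (cover _)))%N.
apply/setP => K; rewrite !inE; case: eqP => //= ->.
have := proper_sub (hp _ hH); rewrite properE => ->; rewrite andbF.
by apply/esym/negbTE; rewrite (negPf nG).
Qed.

Lemma cl_cover_proper G S : G \in Gs -> nestedb S ->
  (cl (cover S) \proper G) = [forall H in S, H \proper G].
Proof.
move=> hG hS; apply/idP/forall_inP => [h H hH|h].
  apply: sub_proper_trans h; apply: subset_trans (sub_cl _ _); exact: (bigcup_sup H).
have s : cl (cover S) \subset G.
  apply: cl_sub => //; first exact: building_flat hG.
  by apply/bigcupsP => H /h/proper_sub.
rewrite properEneq s andbT; apply/eqP => e.
have : G \in comps (cl (cover S)).
  by rewrite e; apply/compsP; split=> // H _ a b; apply/eqP; rewrite eqEsubset a.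
by rewrite comps_nested // => /(subsetP (maxelts_sub S))/h; rewrite properxx.
Qed.

(** If S has join G, then G is a component of the join and so belongs to S. Removing it leaves a
    nested set whose join X is properly below G, and splits off the factor up (rk G - rk X). *)
Lemma av_rec G : G \in Gs ->
  av G = \sum_(X | flat X && (X \proper G)) av X * up (rk G - rk X).
Proof.
move=> hG.
transitivity (\sum_(S | nestedb S && (cl (cover S) \proper G)) wgt S * up (rk G - rk (cover S))).
  rewrite /av (reindex_onto (fun S => G |: S) (fun S => S :\ G)) /=; last first.
    move=> S /andP[hS /eqP e]; apply: setD1K.
    have : G \in comps (cl (cover S)).
      by rewrite e; apply/compsP; split=> // H _ a b; apply/eqP; rewrite eqEsubset a.
    by rewrite comps_nested // => /(subsetP (maxelts_sub S)).
  apply: eq_big => [S|S /andP[/andP[h1 /eqP h2] /eqP h3]]; last first.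
    rewrite wgt_add 1?mulrC // => H hH.
    have HS : H \in (G |: S) :\ G by rewrite h3.
    move: HS; rewrite !inE => /andP[HG _]; rewrite properEneq HG /= -h2.
    apply: subset_trans (sub_cl _ _); apply: (bigcup_sup H); by rewrite inE hH orbT.
  apply/andP/andP => [[/andP[h1 /eqP h2] /eqP h3]|[h1 h2]].
    have hS : nestedb S by apply: nested_sub h1 _; apply: subsetUr.
    split=> //; rewrite cl_cover_proper //; apply/forall_inP => H hH.
    have HS : H \in (G |: S) :\ G by rewrite h3.
    move: HS; rewrite !inE => /andP[HG _]; rewrite properEneq HG /= -h2.
    apply: subset_trans (sub_cl _ _); apply: (bigcup_sup H); by rewrite inE hH orbT.
  have /forall_inP hp : [forall H in S, H \proper G] by rewrite -cl_cover_proper.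
  rewrite nested_add //; split; last first.
    by rewrite setU1K //; apply/negP => /hp; rewrite properxx.
  have -> : cover (G |: S) = G.
    by rewrite /cover bigcup_setU big_set1; apply/setUidPl/bigcupsP => H /hp/proper_sub.
  exact: building_flat hG.
rewrite (partition_big (fun S => cl (cover S)) (fun X => flat X && (X \proper G))) /=; last first.
  by move=> S /andP[_ ->]; rewrite flat_cl.
apply: eq_bigr => X /andP[hX pX]; rewrite /av mulr_suml; apply: eq_big => S.
  by rewrite -andbA; congr (_ && _); apply: andb_idl => /eqP->.
by move=> /andP[_ /eqP <-]; rewrite rank_cl.
Qed.

Lemma hpart_av X : flat X -> hpart X = \sum_(Y | flat Y && (Y \subset X)) av Y.
Proof.
move=> hX; rewrite /hpart.
rewrite (partition_big (fun S => cl (cover S)) (fun Y => flat Y && (Y \subset X))) /=; last first.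
  by move=> S /andP[_ h]; rewrite flat_cl // cl_sub.
apply: eq_bigr => Y /andP[hY sY]; rewrite /av; apply: eq_bigl => S.
rewrite -andbA; congr (_ && _); apply: andb_idl => /eqP h.
by apply: subset_trans sY; rewrite -h sub_cl.
Qed.

End NestedSums.

(** * Lexicographic chains *)

Lemma nat_ivt (f : nat -> nat) r k : (f 0 <= r)%N -> (r <= f k)%N ->
  (forall t, f t.+1 <= (f t).+1)%N -> exists2 t, (t <= k)%N & f t = r.
Proof.
move=> h0 hk hs; elim: k hk => [|k IH] hk; first by exists 0%N => //; lia.
case: (leqP r (f k)) => h; first by have [t ht e] := IH h; exists t => //; apply: leqW.
by exists k.+1 => //; have := hs k; lia.
Qed.

Section LexChains.
Variables (E : finType) (I Gs : {set {set E}}).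
Hypotheses (matI : is_matroid I) (loopI : loopless I).
Hypothesis bldG : is_building_set I Gs.
Variable s : seq E.
Hypotheses (us : uniq s) (alls : forall e, e \in s).
Notation rk := (mrank I).
Notation cl := (mcl I).
Notation comps := (maxbelow Gs).
Notation flat := (mflat I).
Notation av := (nested_sum I Gs).
Implicit Types (A B C D F G H K R X Y Z : {set E}).

Definition firsts t : {set E} := [set e in take t s].

Lemma mem_firsts e t : (e \in firsts t) = (index e s < t)%N.
Proof. by rewrite inE in_take. Qed.

Lemma firsts0 : firsts 0 = set0.
Proof. by apply/setP => e; rewrite mem_firsts inE. Qed.

Lemma firsts_all : firsts (size s) = setT.
Proof. by apply/setP => e; rewrite mem_firsts inE index_mem alls. Qed.

Lemma firstsS t t' : (t <= t')%N -> firsts t \subset firsts t'.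
Proof. by move=> h; apply/subsetP => e; rewrite !mem_firsts => /leq_trans; apply. Qed.

(** A member of the chain from X to G, reached after the first t elements of E. Positions are
    counted in E, not in G \ X as in [chainC], so that one threshold makes sense for different pairs
    of flats; the chain then has repetitions. *)
Definition cch t X G := cl (X :|: (G :&: firsts t)).

Lemma flat_cch t X G : flat (cch t X G).
Proof. exact: flat_cl. Qed.

Lemma sub_cch t X G : X \subset cch t X G.
Proof. by apply: subset_trans (sub_cl _ _); apply: subsetUl. Qed.

Lemma cch_sub t X G : flat G -> X \subset G -> cch t X G \subset G.
Proof. by move=> hG s1; apply: cl_sub => //; rewrite subUset s1 subsetIl. Qed.

Lemma cchS t t' X G : (t <= t')%N -> cch t X G \subset cch t' X G.
Proof. by move=> h; apply: clS => //; apply: setUS; apply: setIS; apply: firstsS. Qed.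

Lemma cch0 X G : flat X -> cch 0 X G = X.
Proof. by move=> /eqP hX; rewrite /cch firsts0 setI0 setU0. Qed.

Lemma cch_max X G : flat G -> X \subset G -> cch (size s) X G = G.
Proof. by move=> /eqP hG s1; rewrite /cch firsts_all setIT (setUidPr s1). Qed.

Lemma rank_cch t X G : (rk (cch t.+1 X G) <= (rk (cch t X G)).+1)%N.
Proof.
rewrite !rank_cl //; case: (leqP (size s) t) => ht.
  apply: leqW; apply: rankS => //; apply: setUS; apply: setIS; apply/subsetP => e _.
  by rewrite mem_firsts; apply: leq_trans ht; rewrite index_mem.
have [x0 _] : exists x0 : E, true by case: (s) ht => [//|x0 l] _; exists x0.
apply: leq_trans (rankU1 matI (nth x0 s t) _); apply: rankS => //.
apply/subsetP => e; rewrite !in_setU !in_setI in_set1 !mem_firsts ltnS leq_eqVlt.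
case/orP => [->|/andP[eG /orP[/eqP <-|h]]]; rewrite ?orbT //.
  by rewrite nth_index ?eqxx.
by rewrite eG h !orbT.
Qed.

(* The position of the least element of G \ F, and [size s] if G is contained in F. *)
Definition mth F G := find (fun e => e \in G :\: F) s.

Lemma mth_sub F G : G :&: firsts (mth F G) \subset F.
Proof.
apply/subsetP => e /setIP[eG]; rewrite mem_firsts => h; apply: contraT => eF.
by have := before_find e h; rewrite nth_index // inE eF eG.
Qed.

Lemma mth_max F G t : F \proper G -> G :&: firsts t \subset F -> (t <= mth F G)%N.
Proof.
move=> /properP[_ [e0 e0G e0F]] h; rewrite leqNgt; apply/negP => lt.
have ha : has (fun e => e \in G :\: F) s by apply/hasP; exists e0; rewrite // inE e0G e0F.
have := nth_find e0 ha; set e := nth _ _ _; rewrite inE => /andP[eF eG].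
case/negP: eF; apply: (subsetP h); rewrite inE eG mem_firsts /e index_uniq //.
by rewrite -has_find.
Qed.

Lemma mth_cap F G : F \proper G -> G :&: firsts (mth F G) = F :&: firsts (mth F G).
Proof.
move=> /proper_sub FG; apply/eqP; rewrite eqEsubset subsetI mth_sub subsetIr.
by rewrite setSI.
Qed.

(* F lies on the lexicographic chain from F' to G. *)
Definition link G F' F := cch (mth F G) F' F == F.

(** Up to threshold [mth F G] the elements of G read so far lie in F, so the chains to G and to F
    agree; afterwards the chain to G has left F. Defining [link] by the chain to F keeps
    computations inside F, where components are available. *)
Lemma linkP G F' F : flat F -> F' \subset F -> F \proper G ->
  reflect (exists t, cch t F' G = F) (link G F' F).
Proof.
move=> hF sF pF; apply: (iffP eqP) => [h|[t h]].
  by exists (mth F G); rewrite /cch mth_cap.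
have le : (t <= mth F G)%N.
  apply: mth_max => //; rewrite -h; apply: subset_trans (sub_cl _ _); exact: subsetUr.
apply/eqP; rewrite eqEsubset cch_sub //= /cch -mth_cap // -/(cch _ _ _).
by rewrite -{1}h cchS.
Qed.

(** The chain from F' has reached F by threshold [mth F G] and then continues as the chain from F;
    the chain from F reaches G only after that threshold. *)
Lemma link_thr G F' F m : flat F -> flat G -> F' \subset F -> F \proper G -> link G F' F ->
  (cch m F G == G) = (cch m F' G == G).
Proof.
move=> hF hG sF pF lk; have FG := proper_sub pF.
have F'G := subset_trans sF FG.
rewrite !eqEsubset !cch_sub //=; apply/idP/idP => h; last first.
  by apply: subset_trans h _; apply: clS => //; apply: setSU.
have hm : (mth F G < m)%N.
  rewrite ltnNge; apply/negP => le.
  have : G :&: firsts m \subset F by apply: subset_trans (mth_sub F G); apply: setIS; apply: firstsS.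
  move=> /setUidPl e; move: h; rewrite /cch e (eqP hF) => GF.
  by move: pF; rewrite properE GF andbF.
apply: subset_trans h _; apply: cl_sub => //; first exact: flat_cch.
rewrite subUset; apply/andP; split; last first.
  by apply: subset_trans (sub_cl _ _); apply: subsetUr.
move/eqP: lk => <-; rewrite /cch -mth_cap // -/(cch _ _ _); apply: cchS; exact: ltnW.
Qed.

(** The chain has exactly one flat of each intermediate rank: one more element raises the rank by at
    most 1, and flats of equal rank on a chain are equal. *)
Lemma link_sum G F' (f : nat -> {poly rat}) : flat F' -> flat G -> F' \proper G ->
  \sum_(F | [&& flat F, F' \proper F, F \proper G & link G F' F]) f (rk F - rk F')%N =
  \sum_(1 <= j < rk G - rk F') f j.
Proof.
move=> hF' hG pF; have sF := proper_sub pF.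
have rkG := flat_rank_lt matI hF' pF.
rewrite big_add1 big_mkord.
set d := (_ - _).-1.
pose P F := [&& flat F, F' \proper F, F \proper G & link G F' F].
have exF (j : 'I_d) : exists F, P F && (rk F == rk F' + j.+1)%N.
  have [|||t _ ht] := @nat_ivt (fun t => rk (cch t F' G)) (rk F' + j.+1)%N (size s).
  - by rewrite cch0 // leq_addr.
  - by rewrite cch_max //; have := ltn_ord j; rewrite /d; move: rkG; lia.
  - by move=> t; apply: rank_cch.
  exists (cch t F' G); rewrite ht eqxx andbT /P flat_cch.
  have p1 : F' \proper cch t F' G.
    rewrite properEneq sub_cch andbT; apply/eqP => e; move: ht; rewrite -e.
    by rewrite addnS => /esym/eqP; rewrite -addnS -[X in _ == X]addn0 eqn_add2l.
  have p2 : cch t F' G \proper G.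
    rewrite properEneq cch_sub // andbT; apply/eqP => e; move: ht; rewrite e.
    by have := ltn_ord j; rewrite /d; move: rkG; lia.
  rewrite p1 p2; apply/linkP => //; [exact: flat_cch|exact: proper_sub|by exists t].
pose h (j : 'I_d) := xchoose (exF j).
have hP j : P (h j) by have /andP[] := xchooseP (exF j).
have hr j : rk (h j) = (rk F' + j.+1)%N by have /andP[_ /eqP] := xchooseP (exF j).
have uniqF F1 F2 : P F1 -> P F2 -> rk F1 = rk F2 -> F1 = F2.
  move=> /and4P[f1 p1 q1 /(linkP f1 (proper_sub p1) q1)[t1 e1]].
  move=> /and4P[f2 p2 q2 /(linkP f2 (proper_sub p2) q2)[t2 e2]] er.
  case/orP: (leq_total t1 t2) => le.
    by apply: (flat_rank_eq matI f1); rewrite -?e1 -?e2 ?cchS // e1 e2 er.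
  by apply/esym; apply: (flat_rank_eq matI f2); rewrite -?e1 -?e2 ?cchS // e1 e2 er.
rewrite (eq_bigl P) //.
case: (posnP d) => [d0|dpos].
  rewrite d0 big_ord0 big1 // => F /and4P[f1 p1 q1 _].
  have := flat_rank_lt matI hF' p1; have := flat_rank_lt matI f1 q1.
  by move: d0; rewrite /d; lia.
rewrite (reindex_onto h (fun F => insubd (Ordinal dpos) (rk F - rk F').-1)); last first.
  move=> F hF; apply: uniqF => //; rewrite hr.
  have /and4P[f1 p1 q1 _] := hF.
  have := flat_rank_lt matI hF' p1; have := flat_rank_lt matI f1 q1.
  by rewrite val_insubd; case: ifP; rewrite /d; lia.
apply: eq_big => [j|j _]; last by rewrite hr addKn.
rewrite hP hr addKn /=; apply/eqP/val_inj; rewrite val_insubd ltn_ord //.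
Qed.

(** The recursion [av_rec] restricted to the flats whose chain to G is still incomplete at threshold
    m. For m = 0 and G in the building set it is all of [av G]. *)
Definition pm G m : {poly rat} :=
  \sum_(F | [&& flat F, F \proper G & cch m F G != G]) av F * up (rk G - rk F).

(* What remains of [av F] when the chains that pass through F on their way to G
   are left out. *)
Definition dg G F : {poly rat} :=
  av F - \sum_(F' | [&& flat F', F' \proper F & link G F' F]) av F' * up (rk F - rk F').

(** Expand [dg] and exchange the sums. For fixed F', the F linked to it have one rank each, so their
    terms form the convolution in the recursion for V, and what is left is v. The condition at m
    passes between F and F' by [link_thr]. Used for (up, tp) and (1 + up, vp). *)
Lemma dg_sum (v V : nat -> {poly rat}) G m : flat G ->
  (forall d, (0 < d)%N -> V d = v d + \sum_(1 <= j < d) up j * V (d - j)%N) ->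
  \sum_(F | [&& flat F, F \proper G & cch m F G != G]) av F * v (rk G - rk F)%N =
  \sum_(F | [&& flat F, F \proper G & cch m F G != G]) dg G F * V (rk G - rk F)%N.
Proof.
move=> hG hV.
rewrite [RHS](eq_bigr (fun F => av F * V (rk G - rk F)%N -
    \sum_(F' | [&& flat F', F' \proper F & link G F' F])
      av F' * up (rk F - rk F') * V (rk G - rk F)%N)); last first.
  by move=> F _; rewrite /dg mulrBl; congr (_ - _); rewrite mulr_suml.
rewrite sumrB [X in _ - X](exchange_big_dep
  (fun F' => [&& flat F', F' \proper G & cch m F' G != G])) /=; last first.
  move=> F F' /and3P[f1 p1 c1] /and3P[f2 p2 lk]; rewrite f2 (proper_trans p2 p1).
  by rewrite -(link_thr m f1 hG (proper_sub p2) p1 lk).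
rewrite -sumrB; apply: eq_bigr => F' /and3P[f' p' c'].
rewrite (eq_bigl (fun F => [&& flat F, F' \proper F, F \proper G & link G F' F])); last first.
  move=> F; rewrite f' /=; case: (boolP (flat F)) => //= fF.
  case: (boolP (F' \proper F)) => p1; rewrite ?andbF //=; case: (boolP (F \proper G)) => p2 //=.
  case: (boolP (link G F' F)) => lk; rewrite ?andbF // andbT.
  by rewrite (link_thr m fF hG (proper_sub p1) p2 lk).
have rkG := flat_rank_lt matI f' p'.
have lk := link_sum (fun j => up j * V (rk G - rk F' - j)%N) f' hG p'.
rewrite (eq_bigr (fun F => av F' * (up (rk F - rk F') * V (rk G - rk F' - (rk F - rk F'))%N))).
  by rewrite -mulr_sumr lk hV ?subn_gt0 // mulrDr addrK.
move=> F /and4P[f1 p1 p2 _]; rewrite mulrA; congr (_ * _ * V _).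
have := flat_rank_lt matI f' p1; have := flat_rank_lt matI f1 p2; lia.
Qed.

(** * Consequences of completeness *)

Hypothesis hc : forall F G, is_flat I F -> G \in Gs -> F \subset G ->
  chainC I s F G \subset GFG I Gs F G :|: [set F].

(** The form in which completeness is used from here on; [cch t X G] is the member of [chainC] whose
    index is the number of elements of G \ X among the first t. *)
Lemma complete_thr t X G : flat X -> G \in Gs -> X \subset G ->
  cch t X G = X \/ exists2 H, H \in Gs & cch t X G = cl (X :|: H).
Proof.
move=> hX hG XG; have /flatP hX' := hX.
set l := [seq e <- s | e \in G :\: X].
set l1 := [seq e <- take t s | e \in G :\: X].
have lE : l = l1 ++ [seq e <- drop t s | e \in G :\: X].
  by rewrite -filter_cat cat_take_drop.
have l1E : take (size l1) l = l1 by rewrite lE take_size_cat.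
have sz : (size l1 < (size l).+1)%N by rewrite ltnS lE size_cat leq_addr.
have : cch t X G \in chainC I s X G.
  apply/imsetP; exists (Ordinal sz) => //=; rewrite -/l l1E; congr (cl _).
  apply/setP => e; rewrite !inE mem_filter !inE.
  by case: (e \in X); case: (e \in G).
move/(subsetP (hc hX' hG XG)); rewrite !inE => /orP[|/eqP]; last by left.
move=> /andP[/andP[_ /imsetP[H hH e]] _]; right; exists H => //.
Qed.

(** By completeness F = F' v H with H in the building set. H lies in one component K, and elements
    of F outside K are spanned by F' alone. *)
Lemma link_comp G F F' : G \in Gs -> flat F -> F \proper G -> flat F' -> F' \proper F ->
  link G F' F -> exists2 K, K \in comps F & F :\: K \subset F'.
Proof.
move=> hG hF pF hF' pF' lk; have FG := proper_sub pF; have F'F := proper_sub pF'.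
have e : cch (mth F G) F' G = F by rewrite /cch mth_cap //; apply/eqP.
have [h|[H hH h]] := complete_thr (mth F G) hF' hG (subset_trans F'F FG).
  by rewrite -e h properxx in pF'.
have HF : H \subset F by rewrite -e h; apply: subset_trans (sub_cl _ _); apply: subsetUr.
have [K hK HK] := comps_above hH HF; exists K => //; apply/subsetP => x.
rewrite inE => /andP[xK xF].
have sX : F' :|: H \subset F by rewrite subUset F'F.
have := cl_compsC matI loopI bldG hF sX hK xF xK; rewrite -h e => /(_ xF).
rewrite setDUl (_ : H :\: K = set0) ?setU0; last by apply/eqP; rewrite setD_eq0.
move=> hx; rewrite -(eqP hF'); apply: (subsetP (clS matI _)) hx; exact: subsetDl.
Qed.

(** Being linked to F can be tested on each component of F. If K1 and K2 differed, F1 :&: F2 would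
    agree with F1 on K1 and with F2 on the other components, hence be linked as well; but it
    contains neither K1 nor K2, while [link_comp] leaves only one component incomplete. *)
Lemma link_comp_uniq G F F1 F2 K1 K2 : G \in Gs -> flat F -> F \proper G ->
  flat F1 -> flat F2 -> F1 \proper F -> F2 \proper F -> link G F1 F -> link G F2 F ->
  K1 \in comps F -> K2 \in comps F -> F :\: K1 \subset F1 -> F :\: K2 \subset F2 -> K1 = K2.
Proof.
move=> hG hF pF f1 f2 p1 p2 l1 l2 hK1 hK2 s1 s2; apply/eqP; apply: contraT => neK.
have subs K F0 : F0 \proper F -> F :\: K \subset F0 -> ~~ (K \subset F0).
  move=> p0 s0; apply/negP => KF; move: p0; rewrite properE => /andP[_ /negP[]].
  apply/subsetP => x xF; case: (boolP (x \in K)) => xK; first exact: (subsetP KF).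
  by apply: (subsetP s0); rewrite inE xK.
have disj K K' F0 : K \in comps F -> K' \in comps F -> K != K' -> F :\: K \subset F0 ->
    K' \subset F0.
  move=> hK hK' ne s0; apply/subsetP => x xK'; apply: (subsetP s0).
  rewrite inE (subsetP (comps_sub hK')) // andbT; apply: contra ne => xK.
  by apply/eqP; apply: (comps_disjoint matI loopI bldG hF hK hK' xK xK').
pose F3 := F1 :&: F2; have f3 : flat F3 by apply: flatI.
have p3 : F3 \proper F by apply: sub_proper_trans p1; apply: subsetIl.
have aux K F0 : K \in comps F -> F0 \subset F -> link G F0 F -> F0 :&: K \subset F3 ->
    K \subset cch (mth F G) F3 F.
  move=> hK sF0 lk s0; apply/subsetP => x xK.
  have xF : x \in cch (mth F G) F0 F by rewrite (eqP lk) (subsetP (comps_sub hK)).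
  have sX : F0 :|: (F :&: firsts (mth F G)) \subset F by rewrite subUset sF0 subsetIl.
  have := cl_comps matI loopI bldG hF sX hK xK xF; apply: (subsetP (clS matI _)).
  rewrite setIUl; apply: setUSS => //; exact: subsetIl.
have l3 : link G F3 F.
  rewrite /link eqEsubset cch_sub ?(proper_sub p3) //=; apply/subsetP => x xF.
  have [K hK xK] := comps_cover matI loopI bldG hF xF.
  case: (eqVneq K K1) => [eK|n1].
    apply: (subsetP (aux K F1 hK (proper_sub p1) l1 _)) => //; rewrite subsetI subsetIl.
    apply: subset_trans (subsetIr _ _) _; rewrite eK; apply: (disj K2) => //.
    by rewrite eq_sym.
  apply: (subsetP (aux K F2 hK (proper_sub p2) l2 _)) => //; rewrite subsetI subsetIl andbT.
  apply: subset_trans (subsetIr _ _) _; apply: (disj K1) => //; by rewrite eq_sym.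
have [K3 hK3 s3] := link_comp hG hF pF f3 p3 l3.
case: (eqVneq K3 K1) => [eK|n1].
  have := subs K2 F2 p2 s2 => /negP[]; apply: subset_trans (subsetIr F1 F2).
  by apply: (disj K3) => //; rewrite eK.
have := subs K1 F1 p1 s1 => /negP[]; apply: subset_trans (subsetIl F1 F2).
exact: (disj K3).
Qed.

(** The linked F' are the sets Y :|: (F \ K), and the link becomes [cch m Y K == K] with m =
    [mth F G]. Rank differences do not change and [av] is multiplicative, so av (F \ K) factors out
    and [pm K m] is what remains of the recursion for [av K]. *)
Lemma dg_comp G F K : G \in Gs -> flat F -> F \proper G -> K \in comps F ->
  (forall F', flat F' -> F' \proper F -> link G F' F -> F :\: K \subset F') ->
  dg G F = av (F :\: K) * pm K (mth F G).
Proof.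
move=> hG hF pF hK hl; set R := F :\: K; set m := mth F G.
have hKf : flat K := flat_comp bldG hK.
have hR : flat R := flat_compC matI loopI bldG hF hK.
have FE : F = K :|: R := splitX hK.
have RR : R \subset F :\: K by [].
have avF : av F = av K * av R.
  by rewrite {1}FE (av_split matI loopI bldG hF hK).
have avK : av K = pm K m + \sum_(Y | [&& flat Y, Y \proper K & cch m Y K == K])
    av Y * up (rk K - rk Y).
  rewrite (av_rec matI loopI bldG (comps_building hK)).
  rewrite (bigID (fun Y => cch m Y K != K)) /=; congr (_ + _); apply: eq_bigl => Y.
    by rewrite andbA.
  by rewrite negbK andbA.
rewrite /dg avF avK mulrDl mulrC -addrA; apply/eqP; rewrite -subr_eq0 addrAC subrr add0r subr_eq0.
apply/eqP; rewrite mulr_suml.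
rewrite [RHS](reindex_onto (fun Y => Y :|: R) (fun F' => F' :&: K)) /=; last first.
  move=> F' /and3P[f' p' l']; have s' := hl F' f' p' l'.
  apply/setP => x; rewrite !inE; case: (boolP (x \in K)) => xK /=; rewrite ?andbT ?andbF ?orbF //=.
  apply/idP/idP => [xF|/(subsetP (proper_sub p'))//].
  by apply: (subsetP s'); rewrite inE xK.
apply: eq_big => [Y|Y /and3P[fY pY _]]; last first.
  have YK := proper_sub pY.
  rewrite (av_split matI loopI bldG hF hK) // FE !(rank_union matI loopI bldG hF hK) //.
  by rewrite subnDr mulrAC.
apply/and3P/andP => [[fY pY /eqP cY]|[/and3P[f' p' l'] /eqP e]].
  have YK := proper_sub pY; rewrite (unionK YK RR) eqxx; split=> //.
  rewrite (flat_union matI loopI bldG hF hK) //=; apply/andP; split.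
    rewrite properE subUset (subset_trans YK (comps_sub hK)) subsetDl /=.
    apply: contraTN pY => FY; rewrite properE negb_and negbK; apply/orP; right.
    apply/subsetP => x xK; have := subsetP FY x (subsetP (comps_sub hK) x xK).
    by rewrite !inE xK orbF.
  rewrite /link eqEsubset cch_sub //=; last first.
    by rewrite subUset (subset_trans YK (comps_sub hK)) subsetDl.
  rewrite {1}FE subUset -{1}cY; apply/andP; split; last first.
    apply: subset_trans (sub_cch _ _ _); exact: subsetUr.
  apply: clS => //; apply: setUSS; first exact: subsetUl.
  by apply: setSI; exact: comps_sub hK.
have YK : Y \subset K by rewrite -e subsetIr.
have fY : flat Y by rewrite -e; apply: flatI.
split=> //.
  rewrite properEneq YK andbT; apply: contraTneq p' => ->; by rewrite -FE properxx.
rewrite eqEsubset cch_sub //=; apply/subsetP => x xK.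
have sX : Y :|: R :|: (F :&: firsts m) \subset F.
  by rewrite !subUset (subset_trans YK (comps_sub hK)) subsetDl subsetIl.
have xF : x \in cch m (Y :|: R) F by rewrite (eqP l') (subsetP (comps_sub hK)).
have := cl_comps matI loopI bldG hF sX hK xK xF; apply: (subsetP (clS matI _)).
apply/subsetP => z; rewrite !inE; case: (z \in K); rewrite ?andbF //= !andbT orbF.
by case: (z \in Y) => //= /andP[].
Qed.

(** [av X] is the product of the [av K = pm K 0] over the components, and the ranks add up. *)
Lemma gpos_av_of r : (forall G m, G \in Gs -> (rk G < r)%N -> gpos (rk G) (pm G m)) ->
  forall X, flat X -> (rk X < r)%N -> gpos (rk X) (av X).
Proof.
move=> hr X; move: {2}#|X| (leqnn #|X|) => k; elim: k X => [|k IH] X.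
  rewrite leqn0 cards_eq0 => /eqP-> _ _; rewrite av0 // rank0 //; exact: gpos1.
move=> hk hX rX; case: (set_0Vmem X) => [->|[e eX]].
  by rewrite av0 // rank0 //; exact: gpos1.
have [K hK eK] := comps_cover matI loopI bldG hX eX.
have hKG := comps_building hK; have KXs := comps_sub hK.
have rKX : (rk K <= rk X)%N by apply: rankS.
have gK : gpos (rk K) (av K).
  rewrite (av_rec matI loopI bldG hKG) (_ : \sum_(_ | _) _ = pm K 0).
    by apply: hr => //; apply: leq_ltn_trans rX.
  apply: eq_bigl => Y; case: (boolP (flat Y)) => //= fY; rewrite cch0 //.
  by apply/esym/andb_idr => /properP[_ [z zK zY]]; apply: contraNneq zY => ->.
have hR : flat (X :\: K) := flat_compC matI loopI bldG hX hK.
rewrite (splitX hK) (av_split matI loopI bldG hX hK) ?(flat_comp bldG hK) //.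
rewrite (rank_union matI loopI bldG hX hK) //; apply: gposM => //; apply: IH => //.
  rewrite -ltnS; apply: leq_trans hk; apply: proper_card.
  rewrite properE subsetDl; apply/subsetPn; exists e => //; by rewrite inE eK.
by apply: leq_ltn_trans rX; apply: rankS => //; apply: subsetDl.
Qed.

Lemma gpos_dg G F : G \in Gs ->
  (forall H m, H \in Gs -> (rk H < rk G)%N -> gpos (rk H) (pm H m)) ->
  flat F -> F \proper G -> gpos (rk F) (dg G F).
Proof.
move=> hG hr hF pF; have rF := flat_rank_lt matI hF pF.
have hav := gpos_av_of hr.
case: (pickP (fun F' => [&& flat F', F' \proper F & link G F' F])) => [F0|h0]; last first.
  by rewrite /dg big_pred0 // subr0; apply: hav.
move=> /and3P[f0 p0 l0]; have [K hK s0] := link_comp hG hF pF f0 p0 l0.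
rewrite (dg_comp hG hF pF hK); last first.
  move=> F' f' p' l'; have [K' hK' s'] := link_comp hG hF pF f' p' l'.
  by rewrite (link_comp_uniq hG hF pF f0 f' p0 p' l0 l' hK hK' s0 s').
have hR : flat (F :\: K) := flat_compC matI loopI bldG hF hK.
have -> : rk F = (rk (F :\: K) + rk K)%N.
  by rewrite {1}(splitX hK) (rank_union matI loopI bldG hF hK) // addnC.
apply: gposM.
  by apply: hav => //; apply: leq_ltn_trans rF; apply: rankS => //; apply: subsetDl.
apply: hr; first exact: comps_building hK.
by apply: leq_ltn_trans rF; apply: rankS => //; exact: comps_sub hK.
Qed.

Lemma gpos_pm G m : G \in Gs -> gpos (rk G) (pm G m).
Proof.
move: {2}(rk G) (leqnn (rk G)) => r; elim/ltn_ind: r G m => r IH G m hr hG.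
have IH' H m' : H \in Gs -> (rk H < rk G)%N -> gpos (rk H) (pm H m').
  by move=> hH lt; apply: (IH (rk H)) => //; apply: leq_trans lt _.
rewrite /pm (dg_sum m (building_flat bldG hG) tp_rec); apply: gpos_sum => F /and3P[fF pF _].
have -> : rk G = (rk F + (rk G - rk F))%N by rewrite subnKC // rankS // proper_sub.
by rewrite addKn; apply: gposM; [apply: gpos_dg|apply: gpos_tp].
Qed.

(** Adding the A(F) with F < G to the recursion for A(G) changes the weights up d into 1 + up d,
    which regroup to (1 + t)^(d - 1); hence the degree rk G - 1 in place of rk G. *)
Lemma gpos_hpart_building G : G \in Gs -> gpos (rk G).-1 (hpart I Gs G).
Proof.
move=> hG; have fG := building_flat bldG hG.
rewrite hpart_av // (bigD1 G) /= ?fG ?subxx // (av_rec matI loopI bldG hG).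
rewrite [X in _ + X](eq_bigl (fun F => flat F && (F \proper G))); last first.
  by move=> F; rewrite properEneq -andbA; congr (_ && _); rewrite andbC.
rewrite -big_split /= (eq_bigr (fun F => av F * (1 + up (rk G - rk F)))); last first.
  by move=> F _; rewrite mulrDr mulr1 addrC.
rewrite (eq_bigl (fun F => [&& flat F, F \proper G & cch 0 F G != G])); last first.
  move=> F; case: (boolP (flat F)) => //= fF; rewrite cch0 //.
  by apply/esym/andb_idr => /properP[_ [z zK zY]]; apply: contraNneq zY => ->.
rewrite (dg_sum (v := fun d => 1 + up d) 0 fG vp_rec); apply: gpos_sum => F /and3P[fF pF _].
have rF := flat_rank_lt matI fF pF.
have -> : (rk G).-1 = (rk F + (rk G - rk F).-1)%N by lia.
apply: gposM; last exact: gposX1.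
by apply: gpos_dg => // H m hH _; apply: gpos_pm.
Qed.

Lemma gpos_hpart X : flat X -> exists d, gpos d (hpart I Gs X).
Proof.
move: {2}#|X| (leqnn #|X|) => k; elim: k X => [|k IH] X.
  by rewrite leqn0 cards_eq0 => /eqP-> _; rewrite hpart0 //; exists 0%N; exact: gpos1.
move=> hk hX; case: (set_0Vmem X) => [->|[e eX]].
  by rewrite hpart0 //; exists 0%N; exact: gpos1.
have [K hK eK] := comps_cover matI loopI bldG hX eX.
have hR : flat (X :\: K) := flat_compC matI loopI bldG hX hK.
have [|d hd] := IH _ _ hR.
  rewrite -ltnS; apply: leq_trans hk; apply: proper_card.
  rewrite properE subsetDl; apply/subsetPn; exists e => //; by rewrite inE eK.
exists ((rk K).-1 + d)%N; rewrite (hpart_split matI loopI bldG hX hK); apply: gposM => //.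
exact: gpos_hpart_building (comps_building hK).
Qed.

End LexChains.

(** * Counting standard monomials *)

Section StandardCount.
Variables (E : finType) (I Gs : {set {set E}}).
Hypotheses (matI : is_matroid I) (loopI : loopless I).
Hypothesis bldG : is_building_set I Gs.
Notation rk := (mrank I).
Notation n := #|Gs|.
Notation nestedb := (is_nested I Gs).
Notation rkdrop := (rank_drop I).
Notation standard := (standard_mnm I (Gs:=Gs)).
Implicit Types (G X : {set E}) (S : {set {set E}}).
Variable i : nat.
(** A bound above every rank drop and above the degree i, so that exponent vectors become finite
    functions without loss. *)
Notation B := (#|E| + i).+1.

Definition okexp S (j : 'I_n) : pred 'I_B := fun a =>
  if enum_val j \in S then (0 < a < rkdrop S (enum_val j))%N else a == 0%N :> nat.

Lemma up_ord d : (d <= B)%N -> up d = \sum_(a < B | (0 < a < d)%N) 'X^a.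
Proof.
move=> hd; rewrite -(big_mkord (fun a => 0 < a < d)%N (fun a => 'X^a)) /up.
rewrite (big_nat_widenl _ 0) // (big_nat_widen _ _ _ _ _ hd).
by apply: eq_bigl => a; rewrite andTb.
Qed.

Lemma wgt_family S : nestedb S ->
  wgt I S = \sum_(f in family (okexp S)) 'X^(\sum_j f j).
Proof.
move=> hS; have sS : S \subset Gs by case/andP: hS.
transitivity (\prod_(j < n) \sum_(a : 'I_B | okexp S j a) ('X^a : {poly rat})); last first.
  rewrite bigA_distr_big_dep; apply: eq_big => // f _.
  by rewrite -(big_morph (fun k => 'X^k : {poly rat}) (exprD 'X) (expr0 'X)).
rewrite /wgt (eq_bigl (fun G => (G \in Gs) && (G \in S))); last first.
  by move=> G; case: (boolP (G \in S)) => h; rewrite ?andbF ?(subsetP sS).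
rewrite (big_enum_val_cond (fun G : {set E} => G \in S)) big_mkcond /=.
apply: eq_bigr => j _; rewrite /okexp; case: ifP => hj.
  apply: up_ord; apply: leq_trans (leq_subr _ _) _.
  apply: leq_trans (rank_leq_card matI _) _; apply: leqW.
  by apply: leq_trans (max_card _) _; apply: leq_addr.
by rewrite (big_pred1 ord0).
Qed.

Definition mnf (f : {ffun 'I_n -> 'I_B}) : 'X_{1..n} := [multinom nat_of_ord (f j) | j < n].

Lemma mdeg_mnf f : mdeg (mnf f) = (\sum_j f j)%N.
Proof. by rewrite mdegE; apply: eq_bigr => j _; rewrite mnmE. Qed.

(** S is recovered as the support of f, so the pairs (S, f) are the standard monomials with
    exponents below the bound. *)
Lemma okexp_standard S (f : {ffun 'I_n -> 'I_B}) :
  nestedb S && (f \in family (okexp S)) = (S == msets (mnf f)) && standard (mnf f).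
Proof.
apply/andP/andP => [[hS /familyP hf]|[/eqP-> /andP[hS /forallP hst]]]; last first.
  split=> //; apply/familyP => j; rewrite unfold_in /okexp mem_msets.
  have := hst j; rewrite mnmE; case: (nat_of_ord (f j)) => //= k; exact.
have sS : S \subset Gs by case/andP: hS.
have hf' j : okexp S j (f j) := hf j.
have SE : S = msets (mnf f).
  apply/setP => G; case: (boolP (G \in Gs)) => hG; last first.
    rewrite (contraNF (subsetP sS G) hG); apply/esym.
    exact: (contraNF (subsetP (msets_building _) G) hG).
  rewrite -(enum_rankK_in hG hG) mem_msets mnmE; set j := enum_rank_in _ _.
  by have := hf' j; rewrite /okexp; case: ifP => _; [case: (nat_of_ord _)|move=> ->].
split; first by rewrite -SE.
rewrite /standard_mnm -SE hS; apply/forallP => j; apply/implyP; rewrite mnmE => h.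
have := hf' j; rewrite /okexp; case: ifP => _; first by case/andP.
by move=> h'; rewrite h' in h.
Qed.

Lemma hpart_coef : (hpart I Gs setT)`_i =
  #|[pred m : 'X_{1..n < i.+1} | standard m && (mdeg m == i)]|%:R.
Proof.
rewrite /hpart coef_sum.
transitivity (\sum_(S | nestedb S) \sum_(f | f \in family (okexp S))
    (i == \sum_j f j)%N%:R : rat).
  apply: eq_big => [S|S /andP[hS _]]; first by rewrite subsetT andbT.
  by rewrite wgt_family // coef_sum; apply: eq_bigr => f _; rewrite coefXn.
rewrite (exchange_big_dep xpredT) //=.
transitivity (\sum_(f | standard (mnf f) && (mdeg (mnf f) == i)) 1 : rat).
  rewrite [RHS]big_mkcond /=; apply: eq_bigr => f _.
  rewrite (eq_bigl _ _ (fun S => okexp_standard S f)).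
  case: (boolP (standard (mnf f))) => hf.
    rewrite (big_pred1 (msets (mnf f))) => [|S]; last by rewrite andbT.
    by rewrite mdeg_mnf eq_sym; case: eqP.
  by rewrite big_pred0 // => S; rewrite andbF.
have h0 : (mdeg (0%MM : 'X_{1..n}) < i.+1)%N by rewrite mdeg0.
(* The value of [insubd] on exponent vectors of degree above i. Its round trip returns the zero
   vector, so none of them is counted. *)
pose m0 := BMultinom h0.
rewrite -(sum1_card [pred m : 'X_{1..n < i.+1} | standard m && (mdeg m == i)]) natr_sum /=.
rewrite [RHS](reindex_onto (fun f => insubd m0 (mnf f))
  (fun m : 'X_{1..n < i.+1} => [ffun j => inord (m j)])) /=; last first.
  move=> m hm; have fE : mnf [ffun j => inord (m j)] = m.
    apply/mnmP => j; rewrite mnmE ffunE inordK // ltnS.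
    have := bmdeg m; rewrite mdegE (bigD1 j) //= ltnS => h.
    by apply: leq_trans (leq_addl _ _); apply: leq_trans h; apply: leq_addr.
  by apply: val_inj; rewrite val_insubd fE bmdeg.
apply: eq_bigl => f; rewrite inE val_insubd.
case: (ltnP (mdeg (mnf f)) i.+1) => hd.
  rewrite (_ : [ffun j => _] = f) ?eqxx ?andbT //.
  by apply/ffunP => j; rewrite ffunE mnmE inord_val.
rewrite (_ : mdeg (mnf f) == i = false) ?andbF; last by apply/negbTE; rewrite neq_ltn hd orbT.
symmetry; apply/negbTE; apply: contraL hd => /andP[_ /eqP <-].
rewrite -ltnNge mdeg_mnf big1 // => j _; rewrite ffunE mnm0E inordK //.
Qed.

End StandardCount.

Lemma hpart_coef0 (E : finType) (I Gs : {set {set E}}) : is_building_set I Gs ->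
  (hpart I Gs setT)`_0 = 1.
Proof.
move=> bldG; rewrite /hpart (bigD1 set0) /=; last by rewrite nested0 subsetT.
rewrite wgt0 coefD coef1 coef_sum big1 ?addr0 // => S /andP[_ /set0Pn[G hG]].
rewrite /wgt (big_setD1 G) //= -horner_coef0 hornerM (_ : (up _).[0] = 0) ?mul0r //.
rewrite /up horner_sum big_nat big1 // => -[//|a] _.
by rewrite hornerXn expr0n.
Qed.

Unset Implicit Arguments.

Theorem theorem5p2 (E : finType) (I Gs : {set {set E}}) :
  is_matroid I -> loopless I -> is_building_set I Gs -> complete I Gs ->
  exists H : {poly rat}, is_chow_poly I Gs H /\ gamma_positive H.
Proof.
move=> matI loopI bldG [s [us alls hc]]; exists (hpart I Gs setT); split.
  move=> i; eexists; split; first exact: (chow_dim_standard matI loopI bldG i).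
  exact: hpart_coef.
have [d hd] := gpos_hpart matI loopI bldG us alls hc (flatT I).
exact: gpos_gamma hd (hpart_coef0 bldG).
Qed.
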